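(* Let $\omega=(\omega_1,\omega_2)\in\mathbb{R}^2$, $M_1=M_2=\mathbb{T}\times\mathbb{R}$, and let $T_0:M_1\times M_2\to M_1\times M_2$ be $T_0\big((\theta_1,r_1),(\theta_2,r_2)\big)=\big((\theta_1+\omega_1+r_1+\mathbb{Z},r_1),(\theta_2+\omega_2+r_2+\mathbb{Z},r_2)\big)$. Let $\alpha>1$ and $L>0$ be real, and put $\gamma=\frac1{\alpha-1}$. There is a constant $C>0$ such that for any $\epsilon>0$ there exist $u\in G^{\alpha,L}(M_1)$ and $v\in G^{\alpha,L}(M_1\times M_2)$ that are $1$-periodic in $r_1$, and a closed set $X_\epsilon\subset[0,1]$ with $\mathrm{Leb}(X_\epsilon)\ge1-\epsilon$, such that (1) $u$ and $v$ are flat for $r_1\in X_\epsilon+\mathbb{Z}$; (2) $\|u\|_{\alpha,L}+\|v\|_{\alpha,L}<\epsilon$; (3) for each $(r_1,r_2)\in(X_\epsilon+\mathbb{Z})\times\mathbb{R}$, the torus $\mathcal{T}_{(r_1,r_2)}=\mathbb{T}^2\times\{(r_1,r_2)\}\subset \mathbb{T}^2\times\mathbb{R}^2\simeq M_1\times M_2$ is invariant and diffusive-$*$ for $T=\Phi^v\circ\Phi^u\circ T_0$, diffusiveness-$*$ being understood with respect to the function $E^*=E^*_{C,\gamma}$.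
   Context: $\mathbb{T}=\mathbb{R}/\mathbb{Z}$, $\mathbb{N}=\{0,1,2,\dots\}$; $\mathrm{Leb}$ is Lebesgue measure. $M_1\times M_2\simeq\mathbb{T}^2\times\mathbb{R}^2$ carries the symplectic form $d\theta_1\wedge dr_1+d\theta_2\wedge dr_2$ and the standard flat product metric. For a function $H$ generating a complete Hamiltonian vector field ($\dot\theta=\partial_rH$, $\dot r=-\partial_\theta H$), $\Phi^H$ denotes the time-$1$ map of its flow. A function $u$ on $M_1$ is viewed as a function on $M_1\times M_2$ independent of $(\theta_2,r_2)$, so $\Phi^u$ acts on $M_1\times M_2$. A function is flat on a set if it vanishes there together with all its partial derivatives of all orders. For a product $D$ of tori and a Euclidean space, with $N$ variables, $G^{\alpha,L}(D)$ is the set of $f\in C^\infty(D)$ with $\|f\|_{\alpha,L}:=\sum_{\ell\in\mathbb{N}^N}\frac{L^{|\ell|\alpha}}{\ell!^\alpha}\|\partial^\ell f\|_{C^0(D)}<\infty$, where $|\ell|=\ell_1+\cdots+\ell_N$, $\ell!=\ell_1!\cdots\ell_N!$. $E_{C,\gamma}(\nu)=\exp(\exp(C\nu^{-\gamma}))$ for $\nu>0$, and $E^*_{C,\gamma}(\nu)=E_{C,\gamma}(\nu/|\ln\nu|)$ for $\nu\in(0,1)$. For a map $T$ on a metric space $(M,d)$ and small $\nu>0$, a point $z\in M$ is $\nu$-diffusive-$*$ if there exist $\hat z\in M$ and a positive integer $t$ such that $d(\hat z,z)\le\nu$, $t\le E^*(\nu)$ and $d(T^t\hat z,z)\ge E^*(2\nu)$.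 A subset $X\subset M$ is $\nu$-diffusive-$*$ if all its points are, and diffusive-$*$ if there is a sequence of positive numbers $\nu_k\to0$ such that $X$ is $\nu_k$-diffusive-$*$ for each $k$. *)

(* Defs.v *)
From HB Require Import structures.
From mathcomp Require Import all_boot all_order all_algebra.
From mathcomp Require Import all_classical all_reals all_analysis.

Set Implicit Arguments.
Unset Strict Implicit.
Unset Printing Implicit Defensive.

Import Order.TTheory GRing.Theory Num.Theory.
Import numFieldNormedType.Exports.

Local Open Scope classical_set_scope.
Local Open Scope ring_scope.

(* Objects on T^n x R^m, where T = R/Z, are represented by their lifts to the
   universal cover R^(n + m): a point is a row vector whose first n coordinates
   are representatives of the angles, and a function is a function on
   'rV[R]_(n + m) that is 1-periodic in the first n coordinates. *)

Section Gevrey.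
Context {R : realType}.

Definition basis_vec (N : nat) (i : 'I_N) : 'rV[R]_N := delta_mx 0 i.

Definition partial (N : nat) (i : 'I_N) (f : 'rV[R]_N -> R) : 'rV[R]_N -> R :=
  'D_(basis_vec i) f.

Definition partials (N : nat) (s : seq 'I_N) (f : 'rV[R]_N -> R) :
  'rV[R]_N -> R := foldr (@partial N) f s.

Definition smooth (N : nat) (f : 'rV[R]_N -> R) : Prop :=
  forall s : seq 'I_N, continuous (partials s f) /\
    forall (i : 'I_N) (x : 'rV[R]_N), derivable (partials s f) x (basis_vec i).

(* The order of the differentiations is immaterial for smooth f. *)
Definition multi_partial (N : nat) (l : {ffun 'I_N -> nat})
    (f : 'rV[R]_N -> R) : 'rV[R]_N -> R :=
  foldr (fun i => iter (l i) (partial i)) f (enum 'I_N).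

Definition periodic_along (N : nat) (i : 'I_N) (f : 'rV[R]_N -> R) : Prop :=
  forall x, f (x + basis_vec i) = f x.

Definition C0norm (N : nat) (f : 'rV[R]_N -> R) : \bar R :=
  ereal_sup (range (fun x => `|f x|%:E)).

Definition gevrey_norm (alpha L : R) (N : nat) (f : 'rV[R]_N -> R) : \bar R :=
  (\esum_(l in [set: {ffun 'I_N -> nat}])
     ((L `^ ((\sum_i l i)%N%:R * alpha) / ((\prod_i (l i)`!)%N%:R `^ alpha))%:E
      * C0norm (multi_partial l f)))%E.

Definition gevrey (alpha L : R) (n m : nat) (f : 'rV[R]_(n + m) -> R) : Prop :=
  [/\ smooth f,
      (forall i : 'I_n, periodic_along (lshift m i) f)
    & (gevrey_norm alpha L f < +oo)%E].

Definition flat_on (N : nat) (A : set 'rV[R]_N) (f : 'rV[R]_N -> R) : Prop :=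
  forall (l : {ffun 'I_N -> nat}) x, A x -> multi_partial l f x = 0.

End Gevrey.

Section Hamiltonian.
Context {R : realType} {n : nat}.

(* Points of T^n x R^n are written row_mx theta r. *)
Definition hamiltonian_field (H : 'rV[R]_(n + n) -> R) (z : 'rV[R]_(n + n)) :
    'rV[R]_(n + n) :=
  row_mx (\row_i partial (rshift n i) H z) (\row_i - partial (lshift n i) H z).

Definition is_flow (H : 'rV[R]_(n + n) -> R)
    (phi : R -> 'rV[R]_(n + n) -> 'rV[R]_(n + n)) : Prop :=
  (forall z, phi 0 z = z) /\
  (forall z (t : R),
     is_derive t 1 (fun s : R => phi s z) (hamiltonian_field H (phi t z))).

(* Since phi is defined for all times, this also says that the Hamiltonian
   vector field is complete. For smooth H integral curves are unique, so that
   Phi is the time-1 map of the flow of H, commuting with integer translations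
   of the angles when H is periodic in them. *)
Definition time_one_map (H : 'rV[R]_(n + n) -> R)
    (Phi : 'rV[R]_(n + n) -> 'rV[R]_(n + n)) : Prop :=
  exists2 phi, is_flow H phi & Phi = phi 1.

End Hamiltonian.

Section Diffusive.
Context {R : realType}.

Definition dbl_exp (C gamma nu : R) : R := expR (expR (C * nu `^ (- gamma))).

Definition dbl_exp_star (C gamma nu : R) : R := dbl_exp C gamma (nu / `|ln nu|).

Definition nu_diffusive_point (Estar : R -> R) (M : Type) (d : M -> M -> R)
    (T : M -> M) (nu : R) (z : M) : Prop :=
  exists (zhat : M) (t : nat), [/\ (0 < t)%N, d zhat z <= nu,
    t%:R <= Estar nu & Estar (2 * nu) <= d (iter t T zhat) z].

(* The bound nu < 1/2 keeps both nu and 2 * nu in ]0, 1[, the domain of E^*. *)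
Definition diffusive (Estar : R -> R) (M : Type) (d : M -> M -> R)
    (T : M -> M) (X : set M) : Prop :=
  exists nu : nat -> R,
    [/\ (forall k, 0 < nu k < 2^-1), nu @ \oo --> 0
      & forall k z, X z -> nu_diffusive_point Estar d T (nu k) z].

End Diffusive.

Section ProductSpace.
Context {R : realType}.

(* Distance from s to the integers, i.e. the distance in R/Z of s to 0. *)
Definition circle_norm (s : R) : R := inf (range (fun k : int => `|s - k%:~R|)).

(* Flat product distance of T^n x R^m, computed on representatives. *)
Definition flat_dist (n m : nat) (z w : 'rV[R]_(n + m)) : R :=
  Num.sqrt (\sum_(i < n) circle_norm ((lsubmx z - lsubmx w) 0 i) ^+ 2
            + \sum_(j < m) ((rsubmx z - rsubmx w) 0 j) ^+ 2).

(* The coordinates are (theta_1, r_1) on M_1 = T x R, and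
   (theta_1, theta_2, r_1, r_2) on M_1 x M_2 = T^2 x R^2. *)
Definition idx_r1_M1 : 'I_(1 + 1) := rshift 1 ord0.
Definition idx_theta1 : 'I_(2 + 2) := lshift 2 ord0.
Definition idx_r1 : 'I_(2 + 2) := rshift 2 ord0.

Definition proj_M1 (z : 'rV[R]_(2 + 2)) : 'rV[R]_(1 + 1) :=
  row_mx (z 0 idx_theta1)%:M (z 0 idx_r1)%:M.

Definition T0 (omega : 'rV[R]_2) (z : 'rV[R]_(2 + 2)) : 'rV[R]_(2 + 2) :=
  row_mx (lsubmx z + omega + rsubmx z) (rsubmx z).

Definition torus (r : 'rV[R]_2) : set 'rV[R]_(2 + 2) := [set z | rsubmx z = r].

Definition plus_int (X : set R) : set R :=
  [set x | exists2 y, X y & exists k : int, x = y + k%:~R].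

End ProductSpace.

(* Main.v *)
(** Near the circles [r1 = c] with [c + omega_1 = p / n], [u] is a Gevrey cutoff
    in [r1] times [mu cos (2 pi n theta_1)], so that in the variables
    [n theta_1], [n (r1 - c)] the map [Phi^u o T0] is a standard map with small
    coupling.  By reversibility and the intermediate value theorem it has an
    orbit of period [q = 2 m + 1] whose action reaches its maximum exactly once
    per period.  There [v] is a narrower cutoff times
    [(2 pi q)^-1 cos (2 pi theta_2)], which kicks [r2] by [1 / q] once per period:
    [theta_2] is 1/4 modulo 1 at every kick, because between two kicks [r2] is a
    multiple of [1 / q] up to [omega_2].  Hence [r2] drifts linearly in time at
    speed [q ^ -2], and every point with [r1] at distance at most [1 / n] of such
    a circle is [4 / n]-close to a drifting orbit.  A Gevrey cutoff of width [w]
    has norm [exp (O (w ^ - gamma))]; the width of [v] is itself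
    [exp (- O (n ^ gamma))], so [q <= exp (exp (O (n ^ gamma)))].  The logarithm
    in [E^*] makes [E^* (nu) / E^* (2 nu)] larger than any such bound with a
    fixed constant in the exponent, which lets [C = 1] work for all [epsilon].
    Finally [X] is what remains of [0, 1] when the supports of all generations of
    circles, of total measure at most [epsilon], are removed. *)

(* For each generation the constants are fixed in the order n, gap width, coupling [sig], width of
   the cutoff of [v], period q. This is consistent because the highest action of the periodic orbit
   exceeds all others by [sig ^+ 2 / 8], a bound without q: the norm of the cutoff of [v] is known
   before q, and q is then taken so large that the factor 1 / q pays for it. Shadowing must fit
   theta_2 and r_2 at once. The drifting orbit starts n steps before its first kick, with theta_2 =
   1/4 - n l / q and r_2 = l / q - omega_2; while l runs over q / n consecutive integers, r_2 moves
   by 1 / n only and theta_2 goes once around the circle. Each Hamiltonian depends on one angle and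
   one action. The field of [v] does not move those two coordinates, so its flow is explicit. The
   flow of [u] comes from Picard iteration and is needed in closed form only where its field is
   constant along the segment covered in unit time. Circles too close to an earlier generation are
   dropped; [X] avoids twice the half-width of every gap, so that the circles within 1 / n of a
   point of [X] all survive. *)
Require Import Defs.
From HB Require Import structures.
From mathcomp Require Import all_boot all_order all_algebra.
From mathcomp Require Import all_classical all_reals all_analysis.
From mathcomp Require Import measurable_realfun.
From mathcomp Require Import ring lra.
Set Implicit Arguments.
Unset Strict Implicit.
Unset Printing Implicit Defensive.

Import Order.TTheory GRing.Theory Num.Theory.
Import numFieldNormedType.Exports.
Local Open Scope classical_set_scope.
Local Open Scope ring_scope.

(** * Calculus of one real variable *)

Section RealCalculus.
Context {R : realType}.
Implicit Types (f g df : R -> R) (x y h l M : R).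

Lemma is_derive_continuous f x l : is_derive x 1 f l -> {for x, continuous f}.
Proof.
by move=> d; apply/differentiable_continuous/derivable1_diffP; case: d.
Qed.

(** Both signs of [h] are covered and the intermediate point is written [x + t * h], so that later
    estimates need no case distinction. *)
Lemma mean_value f df : (forall x, is_derive x 1 f (df x)) ->
  forall x h, exists2 t, 0 <= t <= 1 & f (x + h) - f x = df (x + t * h) * h.
Proof.
move=> dfE x h.
have cf a b : {within `[a, b], continuous f}.
  by apply: continuous_subspaceT => z; exact: is_derive_continuous.
have [->|h0] := eqVneq h 0.
  by exists 0; rewrite ?lexx ?ler01// addr0 subrr mulr0.
have [h_gt0|h_lt0] := ltP 0 h.
- have xh : x <= x + h by rewrite lerDl ltW.
  have [c] := MVT_segment xh (fun z _ => dfE z) (cf _ _).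
  rewrite in_itv/= => /andP[xc cxh] ->; exists ((c - x) / h).
    by rewrite ler_pdivrMr// mul1r lerBlDl cxh divr_ge0 ?subr_ge0// ltW.
  by rewrite divfK// addrCA subrr addr0 addrAC subrr add0r.
- have {h_lt0} h_lt0 : h < 0 by rewrite lt_neqAle h0.
  have xh : x + h <= x by rewrite gerDl ltW.
  have [c] := MVT_segment xh (fun z _ => dfE z) (cf _ _).
  rewrite in_itv/= => /andP[xc cxh] E; exists ((c - x) / h).
    rewrite ler_ndivlMr// mul0r subr_le0 cxh /=.
    by rewrite ler_ndivrMr// mul1r lerBrDl.
  rewrite divfK// addrCA subrr addr0 -opprB E; lra.
Qed.

Lemma derive_bound_lipschitz f df M : (forall x, is_derive x 1 f (df x)) ->
  (forall x, `|df x| <= M) -> forall x y, `|f x - f y| <= M * `|x - y|.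
Proof.
move=> dfE dfM x y; have [t _] := mean_value dfE y (x - y).
by rewrite subrKC => ->; rewrite normrM ler_wpM2r.
Qed.

(** Quadratic remainder bounds add up over a series; this is how sums of series are differentiated
    further on. *)
Lemma quadratic_is_derive f x l M :
  (forall h, `|f (x + h) - f x - l * h| <= M * h ^+ 2) -> is_derive x 1 f l.
Proof.
move=> H.
have M0 : 0 <= M.
  by have := le_trans (normr_ge0 _) (H 1); rewrite expr1n mulr1.
suff cv : (fun h : R => h^-1 *: ((f \o shift x) (h *: 1) - f x)) @ 0^' --> l.
  by apply: DeriveDef; [apply/cvg_ex; exists l | exact/cvg_lim].
apply/cvgrPdist_le => /= e e0.
near=> h.
have h0 : h != 0 by near: h; exact: nbhs_dnbhs_neq.
rewrite /GRing.scale/= mulr1.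
have -> : l - h^-1 * (f (h + x) - f x) = - (h^-1 * (f (x + h) - f x - l * h)).
  by rewrite (addrC h x); field.
rewrite normrN normrM normfV ler_pdivrMl ?normr_gt0//.
rewrite (le_trans (H h))// -normr_id -(real_normK (num_real h)) normr_id.
rewrite expr2 mulrA mulrC ler_pM2l ?normr_gt0//.
have : `|h| <= e / (M + 1).
  by near: h; apply: dnbhs0_le; rewrite divr_gt0// ltr_wpDl.
rewrite ler_pdivlMr ?ltr_wpDl// => he.
by rewrite (le_trans _ he)// mulrC ler_wpM2l// lerDl.
Unshelve. all: by end_near. Qed.

Lemma taylor2_bound f f1 f2 M : (forall x, is_derive x 1 f (f1 x)) ->
  (forall x, is_derive x 1 f1 (f2 x)) -> (forall x, `|f2 x| <= M) ->
  forall x h, `|f (x + h) - f x - f1 x * h| <= M * h ^+ 2.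
Proof.
move=> df df1 f2M x h.
have M0 : 0 <= M := le_trans (normr_ge0 _) (f2M 0).
have [t /andP[t0 t1] ->] := mean_value df x h.
rewrite -mulrBl normrM.
rewrite (le_trans (ler_wpM2r _ (derive_bound_lipschitz df1 f2M _ _)))//.
rewrite addrAC subrr add0r normrM -!mulrA -expr2 real_normK ?num_real//.
rewrite ler_wpM2l// ler_piMl ?sqr_ge0// ger0_norm//.
Qed.

End RealCalculus.

Section Antiderivative.
Context {R : realType}.
Implicit Types (f : R -> R).

Let prim f (a x : R) : R :=
  \int[@lebesgue_measure R]_(t in `[a, x]) f t.

Let prim_derive f (a x : R) : continuous f -> a < x ->
  is_derive x 1 (prim f a) (f x).
Proof.
move=> cf ax.
have xx1 : x < x + 1 by rewrite ltrDl.
have fi : (@lebesgue_measure R).-integrable `[a, x + 1] (EFin \o f).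
  apply: continuous_compact_integrable; first exact: segment_compact.
  exact: continuous_subspaceT.
have [] := continuous_FTC1_closed xx1 fi ax (cf x).
by move=> d dE; apply: (DeriveDef d); rewrite -derive1E.
Qed.

(** The integral from [a] is a primitive only to the right of [a]. Normalised to vanish at 0 it no
    longer depends on [a], so [a] may move with [x]; near a given [x] the moving base point is
    replaced by a fixed one slightly further left. *)
Lemma antiderivative f : continuous f ->
  exists F : R -> R, F 0 = 0 /\ forall x : R, is_derive x 1 F (f x).
Proof.
move=> cf.
pose H a x := prim f a x - prim f a 0.
have dH (a x : R) : a < x -> is_derive x 1 (H a) (f x).
  move=> ax; rewrite /H -[f x]subr0.
  by apply: is_deriveB; exact: prim_derive.
have HH (a b x : R) : a <= b -> b < 0 -> b < x -> H a x = H b x.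
  move=> ab b0 bx.
  suff E (u v : R) : b < u -> u <= v -> H a u - H b u = H a v - H b v.
    have H0 (c : R) : H c 0 = 0 by rewrite /H subrr.
    apply/eqP; rewrite -subr_eq0; apply/eqP.
    have [x0|/ltW x0] := leP x 0; rewrite ?(E _ _ bx x0) -?(E _ _ b0 x0);
      by rewrite !H0 subrr.
  move=> bu uv.
  have dd (z : R) : b < z -> is_derive z 1 (H a \- H b) 0.
    move=> bz; rewrite -[0](subrr (f z)); apply: is_deriveB; apply: dH => //.
    exact: le_lt_trans bz.
  have [||c _] := @MVT_segment R (H a \- H b) (fun=> 0) u v uv.
  - move=> z; rewrite in_itv/= => /andP[uz _]; apply: dd; exact: lt_trans uz.
  - apply: derivable_within_continuous => z; rewrite in_itv/= => /andP[uz _].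
    by case: (dd z (lt_le_trans bu uz)).
  by rewrite mul0r => /eqP; rewrite subr_eq0 => /eqP/= ->.
exists (fun x => H (- (`|x| + 1)) x); split; first by rewrite /H subrr.
move=> x; set a := - (`|x| + 2).
have aN : a < - `|x| by rewrite /a ltrN2 ltrDl.
apply: (@near_eq_is_derive _ _ _ (H a)); last first.
  by apply: dH; rewrite (lt_le_trans aN)// lerNl -normrN ler_norm.
near=> z.
have zx : `|z| < `|x| + 1.
  have : `|x - z| < 1 by near: z; apply: cvgr_dist_lt.
  have : `|z| <= `|x| + `|x - z| by rewrite -[X in `|X|](subKr x) ler_normB.
  lra.
apply: HH; rewrite ?oppr_lt0 ?ltr_wpDl// ?lerN2.
- lra.
- by rewrite ltrNl (le_lt_trans (ler_norm _))// normrN ltrDl.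
Unshelve. all: by end_near. Qed.

End Antiderivative.

Section Telescoping.
Context {R : realType}.

(** [b] decreases and [u - b] increases, both within bounds, so [u] converges as their sum; the
    distance to the limit is the telescoped tail. *)
Lemma telescoping_cvg (u b : nat -> R) :
  (forall n, `|u n.+1 - u n| <= b n - b n.+1) -> (forall n, 0 <= b n) ->
  cvgn u /\ forall n, `|limn u - u n| <= b n.
Proof.
move=> ub b0.
have bS n : b n.+1 <= b n by rewrite -subr_ge0 (le_trans _ (ub n)).
have cb : cvgn b.
  apply: nonincreasing_is_cvgn.
    by apply/nonincreasing_seqP => n; exact: bS.
  by exists 0 => _ [n _ <-].
have dist n m : `|u (n + m)%N - u n| <= b n - b (n + m)%N.
  elim: m => [|m IH]; first by rewrite addn0 !subrr normr0.
  rewrite addnS; have := ler_normD (u (n + m).+1 - u (n + m)%N) (u (n + m)%N - u n).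
  rewrite subrKA => /le_trans; apply.
  by have := ub (n + m)%N; lra.
have cu : cvgn u.
  have -> : u = (u \- b) \+ b by apply/funext => n /=; rewrite subrK.
  apply: is_cvgD => //; apply: nondecreasing_is_cvgn.
    apply/nondecreasing_seqP => n /=.
    by have := ub n; rewrite ler_norml => /andP[]; lra.
  exists (u 0%N + b 0%N) => _ [n _ <-] /=.
  by have := dist 0%N n; rewrite add0n ler_norml => /andP[_]; have := b0 n; lra.
split => // n.
have cd : `|u k - u n| @[k --> \oo] --> `|limn u - u n|.
  by apply: cvg_norm; apply: cvgB => //; exact: cvg_cst.
apply: (closed_cvg (fun x => x <= b n)) cd; first exact: closed_le.
exists n => // k /= nk; rewrite -(subnKC nk).
by rewrite (le_trans (dist _ _))// lerBlDr lerDl.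
Qed.

End Telescoping.

Definition jet {R : realType} (F : nat -> R -> R) : Prop :=
  forall a (x : R), is_derive x 1 (F a) (F a.+1 x).

(** * Smoothing by infinitely many box averages *)

Section Mollifier.
Context {R : realType}.
Implicit Types (g h : R -> R) (a x y e : R).

Definition lipschitz_on_line (M : R) g := forall x y, `|g x - g y| <= M * `|x - y|.

Lemma lipschitz_on_line_continuous M g : lipschitz_on_line M g -> continuous g.
Proof.
move=> gM x; apply/cvgrPdist_le => /= e e0.
have M0 : 0 <= M.
  by have := le_trans (normr_ge0 _) (gM 0 1); rewrite sub0r normrN1 mulr1.
near=> y.
rewrite (le_trans (gM _ _))//.
have : `|x - y| <= e / (M + 1).
  near: y; apply: cvgr_dist_le => //.
  by rewrite divr_gt0// ltr_wpDl.
rewrite ler_pdivlMr ?ltr_wpDl// => he.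
by rewrite (le_trans _ he)// mulrC ler_wpM2l// lerDl.
Unshelve. all: by end_near. Qed.

Definition primitive g : R -> R :=
  xget (fun=> 0) [set G : R -> R | forall x : R, is_derive x 1 G (g x)].

Lemma primitiveP g : continuous g ->
  forall x : R, is_derive x 1 (primitive g) (g x).
Proof.
move=> /antiderivative[G [_ dG]]; rewrite /primitive.
by case: xgetP => [F _ //|/(_ G)]; apply: contra_notP.
Qed.

(** The mean of [g] over [[x, x + a]], that is, convolution with a one-sided box of width [a]. *)
Definition average a g x := (primitive g (x + a) - primitive g x) / a.

Lemma is_derive_translate g x a l :
  is_derive (x + a) 1 g l -> is_derive x 1 (fun y => g (y + a)) l.
Proof.
by move=> dg; apply: is_derive_eq; rewrite addr0 mulr1.
Qed.

Lemma average_value a g x : 0 < a -> continuous g ->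
  exists2 t, 0 <= t <= 1 & average a g x = g (x + t * a).
Proof.
move=> a0 /primitiveP dg; have [t t01 E] := mean_value dg x a.
by exists t => //; rewrite /average E mulfK// gt_eqF.
Qed.

Lemma average_dist a g h e x : 0 < a -> continuous g -> continuous h ->
  (forall x, `|g x - h x| <= e) -> `|average a g x - average a h x| <= e.
Proof.
move=> a0 /primitiveP dg /primitiveP dh gh.
have dgh (z : R) : is_derive z 1 (primitive g \- primitive h) (g z - h z).
  by apply: is_deriveB.
have [t _ /= E] := mean_value dgh x a.
rewrite /average -mulrBl.
have -> : primitive g (x + a) - primitive g x - (primitive h (x + a) - primitive h x)
  = (g (x + t * a) - h (x + t * a)) * a by rewrite -E; ring.
by rewrite mulfK// gt_eqF.
Qed.

(** The mean value theorem is applied to the difference of two translates, which gives one common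
    [t]; preservation of Lipschitz constants and of periods both follow. *)
Lemma average_translation a g x y : 0 < a -> continuous g ->
  exists2 t, 0 <= t <= 1 &
    average a g x - average a g y = g (x + t * a) - g (y + t * a).
Proof.
move=> a0 /primitiveP dg.
have dgh (z : R) : is_derive z 1
   (fun z => primitive g (z + x) - primitive g (z + y)) (g (z + x) - g (z + y)).
  by apply: is_deriveB; apply: is_derive_translate; exact: dg.
have [t t01 /= E] := mean_value dgh 0 a.
exists t => //; rewrite /average -mulrBl.
have -> : primitive g (x + a) - primitive g x - (primitive g (y + a) - primitive g y)
  = (g (x + t * a) - g (y + t * a)) * a.
  by move: E; rewrite !add0r (addrC x) (addrC y) (addrC x) (addrC y) => <-; ring.
by rewrite mulfK// gt_eqF.
Qed.

Lemma average_lipschitz a M g : 0 < a -> lipschitz_on_line M g ->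
  lipschitz_on_line M (average a g).
Proof.
move=> a0 gM x y.
have [t _ ->] := average_translation x y a0 (lipschitz_on_line_continuous gM).
by rewrite (le_trans (gM _ _))// opprD addrACA subrr addr0.
Qed.

Lemma average_close a M g x : 0 < a -> lipschitz_on_line M g ->
  `|average a g x - g x| <= M * a.
Proof.
move=> a0 gM; have M0 : 0 <= M.
  by have := le_trans (normr_ge0 _) (gM 0 1); rewrite sub0r normrN1 mulr1.
have [t /andP[t0 t1] ->] := average_value x a0 (lipschitz_on_line_continuous gM).
rewrite (le_trans (gM _ _))// addrAC subrr add0r ler_wpM2l//.
by rewrite ger0_norm ?mulr_ge0// ?ler_piMl// ltW.
Qed.

Lemma average_derive a g x : continuous g ->
  is_derive x 1 (average a g) ((g (x + a) - g x) / a).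
Proof.
move=> /primitiveP dg; rewrite mulrC.
have -> : average a g = a^-1 \*: (fun y => primitive g (y + a) - primitive g y).
  by apply/funext => y; rewrite /average mulrC.
by apply: is_deriveZ; apply: is_deriveB; apply: is_derive_translate.
Qed.

Section Iterate.
Variables (S : nat -> R) (M : R) (g : R -> R).
Hypothesis S_gt0 : forall n, 0 < S n.
Hypothesis S_decr : forall n, S n.+1 < S n.
Hypothesis S_cvg0 : S @ \oo --> 0.
Hypothesis gM : lipschitz_on_line M g.
Hypothesis g_le1 : forall x, `|g x| <= 1.

Let a k := S k - S k.+1.
Let a_gt0 k : 0 < a k. Proof. by rewrite subr_gt0. Qed.

(** Boxes of widths [a k], ..., [a (k + n - 1)], whose sum telescopes to [S k - S (k + n)]; in the
    limit only the values on [[x, x + S k]] matter. *)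
Fixpoint averages n k f : R -> R :=
  if n is n'.+1 then average (a k) (averages n' k.+1 f) else f.

Let averages_lip n k f : lipschitz_on_line M f ->
  lipschitz_on_line M (averages n k f).
Proof.
by move=> fM; elim: n k => //= n IH k; exact: average_lipschitz.
Qed.

(** Seen from the inside, the additional box changes the function by at most [M * a (k + n)], and
    the outer averages do not enlarge this; the successive differences therefore telescope. *)
Let averagesS n k f : averages n.+1 k f = averages n k (average (a (k + n)) f).
Proof.
elim: n k => [|n IH] k /=; first by rewrite addn0.
by congr average; rewrite -/(averages n.+1 k.+1 f) IH addSnnS.
Qed.

Let averages_dist n k f h e : lipschitz_on_line M f -> lipschitz_on_line M h ->
  (forall x, `|f x - h x| <= e) ->
  forall x, `|averages n k f x - averages n k h x| <= e.
Proof.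
move=> fM hM fh; elim: n k => //= n IH k x.
by apply: average_dist => //; apply: lipschitz_on_line_continuous;
  exact: averages_lip.
Qed.

Let M_ge0 : 0 <= M.
Proof.
by have := le_trans (normr_ge0 _) (gM 0 1); rewrite sub0r normrN1 mulr1.
Qed.

Let averages_step k x n :
  `|averages n.+1 k g x - averages n k g x| <=
   M * S (k + n)%N - M * S (k + n.+1)%N.
Proof.
rewrite averagesS -mulrBr addnS; apply: averages_dist => //.
  exact: average_lipschitz.
by move=> y; exact: average_close.
Qed.

Definition mollify k x := limn (fun n => averages n k g x).

Let mollify_cvg k x : cvgn (fun n => averages n k g x) /\
  forall n, `|mollify k x - averages n k g x| <= M * S (k + n)%N.
Proof.
apply: (@telescoping_cvg _ _ (fun n => M * S (k + n)%N)); first exact: averages_step.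
by move=> n; rewrite mulr_ge0// ltW.
Qed.

Let mollify_lim (P : R -> Prop) k x : closed [set y | P y] ->
  (forall n, P (averages n k g x)) -> P (mollify k x).
Proof.
move=> Pc H; apply: (closed_cvg P) (mollify_cvg k x).1 => //.
by apply: nearW.
Qed.

Let mollify_lip k : lipschitz_on_line M (mollify k).
Proof.
move=> x y.
have cd : `|averages n k g x - averages n k g y| @[n --> \oo] -->
    `|mollify k x - mollify k y|.
  by apply: cvg_norm; apply: cvgB; exact: (mollify_cvg _ _).1.
apply: (closed_cvg (fun z => z <= M * `|x - y|)) cd; first exact: closed_le.
by apply: nearW => n; exact: averages_lip.
Qed.

(** Splitting the outermost box off the limit turns the derivative of [mollify k] into a difference
    quotient of [mollify k.+1]. *)
Let mollify_average k : mollify k = average (a k) (mollify k.+1).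
Proof.
apply/funext => x; apply/eqP; rewrite -subr_eq0 -normr_le0.
have cS : 2 * M * S (k + n.+1)%N @[n --> \oo] --> 0.
  rewrite -[0](mulr0 (2 * M)); apply: cvgMr.
  have : S (n + k.+1)%N @[n --> \oo] --> 0 by rewrite cvg_shiftn.
  by under eq_fun do rewrite addnC addSnnS.
apply: (closed_cvg (fun z => `|mollify k x - average (a k) (mollify k.+1) x| <= z)) cS;
  first exact: closed_ge.
apply: nearW => n.
have h1 := (mollify_cvg k x).2 n.+1.
have h2 : `|average (a k) (mollify k.+1) x - averages n.+1 k g x| <= M * S (k + n.+1)%N.
  have -> : averages n.+1 k g = average (a k) (averages n k.+1 g) by [].
  apply: average_dist => //.
  - by apply: lipschitz_on_line_continuous; exact: mollify_lip.
  - by apply: lipschitz_on_line_continuous; exact: averages_lip.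
  - by move=> y; rewrite -addSnnS; exact: (mollify_cvg _ _).2.
rewrite -(subrKA (averages n.+1 k g x)) (le_trans (ler_normD _ _))//.
by rewrite [X in _ + X]distrC -mulrA mulr_natl mulr2n; exact: lerD.
Qed.

Let mollify_le1 k x : `|mollify k x| <= 1.
Proof.
have le1 n : `|averages n k g x| <= 1.
  elim: n k x => //= n IH k x.
  have [t _ ->] := average_value x (a_gt0 k)
    (lipschitz_on_line_continuous (averages_lip n k.+1 gM)).
  exact: IH.
rewrite ler_norml; apply/andP; split.
- apply: (@mollify_lim (fun z => -1 <= z)); first exact: closed_ge.
  by move=> n; have := le1 n; rewrite ler_norml => /andP[].
- apply: (@mollify_lim (fun z => z <= 1)); first exact: closed_le.
  by move=> n; have := le1 n; rewrite ler_norml => /andP[].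
Qed.

Lemma mollify_cst k c x : (forall y, x <= y <= x + S k -> g y = c) ->
  mollify k x = c.
Proof.
move=> gc; apply: (@mollify_lim (fun z => z = c)); first exact: closed_eq.
move=> n; elim: n k x gc => [|n IH] k x gc /=.
  by apply: gc; rewrite lexx lerDl ltW.
have [t /andP[t0 t1] ->] := average_value x (a_gt0 k)
  (lipschitz_on_line_continuous (averages_lip n k.+1 gM)).
apply: IH => y /andP[y0 y1]; apply: gc.
have ta0 : 0 <= t * a k by rewrite mulr_ge0// ltW.
have ta1 : t * a k <= a k by rewrite ler_piMl// ltW.
by apply/andP; split; move: ta0 ta1 y0 y1; rewrite /a; lra.
Qed.

Lemma mollify_periodic T k x : (forall x, g (x + T) = g x) ->
  mollify k (x + T) = mollify k x.
Proof.
move=> gT; rewrite /mollify; congr (limn _); apply/funext => n.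
elim: n k x => //= n IH k x; apply/eqP; rewrite -subr_eq0; apply/eqP.
have [t _ ->] := average_translation (x + T) x (a_gt0 k)
  (lipschitz_on_line_continuous (averages_lip n k.+1 gM)).
by rewrite addrAC IH subrr.
Qed.

(** Each derivative consumes one box, whose width is the denominator of the next difference
    quotient; hence the product in [mollify_jet_bound]. *)
Fixpoint mollify_jet j k : R -> R :=
  if j is j'.+1
  then fun x => (mollify_jet j' k.+1 (x + a k) - mollify_jet j' k.+1 x) / a k
  else mollify k.

Lemma mollify_jetP k : jet (mollify_jet^~ k).
Proof.
move=> j; elim: j k => [|j IH] k x /=.
  rewrite {1}mollify_average; apply: average_derive.
  by apply: lipschitz_on_line_continuous; exact: mollify_lip.
have -> : (fun x => (mollify_jet j k.+1 (x + a k) - mollify_jet j k.+1 x) / a k) =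
  (a k)^-1 \*: (fun x => mollify_jet j k.+1 (x + a k) - mollify_jet j k.+1 x).
  by apply/funext => y; rewrite /= mulrC.
rewrite [X in is_derive _ _ _ X]mulrC.
by apply: is_deriveZ; apply: is_deriveB; first apply: is_derive_translate; exact: IH.
Qed.

Lemma mollify_jet_periodic T j k x : (forall x, g (x + T) = g x) ->
  mollify_jet j k (x + T) = mollify_jet j k x.
Proof.
move=> gT; elim: j k x => [|j IH] k x /=; first exact: mollify_periodic.
by rewrite addrAC !IH.
Qed.

Lemma mollify_jet_bound j k x :
  `|mollify_jet j k x| <= \prod_(i < j) (2 / a (k + i)%N).
Proof.
elim: j k x => [|j IH] k x /=; first by rewrite big_ord0; exact: mollify_le1.
rewrite big_ord_recl addn0 normrM normfV (gtr0_norm (a_gt0 k)) mulrAC.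
rewrite ler_pM2r ?invr_gt0// (le_trans (ler_normB _ _))//.
have -> : \prod_(i < j) (2 / a (k + lift ord0 i)%N) = \prod_(i < j) (2 / a (k.+1 + i)%N).
  by apply: eq_bigr => i _; rewrite lift0 addSnnS.
by rewrite mulr_natl mulr2n; exact: lerD.
Qed.

End Iterate.
End Mollifier.

(** * Gevrey cutoffs around a set *)

Section Cutoff.
Context {R : realType}.

Definition gevrey_jet (alpha D M : R) (F : nat -> R -> R) : Prop :=
  jet F /\ forall a (x : R), `|F a x| <= M * (D ^+ a * a`!%:R `^ alpha).

Lemma jet_locally_cst (F : nat -> R -> R) (c x : R) : jet F ->
  (\forall y \near x, F 0%N y = c) -> forall a, F a.+1 x = 0.
Proof.
move=> jF Fc a.
have H (y : R) : (\forall z \near y, F 0%N z = c) -> \forall z \near y, F 1%N z = 0.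
  move=> h; have := near_join h.
  apply: filterS => z hz.
  have d0 : is_derive z 1 (F 0%N) 0.
    apply: near_eq_is_derive (is_derive_cst (c : R) (z : R) 1).
    by apply: filterS hz => t ->.
  by have [_ <-] := jF 0%N z; have [_ ->] := d0.
have {}H : \forall z \near x, F a.+1 z = 0.
  elim: a => [|a IH]; first exact: H.
  have := near_join IH; apply: filterS => z hz.
  have d0 : is_derive z 1 (F a.+1) 0.
    apply: near_eq_is_derive (is_derive_cst (0 : R) (z : R) 1).
    by apply: filterS hz => t ->.
  by have [_ <-] := jF a.+1 z; have [_ ->] := d0.
exact: nbhs_singleton H.
Qed.

(** By convexity, the decrement of t^(1 - alpha) dominates the size of its derivative at the right
    end. These decrements will be the box widths, so a lower bound on them bounds the
    derivatives. *)
Lemma powR_decrement (alpha : R) (m : nat) : 1 < alpha -> (0 < m)%N ->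
  (alpha - 1) * m.+1%:R `^ (- alpha) <=
  m%:R `^ (1 - alpha) - m.+1%:R `^ (1 - alpha).
Proof.
move=> al m0.
have m0R : 0 < m%:R :> R by rewrite ltr0n.
have m1R : 0 < m.+1%:R :> R by rewrite ltr0n.
have -> : m.+1%:R `^ (- alpha) = m.+1%:R `^ (1 - alpha) * m.+1%:R^-1 :> R.
  rewrite -powR_inv1 ?ler0n// -powRD ?pnatr_eq0 ?implybT//.
  by congr (_ `^ _); ring.
have -> : m%:R `^ (1 - alpha) =
    m.+1%:R `^ (1 - alpha) * (m.+1%:R / m%:R) `^ (alpha - 1) :> R.
  rewrite powRM ?invr_ge0 ?ler0n// mulrA -powRD ?pnatr_eq0 ?implybT//.
  have -> : 1 - alpha + (alpha - 1) = 0 by ring.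
  rewrite powRr0 mul1r -powR_inv1 ?ler0n// -powRrM.
  by congr (_ `^ _); ring.
rewrite mulrCA -[X in _ <= _ - X]mulr1 -mulrBr ler_pM2l ?powR_gt0//.
have al1 : 0 < alpha - 1 by rewrite subr_gt0.
have nz : m.+1%:R / m%:R != 0 :> R by rewrite gt_eqF// divr_gt0.
rewrite lerBrDl /powR (negbTE nz).
rewrite (le_trans _ (expR_ge1Dx _))// lerD2l ler_pM2l//.
have -> : m.+1%:R / m%:R = (1 + - m.+1%:R^-1)^-1 :> R.
  by rewrite -natr1; field; rewrite addrK natr1 !gt_eqF.
have lt1 : -1 < - m.+1%:R^-1 :> R.
  by rewrite ltrN2 invf_lt1// ltr1n ltnS.
rewrite lnV ?posrE; last by rewrite -ltrBlDl sub0r.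
by rewrite lerNr le_ln1Dx.
Qed.

Lemma bin_le_exp2 n m : ('C(n, m) <= 2 ^ n)%N.
Proof.
elim: n m => [|n IH] [|m] //; first by rewrite bin0 expn_gt0.
by rewrite binS expnS mul2n -addnn leq_add.
Qed.

Lemma powR_nat_prodS (alpha : R) m n : (m * n)%:R `^ alpha = m%:R `^ alpha * n%:R `^ alpha.
Proof. by rewrite natrM powRM ?ler0n. Qed.

Section Scale.
Variables (alpha D : R).
Hypotheses (alpha_gt1 : 1 < alpha) (D_gt0 : 0 < D).

(** Makes 2 / ([cutoff_const] (alpha - 1)) equal to D / 2^alpha; the factor 2^alpha is spent on the
    binomial bound (J + j)! <= 2^(J + j) J! j!. *)
Definition cutoff_const : R := 2 `^ (1 + alpha) / (D * (alpha - 1)).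

Lemma cutoff_const_gt0 : 0 < cutoff_const.
Proof. by rewrite divr_gt0 ?mulr_gt0 ?powR_gt0// subr_gt0. Qed.

Variable J : nat.
Hypothesis J_gt0 : (0 < J)%N.

(** A larger starting index [J] shrinks the total width [S 0], at the price of a factor (2^alpha)^J
    in the derivative bounds. *)
Let S (k : nat) : R := cutoff_const * (J + k)%:R `^ (1 - alpha).

Let S_gt0 k : 0 < S k.
Proof. by rewrite mulr_gt0 ?cutoff_const_gt0 ?powR_gt0// ltr0n addn_gt0 J_gt0. Qed.

Let S_decr_ge k :
  cutoff_const * (alpha - 1) * (J + k).+1%:R `^ (- alpha) <= S k - S k.+1.
Proof.
rewrite -mulrA /S -mulrBr ler_pM2l ?cutoff_const_gt0// addnS.
by apply: powR_decrement => //; rewrite addn_gt0 J_gt0.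
Qed.

Let S_decr k : S k.+1 < S k.
Proof.
rewrite -subr_gt0 (lt_le_trans _ (S_decr_ge k))//.
apply: mulr_gt0; last by rewrite powR_gt0// ltr0n.
by apply: mulr_gt0; [exact: cutoff_const_gt0|rewrite subr_gt0].
Qed.

Let S_cvg0 : S @ \oo --> 0.
Proof.
have al1 : 0 < alpha - 1 by rewrite subr_gt0.
apply/cvgrPdist_le => e e0; near=> k.
rewrite sub0r normrN gtr0_norm// /S.
have k0 : 0 < (J + k)%:R :> R by rewrite ltr0n addn_gt0 J_gt0.
have -> : 1 - alpha = - (alpha - 1) by ring.
rewrite powRN ler_pdivrMr ?powR_gt0// mulrC -ler_pdivrMr//.
have c0 := cutoff_const_gt0.
have -> : cutoff_const / e = ((cutoff_const / e) `^ (alpha - 1)^-1) `^ (alpha - 1).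
  by rewrite -powRrM mulVf ?gt_eqF// powRr1// ltW// divr_gt0.
apply: ge0_ler_powR; rewrite ?nnegrE ?powR_ge0 ?ltW//.
have : (cutoff_const / e) `^ (alpha - 1)^-1 <= k%:R by near: k; exact: nbhs_infty_ger.
by move=> /le_lt_trans; apply; rewrite ltr_nat -[X in (X < _)%N]add0n ltn_add2r.
Unshelve. all: by end_near. Qed.

Let prod_bound j :
  \prod_(i < j) (2 / (S (0 + i)%N - S (0 + i).+1)) <=
  (2 `^ alpha) ^+ J * (D ^+ j * j`!%:R `^ alpha).
Proof.
pose c := 2 / (cutoff_const * (alpha - 1)).
have c0 : 0 < c.
  apply: divr_gt0 => //.
  by apply: mulr_gt0; [exact: cutoff_const_gt0|rewrite subr_gt0].
have step i : 2 / (S i - S i.+1) <= c * (J + i).+1%:R `^ alpha.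
  rewrite ler_pdivrMr ?subr_gt0// (le_trans _ (ler_wpM2l _ (S_decr_ge i)))//;
    last by rewrite mulr_ge0 ?powR_ge0// ltW.
  rewrite powRN mulrACA /c divfK; last first.
    by rewrite mulf_neq0 ?gt_eqF ?cutoff_const_gt0 ?subr_gt0.
  by rewrite mulfV ?mulr1// powR_eq0 pnatr_eq0.
have H : J`!%:R `^ alpha * \prod_(i < j) (2 / (S (0 + i)%N - S (0 + i).+1)) <=
    c ^+ j * (J + j)`!%:R `^ alpha.
  elim: j => [|j IH]; first by rewrite big_ord0 mulr1 addn0 expr0 mul1r.
  rewrite big_ord_recr /= add0n addnS factS powR_nat_prodS.
  rewrite [X in _ <= X](_ : _ = (c ^+ j * (J + j)`!%:R `^ alpha) *
     (c * (J + j).+1%:R `^ alpha)); last by rewrite exprS; ring.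
  rewrite [X in X <= _]mulrA; apply: ler_pM => //.
  - by rewrite mulr_ge0 ?powR_ge0 ?prodr_ge0// => i _; rewrite divr_ge0 ?subr_ge0// ltW.
  - by rewrite divr_ge0 ?subr_ge0// ltW.
have J0 : 0 < J`!%:R `^ alpha :> R by rewrite powR_gt0// ltr0n fact_gt0.
rewrite -(ler_pM2l J0) (le_trans H)//.
have -> : c = D / 2 `^ alpha.
  rewrite /c /cutoff_const powRD; last by rewrite pnatr_eq0 implybT.
  rewrite powRr1//; field.
  by rewrite ?gt_eqF ?powR_gt0// ?subr_gt0.
have fle : (J + j)`!%:R `^ alpha <=
    (2 `^ alpha) ^+ (J + j) * (j`!%:R `^ alpha * J`!%:R `^ alpha) :> R.
  have -> : (2 `^ alpha) ^+ (J + j) = (2 ^ (J + j))%:R `^ alpha :> R.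
    rewrite natrX -(powR_mulrn _ (powR_ge0 _ _)) -(powR_mulrn _ (ler0n R 2)).
    exact: powRAC.
  rewrite -!powR_nat_prodS.
  apply: ge0_ler_powR; rewrite ?nnegrE ?ler0n//; first by rewrite (le_trans ler01)// ltW.
  rewrite ler_nat -(bin_fact (leq_addl J j)) addnK.
  by rewrite leq_mul2r bin_le_exp2 orbT.
have p0 : 0 < 2 `^ alpha :> R by rewrite powR_gt0.
apply: le_trans (ler_wpM2l _ fle) _; first by rewrite exprn_ge0// divr_ge0 ?ltW.
rewrite le_eqVlt; apply/orP; left; apply/eqP.
rewrite expr_div_n exprD.
by field; rewrite expf_neq0// gt_eqF.
Qed.

Section Set_.
Variables (w : R) (A : set R).
Hypotheses (w_gt0 : 0 < w) (J_large : cutoff_const * J%:R `^ (1 - alpha) <= w).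

(** The cap [4 * w] keeps the set nonempty when [A] is empty, where [inf] would return its default
    value; distances beyond [4 * w] are irrelevant to the cutoff. *)
Let dset x := [set 4 * w] `|` [set `|x - c| | c in A].
Let d x := inf (dset x).

Let dset_lb x : has_lbound (dset x).
Proof. by exists 0 => _ [->|[c _ <-]] //; rewrite mulr_ge0// ltW. Qed.

Let d_le x y : d x <= d y + `|x - y|.
Proof.
rewrite -lerBlDr; apply: lb_le_inf; first by exists (4 * w); left.
move=> _ [->|[c Ac <-]].
  rewrite lerBlDr; apply: le_trans (_ : 4 * w <= _); last by rewrite lerDl.
  by apply: ge_inf; [exact: dset_lb|left].
rewrite lerBlDr; apply: le_trans (_ : `|x - c| <= _).
  by apply: ge_inf; [exact: dset_lb|right; exists c].
by have := ler_distD y x c; lra.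
Qed.

Let d_small x c r : A c -> `|x - c| <= r -> d x <= r.
Proof.
move=> Ac; apply: le_trans; apply: ge_inf; [exact: dset_lb|by right; exists c].
Qed.

Let d_large x r : r <= 4 * w -> (forall c, A c -> r <= `|x - c|) -> r <= d x.
Proof.
move=> r4 H; apply: lb_le_inf; first by exists (4 * w); left.
by move=> _ [->//|[c Ac <-]]; exact: H.
Qed.

Let clamp (t : R) : R := Num.min 1 (Num.max 0 t).

Let clamp_lip s t : `|clamp s - clamp t| <= `|s - t|.
Proof.
have H a b : clamp a - clamp b <= `|a - b|.
  have := normr_ge0 (a - b); have := ler_norm (a - b).
  by rewrite /clamp /Num.min /Num.max; do ! case: ifP => //; lra.
by rewrite ler_norml H andbT lerNl opprB (le_trans (H _ _))// distrC.
Qed.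

(** Equal to 1 within [2 * w] of [A] and to 0 beyond [3 * w]. The averages look at most [w] to the
    right, which leaves 1 within [w] and 0 beyond [4 * w]; the fifth [w] provides the neighbourhood
    on which all derivatives vanish. *)
Let g x := clamp (3 - d x / w).

Let g_lip : lipschitz_on_line w^-1 g.
Proof.
move=> x y; rewrite (le_trans (clamp_lip _ _))//.
have -> : 3 - d x / w - (3 - d y / w) = w^-1 * (d y - d x) by ring.
rewrite normrM gtr0_norm ?invr_gt0// ler_pM2l ?invr_gt0//.
rewrite ler_norml; have := d_le x y; have := d_le y x; rewrite (distrC y x); lra.
Qed.

Let g_le1 x : `|g x| <= 1.
Proof.
by rewrite ler_norml /g /clamp /Num.min /Num.max; do ! case: ifP => //; lra.
Qed.

Let g1 x : d x <= 2 * w -> g x = 1.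
Proof.
move=> dx; have : d x / w <= 2 by rewrite ler_pdivrMr.
by rewrite /g /clamp /Num.min /Num.max; do ! case: ifP => //; lra.
Qed.

Let g0 x : 3 * w <= d x -> g x = 0.
Proof.
move=> dx; have : 3 <= d x / w by rewrite ler_pdivlMr.
by rewrite /g /clamp /Num.min /Num.max; do ! case: ifP => //; lra.
Qed.

Let g_periodic : (forall x, A (x + 1) <-> A x) -> forall x, g (x + 1) = g x.
Proof.
move=> A1 x; rewrite /g /d; congr (clamp (3 - inf _ / w)).
rewrite /dset; congr (_ `|` _); apply/seteqP; split=> _ [c Ac <-].
  by exists (c - 1); [apply/A1; rewrite subrK|congr (`|_|); ring].
by exists (c + 1); [apply/A1|congr (`|_|); ring].
Qed.

Let S0w : S 0%N <= w. Proof. by rewrite /S addn0. Qed.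

Lemma gevrey_cutoff : (forall x, A (x + 1) <-> A x) ->
  exists F, [/\ gevrey_jet alpha D ((2 `^ alpha) ^+ J) F,
    (forall a x, F a (x + 1) = F a x),
    (forall x, (exists2 c, A c & `|x - c| <= w) -> F 0%N x = 1),
    (forall x, (exists2 c, A c & `|x - c| < w) -> forall a, F a.+1 x = 0)
    & (forall x, (forall c, A c -> 5 * w <= `|x - c|) -> forall a, F a x = 0)].
Proof.
move=> A1; pose F j := mollify_jet S g j 0.
have jF : jet F by apply: mollify_jetP => //; exact: g_lip.
have F1 x : (exists2 c, A c & `|x - c| <= w) -> F 0%N x = 1.
  move=> [c Ac xc]; apply: (mollify_cst S_gt0 S_decr g_lip) => y /andP[xy yx].
  apply: g1; apply: (d_small Ac).
  move: xc; rewrite !ler_norml; have := S0w; lra.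
have F0 x : (forall c, A c -> 4 * w <= `|x - c|) -> F 0%N x = 0.
  move=> H; apply: (mollify_cst S_gt0 S_decr g_lip) => y /andP[xy yx].
  apply: g0; apply: d_large => [|c /H]; first by rewrite ler_pM2r// ler_nat.
  have := ler_distD y x c.
  have -> : `|x - y| = y - x by rewrite distrC ger0_norm// subr_ge0.
  by have := S0w; lra.
exists F; split => //.
- split => // a x.
  have := mollify_jet_bound S_gt0 S_decr g_lip g_le1 a 0 x.
  by move=> /le_trans; apply; exact: prod_bound.
- by move=> a x; apply: (mollify_jet_periodic S_decr g_lip); exact: g_periodic.
- move=> x [c Ac xc] a; apply: (@jet_locally_cst F 1) => //.
  near=> y; apply: F1; exists c => //.
  have : `|y - x| < w - `|x - c|.
    by rewrite distrC; near: y; apply: cvgr_dist_lt; rewrite // subr_gt0.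
  have := ler_distD x y c; lra.
- move=> x H [|a].
    by apply: F0 => c /H; apply: le_trans; rewrite ler_pM2r// ler_nat.
  apply: (@jet_locally_cst F 0) => //; near=> y; apply: F0 => c /H.
  have : `|x - y| < w by near: y; apply: cvgr_dist_lt.
  have := ler_distD y x c; lra.
Unshelve. all: by end_near. Qed.

End Set_.
End Scale.
End Cutoff.

(** * Dominated series and jets of functions of two variables *)

Section DominatedSum.
Context {R : realType}.
Implicit Types (u v : nat -> R) (m : R).

Definition dsum u : R := limn (fun n => \sum_(k < n) u k).

Definition halving m u : Prop := forall k, `|u k| <= m / 2 ^+ k.+1.

Lemma dsum_cvg m u : halving m u ->
  cvgn (fun n => \sum_(k < n) u k) /\ `|dsum u| <= m.
Proof.
move=> um.
have m0 : 0 <= m.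
  have := le_trans (normr_ge0 _) (um 0%N).
  by rewrite pmulr_lge0 ?invr_gt0// exprn_gt0.
have [|n|cu /(_ 0%N)] := @telescoping_cvg _ (fun n => \sum_(k < n) u k) (fun n => m / 2 ^+ n).
- move=> n; rewrite big_ord_recr /= addrAC subrr add0r (le_trans (um n))//.
  by rewrite le_eqVlt; apply/orP; left; apply/eqP; rewrite exprS; field; rewrite expf_neq0.
- by rewrite divr_ge0 ?exprn_ge0.
by rewrite big_ord0 subr0 expr0 divr1.
Qed.

Lemma dsum_lin m1 m2 (c : R) u v : halving m1 u -> halving m2 v ->
  dsum (fun k => u k + c * v k) = dsum u + c * dsum v.
Proof.
move=> /dsum_cvg[cu _] /dsum_cvg[cv _]; rewrite /dsum.
under eq_fun do rewrite big_split /= -mulr_sumr.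
apply/cvg_lim => //; apply: cvgD => //; exact: cvgMr.
Qed.

Lemma dsum_single u k0 : (forall k, k != k0 -> u k = 0) -> dsum u = u k0.
Proof.
move=> u0; apply: lim_near_cst => //.
exists k0.+1 => // n /= kn.
rewrite (bigD1 (Ordinal kn)) //= big1 ?addr0// => i ik.
by apply: u0; apply: contra ik => /eqP ik; apply/eqP/val_inj.
Qed.

Lemma dsum0 u : (forall k, u k = 0) -> dsum u = 0.
Proof. by move=> u0; rewrite (@dsum_single _ 0%N) => [|k _]; exact: u0. Qed.

(** The second-order Taylor remainders of the terms are dominated by the geometric sequence for
    [m * h ^+ 2], so the sum has a quadratic remainder and [quadratic_is_derive] applies. *)
Lemma dsum_derive m (g g1 g2 : nat -> R -> R) :
  (forall k (x : R), is_derive x 1 (g k) (g1 k x)) ->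
  (forall k (x : R), is_derive x 1 (g1 k) (g2 k x)) ->
  (forall x, halving m (g^~ x)) -> (forall x, halving m (g1^~ x)) ->
  (forall x, halving m (g2^~ x)) ->
  forall x : R, is_derive x 1 (fun x => dsum (g^~ x)) (dsum (g1^~ x)).
Proof.
move=> dg dg1 gm g1m g2m x; apply: (@quadratic_is_derive _ _ _ _ m) => h.
have gm' : halving (2 * m) (fun k => g k (x + h) + (-1) * g k x).
  move=> k; rewrite mulN1r (le_trans (ler_normB _ _))//.
  by have := gm (x + h) k; have := gm x k => /=; lra.
have -> : dsum (g^~ (x + h)) - dsum (g^~ x) - dsum (g1^~ x) * h =
    dsum (fun k => (g k (x + h) + (-1) * g k x) + (- h) * g1 k x).
  rewrite (dsum_lin _ gm' (g1m x)) (dsum_lin _ (gm _) (gm _)); ring.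
suff H : halving (m * h ^+ 2)
    (fun k => (g k (x + h) + (-1) * g k x) + (- h) * g1 k x) by exact: (dsum_cvg H).2.
move=> k /=; have := taylor2_bound (dg k) (dg1 k) (g2m^~ k) x h.
by rewrite mulN1r mulNr (mulrC h) mulrAC.
Qed.

End DominatedSum.

Section Bijet.
Context {R : realType}.
Implicit Types s : nat -> nat -> R -> R -> R.

(* s a b is the mixed partial derivative of order (a, b) of s 0 0. *)
Definition bijet s : Prop :=
  (forall a b (x y : R), is_derive x 1 (fun x => s a b x y) (s a.+1 b x y)) /\
  (forall a b (x y : R), is_derive y 1 (s a b x) (s a b.+1 x y)).

Definition bounded_bijet s : Prop :=
  bijet s /\ forall a b, exists K, forall x y, `|s a b x y| <= K.

Definition gevrey_bijet (alpha D M : R) s : Prop :=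
  bijet s /\ forall a b (x y : R),
    `|s a b x y| <= M * (D ^+ (a + b) * (a`! * b`!)%:R `^ alpha).

Lemma gevrey_bijet_bounded alpha D M s :
  gevrey_bijet alpha D M s -> bounded_bijet s.
Proof. by move=> [js sb]; split=> // a b; eexists => x y; exact: sb. Qed.

Lemma bounded_bijet_lipschitz s : bounded_bijet s -> forall a b,
  exists2 K, 0 < K & forall x y x' y',
    `|s a b x y - s a b x' y'| <= K * (`|x - x'| + `|y - y'|).
Proof.
move=> [[dx dy] sb] a b; have [K1 HK1] := sb a.+1 b; have [K2 HK2] := sb a b.+1.
have K10 : 0 <= K1 by rewrite (le_trans _ (HK1 0 0)).
have K20 : 0 <= K2 by rewrite (le_trans _ (HK2 0 0)).
exists (1 + K1 + K2) => [|x y x' y']; first by lra.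
have h1 := derive_bound_lipschitz (dx a b ^~ y) (HK1 ^~ y) x x'.
have h2 := derive_bound_lipschitz (dy a b x') (HK2 x') y y'.
rewrite -(subrKA (s a b x' y)) (le_trans (ler_normD _ _))//.
rewrite (le_trans (lerD h1 h2))// mulrDr lerD// ler_wpM2r//; lra.
Qed.

(** The weights factor termwise into those of [A k] and [B k]. Three consecutive orders are bounded
    by one constant, because [dsum_derive] wants the same [m] for the terms and their first two
    derivatives. *)
Lemma tensor_series (alpha D M : R) (A B : nat -> nat -> R -> R) (P Q : nat -> R) :
  0 < D -> (forall k, gevrey_jet alpha D (P k) (A k)) ->
  (forall k, gevrey_jet alpha D (Q k) (B k)) ->
  (forall k, P k * Q k <= M / 2 ^+ k.+1) ->
  gevrey_bijet alpha D M (fun a b x y => dsum (fun k => A k a x * B k b y)).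
Proof.
move=> D0 jA jB PQ.
pose w a b := D ^+ (a + b) * (a`! * b`!)%:R `^ alpha.
have H a b x y : halving (M * w a b) (fun k => A k a x * B k b y).
  move=> k; rewrite normrM.
  have h1 := (jA k).2 a x; have h2 := (jB k).2 b y.
  rewrite (le_trans (ler_pM _ _ h1 h2))// mulrACA [leRHS]mulrAC.
  rewrite [X in _ * X](_ : _ = w a b); last first.
    by rewrite /w exprD powR_nat_prodS; ring.
  by rewrite ler_wpM2r// mulr_ge0 ?powR_ge0// exprn_ge0// ltW.
have Hb a b m : w a b <= m -> 0 <= M -> forall x y,
    halving (M * m) (fun k => A k a x * B k b y).
  move=> wm M0 x y k; rewrite (le_trans (H a b x y k))//.
  by rewrite ler_pM2r ?invr_gt0 ?exprn_gt0// ler_wpM2l.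
have w0 a b : 0 <= w a b by rewrite mulr_ge0 ?powR_ge0// exprn_ge0// ltW.
have M0 : 0 <= M.
  have := le_trans (normr_ge0 _) (H 0%N 0%N 0 0 0%N).
  rewrite pmulr_lge0 ?invr_gt0 ?exprn_gt0// /w expr0 !fact0 muln1 powR1 !mulr1//.
split; last by move=> a b x y; exact: (dsum_cvg (H a b x y)).2.
split=> a b x y.
- pose m := w a b + w a.+1 b + w a.+2 b.
  have := w0 a b; have := w0 a.+1 b; have := w0 a.+2 b => w1 w2 w3.
  have dA c k (z : R) : is_derive z 1 (fun z => A k c z * B k b y) (A k c.+1 z * B k b y).
    have -> : (fun z => A k c z * B k b y) = B k b y \*: A k c.
      by apply/funext => z' /=; rewrite mulrC.
    by rewrite mulrC; apply: is_deriveZ; exact: (jA k).1.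
  apply: (@dsum_derive _ (M * m) (fun k x => A k a x * B k b y)
    (fun k x => A k a.+1 x * B k b y) (fun k x => A k a.+2 x * B k b y)) => //;
    by move=> z; apply: Hb => //; rewrite /m; lra.
- pose m := w a b + w a b.+1 + w a b.+2.
  have := w0 a b; have := w0 a b.+1; have := w0 a b.+2 => w1 w2 w3.
  have dB c k (z : R) : is_derive z 1 (fun z => A k a x * B k c z) (A k a x * B k c.+1 z).
    by apply: is_deriveZ; exact: (jB k).1.
  apply: (@dsum_derive _ (M * m) (fun k y => A k a x * B k b y)
    (fun k y => A k a x * B k b.+1 y) (fun k y => A k a x * B k b.+2 y)) => //;
    by move=> z; apply: Hb => //; rewrite /m; lra.
Qed.

End Bijet.

(** * Functions of two of the coordinates, and their Gevrey norm *)

Section Lift.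
Context {R : realType} {N : nat} (i j : 'I_N).
Implicit Types s : nat -> nat -> R -> R -> R.

Definition lift2 (f : R -> R -> R) (x : 'rV[R]_N) : R := f (x 0 i) (x 0 j).

Lemma line_is_derive (f : 'rV[R]_N -> R) (phi : R -> R) (v x : 'rV[R]_N) (t d : R) :
  (forall h : R, f (h *: v + x) = phi (h + t)) -> is_derive t 1 phi d ->
  is_derive x v f d.
Proof.
move=> fphi [dphi <-].
have E : (fun h : R => h^-1 *: ((f \o shift x) (h *: v) - f x)) =
    (fun h : R => h^-1 *: ((phi \o shift t) (h *: 1) - phi t)).
  apply/funext => h /=; rewrite fphi.
  by have := fphi 0; rewrite scale0r !add0r => ->; rewrite /GRing.scale/= mulr1.
by apply: DeriveDef; rewrite /derivable /derive E.
Qed.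

Lemma line_coord (h : R) (k c : 'I_N) (x : 'rV[R]_N) :
  (h *: basis_vec k + x) 0 c = h * (c == k)%:R + x 0 c.
Proof. by rewrite !mxE eqxx. Qed.

Hypothesis ij : i != j.

Lemma lift2_is_derive_l f (x : 'rV[R]_N) (d : R) :
  is_derive (x 0 i) 1 (f^~ (x 0 j)) d -> is_derive x (basis_vec i) (lift2 f) d.
Proof.
apply: line_is_derive => h.
by rewrite /lift2 !line_coord eqxx (eq_sym j) (negbTE ij) mulr1 mulr0 add0r.
Qed.

Lemma lift2_is_derive_r f (x : 'rV[R]_N) (d : R) :
  is_derive (x 0 j) 1 (f (x 0 i)) d -> is_derive x (basis_vec j) (lift2 f) d.
Proof.
apply: line_is_derive => h.
by rewrite /lift2 !line_coord eqxx (negbTE ij) mulr1 mulr0 add0r.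
Qed.

Lemma lift2_is_derive_0 f k (x : 'rV[R]_N) : k != i -> k != j ->
  is_derive x (basis_vec k) (lift2 f) 0.
Proof.
move=> ki kj.
apply: (@line_is_derive _ (cst (lift2 f x)) _ _ 0) => h.
rewrite /lift2 !line_coord (eq_sym i) (eq_sym j) (negbTE ki) (negbTE kj).
by rewrite !mulr0 !add0r.
Qed.

Lemma partial_lift2_l s a b : bijet s ->
  partial i (lift2 (s a b)) = lift2 (s a.+1 b).
Proof.
move=> [ds _]; apply/funext => x; rewrite /partial.
by have [_ ->] := lift2_is_derive_l (ds a b (x 0 i) (x 0 j)).
Qed.

Lemma partial_lift2_r s a b : bijet s ->
  partial j (lift2 (s a b)) = lift2 (s a b.+1).
Proof.
move=> [_ ds]; apply/funext => x; rewrite /partial.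
by have [_ ->] := lift2_is_derive_r (ds a b (x 0 i) (x 0 j)).
Qed.

Lemma partial_lift2_0 f k : k != i -> k != j -> partial k (lift2 f) = cst 0.
Proof.
move=> ki kj; apply/funext => x; rewrite /partial.
by have [_ ->] := lift2_is_derive_0 f x ki kj.
Qed.

Lemma lift2_continuous s a b : bounded_bijet s -> continuous (lift2 (s a b)).
Proof.
move=> sb x; have [K K0 HK] := bounded_bijet_lipschitz sb a b.
apply/(@cvgrPdist_le _ _ _ (nbhs (x : 'rV[R]_N))) => e e0.
have e2 : 0 < e / (K * 2) by rewrite divr_gt0// mulr_gt0.
near=> y.
have xi : `|x 0 i - y 0 i| <= e / (K * 2).
  by near: y; apply: cvgr_dist_le; [exact: (@coord_continuous R 1 N 0 i x)|exact: e2].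
have xj : `|x 0 j - y 0 j| <= e / (K * 2).
  by near: y; apply: cvgr_dist_le; [exact: (@coord_continuous R 1 N 0 j x)|exact: e2].
rewrite (le_trans (HK _ _ _ _))// -ler_pdivlMl// (le_trans (lerD xi xj))//.
by rewrite le_eqVlt; apply/orP; left; apply/eqP; field; rewrite gt_eqF.
Unshelve. all: by end_near. Qed.

Let shift_bijet_l s : bounded_bijet s -> bounded_bijet (fun a => s a.+1).
Proof. by move=> [[d1 d2] sb]; split=> [|a b]; [split=> a b x y|]. Qed.

Let shift_bijet_r s : bounded_bijet s -> bounded_bijet (fun a b => s a b.+1).
Proof. by move=> [[d1 d2] sb]; split=> [|a b]; [split=> a b x y|]. Qed.

Let bijet0 : bounded_bijet (fun _ _ _ _ => 0 : R).
Proof.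
split=> [|a b]; last by exists 0 => x y; rewrite normr0.
by split=> a b x y; exact: (is_derive_cst (0 : R)).
Qed.

(** A partial derivative of a lift is the lift of a shifted jet or of the zero jet, so a single
    induction treats every word of differentiations. *)
Lemma lift2_smooth s : bounded_bijet s -> smooth (lift2 (s 0%N 0%N)).
Proof.
move=> sb.
have H t : exists s', bounded_bijet s' /\
    partials t (lift2 (s 0%N 0%N)) = lift2 (s' 0%N 0%N).
  elim: t => [|k t [s' [sb' E]]] /=; first by exists s.
  rewrite -/(partials t _) E.
  have [->|ki] := eqVneq k i.
    exists (fun a => s' a.+1); split; first exact: shift_bijet_l.
    by rewrite partial_lift2_l//; exact: sb'.1.
  have [->|kj] := eqVneq k j.
    exists (fun a b => s' a b.+1); split; first exact: shift_bijet_r.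
    by rewrite partial_lift2_r//; exact: sb'.1.
  by exists (fun _ _ _ _ => 0); split=> //; rewrite partial_lift2_0.
move=> t; have [s' [sb' ->]] := H t; split=> [|k x].
  exact: lift2_continuous.
have [->|ki] := eqVneq k i.
  by have [] := lift2_is_derive_l (sb'.1.1 0%N 0%N (x 0 i) (x 0 j)).
have [->|kj] := eqVneq k j.
  by have [] := lift2_is_derive_r (sb'.1.2 0%N 0%N (x 0 i) (x 0 j)).
by have [] := lift2_is_derive_0 (s' 0%N 0%N) x ki kj.
Qed.

Lemma multi_partial_lift2 s (l : {ffun 'I_N -> nat}) : bijet s ->
  multi_partial l (lift2 (s 0%N 0%N)) =
  if [forall k, (k != i) && (k != j) ==> (l k == 0%N)]
  then lift2 (s (l i) (l j)) else cst 0.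
Proof.
move=> js; rewrite /multi_partial.
have iter_l n a b : iter n (partial i) (lift2 (s a b)) = lift2 (s (n + a)%N b).
  by elim: n => //= n ->; rewrite partial_lift2_l.
have iter_r n a b : iter n (partial j) (lift2 (s a b)) = lift2 (s a (n + b)%N).
  by elim: n => //= n ->; rewrite partial_lift2_r.
have iter0 n k : iter n (partial k) (cst 0 : 'rV[R]_N -> R) = cst 0.
  elim: n => //= n ->; apply/funext => x; rewrite /partial.
  by rewrite derive_cst.
have H (r : seq 'I_N) : uniq r ->
    foldr (fun k => iter (l k) (partial k)) (lift2 (s 0%N 0%N)) r =
    if all (fun k => (k != i) && (k != j) ==> (l k == 0%N)) r
    then lift2 (s (if i \in r then l i else 0%N) (if j \in r then l j else 0%N))
    else cst 0.
  elim: r => //= k r IH /andP[kr /IH ->].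
  have [all_r|_] := boolP (all _ r); last first.
    by rewrite andbF; exact: iter0.
  rewrite andbT !inE.
  move: kr; have [->|ki] /= := eqVneq k i => kr.
    by rewrite iter_l (negbTE kr) addn0 (eq_sym j) (negbTE ij).
  move: kr; have [->|kj] /= := eqVneq k j => kr.
    by rewrite iter_r (negbTE kr) addn0.
  have [->|] := eqVneq (l k) 0%N; first by [].
  rewrite -lt0n => /prednK <-.
  by rewrite iterSr partial_lift2_0.
rewrite H ?enum_uniq// !mem_enum !inE.
congr (if _ then _ else _); apply/allP/forallP => h k; last by move=> _; exact: h.
by apply: h; rewrite mem_enum.
Qed.

Lemma multi_partial_lift2_eq0 s (l : {ffun 'I_N -> nat}) (x : 'rV[R]_N) : bijet s ->
  (forall a b, s a b (x 0 i) (x 0 j) = 0) ->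
  multi_partial l (lift2 (s 0%N 0%N)) x = 0.
Proof.
by move=> js s0; rewrite multi_partial_lift2//; case: ifP => // _; exact: s0.
Qed.

Lemma esum_half (r : R) : 0 <= r ->
  (\esum_(k in [set: nat]) (r / (2 ^ k.+1)%:R)%:E = r%:E)%E.
Proof.
move=> r0; rewrite -nneseries_esumT; last first.
  by move=> n; rewrite lee_fin divr_ge0.
have := @cvg_geometric_eseries_half R r 0.
rewrite expr0 divr1 => cv; rewrite -[RHS](cvg_lim _ cv)//.
by congr (limn _); apply/funext => n; apply: eq_bigr => k _; rewrite addn1.
Qed.

(** Only multi-indices supported on [i] and [j] contribute, and they are enumerated by pairs (a, b).
    The hypothesis on [D] bounds the corresponding term by M / 2^(a + b), and the double geometric
    series sums to 4 M. *)
Lemma gevrey_norm_lift2 (alpha D L M : R) s : 0 < alpha -> 0 < L ->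
  0 < D -> D * L `^ alpha <= 2^-1 -> 0 <= M -> gevrey_bijet alpha D M s ->
  (gevrey_norm alpha L (lift2 (s 0%N 0%N)) <= (4 * M)%:E)%E.
Proof.
move=> al0 L0 D0 DL M0 [js sb]; rewrite /gevrey_norm.
pose W := [set l : {ffun 'I_N -> nat} |
  [forall k, (k != i) && (k != j) ==> (l k == 0%N)]].
pose t (a b : nat) : \bar R := (4 * M / (2 ^ a.+1)%:R / (2 ^ b.+1)%:R)%:E.
have t0 a b : (0 <= t a b)%E by rewrite lee_fin !divr_ge0// mulr_ge0.
pose enc (p : nat * nat) : {ffun 'I_N -> nat} :=
  [ffun k => if k == i then p.1 else if k == j then p.2 else 0%N].
have enc_i p : enc p i = p.1 by rewrite ffunE eqxx.
have enc_j p : enc p j = p.2 by rewrite ffunE eq_sym (negbTE ij) eqxx.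
have C00 : C0norm (cst 0 : 'rV[R]_N -> R) = 0%E.
  rewrite /C0norm.
  have -> : range (fun x : 'rV[R]_N => (`|(cst 0 : 'rV[R]_N -> R) x|)%:E) = [set 0%E].
    apply/seteqP; split=> [_ [x _ <-]|_ ->]; first by rewrite /= normr0.
    by exists 0 => //=; rewrite normr0.
  by rewrite ereal_sup1.
have enc_bij : set_bij [set: nat * nat] W enc.
  split.
  - move=> p _; apply/forallP => k; apply/implyP => /andP[/negbTE ki /negbTE kj].
    by rewrite ffunE ki kj.
  - move=> p q _ _ pq; case: p q pq => [a b] [a' b'] pq.
    by have := enc_i (a, b); have := enc_j (a, b); rewrite pq enc_i enc_j /= => -> ->.
  - move=> l /forallP Wl; exists (l i, l j) => //; apply/ffunP => k.
    rewrite ffunE; case: eqVneq => [->//|ki]; case: eqVneq => [->//|kj].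
    by have := Wl k; rewrite ki kj /= => /eqP.
apply: (@le_trans _ _
  (\esum_(l in [set: {ffun 'I_N -> nat}]) if l \in W then t (l i) (l j) else 0)%E).
  apply: le_esum => l _; rewrite multi_partial_lift2// /W.
  case: ifP => [Wl|nWl]; last first.
    rewrite ifF; last by apply/negbTE; rewrite notin_setE /= nWl.
    by rewrite C00 mule0.
  rewrite ifT; last by rewrite inE.
  have sumE : (\sum_k l k = l i + l j)%N.
    rewrite (bigD1 i)//= (bigD1 j) 1?eq_sym//= big1 ?addn0// => k /andP[ki kj].
    by have /forallP/(_ k) := Wl; rewrite ki kj => /eqP.
  have prodE : (\prod_k (l k)`! = (l i)`! * (l j)`!)%N.
    rewrite (bigD1 i)//= (bigD1 j) 1?eq_sym//= big1 ?muln1// => k /andP[ki kj].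
    by have /forallP/(_ k) := Wl; rewrite ki kj => /eqP ->.
  rewrite sumE prodE; set n := (l i + l j)%N; set P := (_ * _)%N.
  have P0 : 0 < P%:R `^ alpha :> R.
    by rewrite powR_gt0// ltr0n muln_gt0 !fact_gt0.
  apply: (@le_trans _ _ ((L `^ (n%:R * alpha) / P%:R `^ alpha)%:E *
      (M * (D ^+ n * P%:R `^ alpha))%:E)%E).
    apply: lee_wpmul2l; first by rewrite lee_fin divr_ge0 ?powR_ge0.
    by apply: ge_ereal_sup => _ [x _ <-]; rewrite lee_fin; exact: sb.
  rewrite -EFinM lee_fin mulrC powRrM.
  have -> : (L `^ n%:R) `^ alpha = (L `^ alpha) ^+ n.
    by rewrite -(powR_mulrn _ (powR_ge0 _ _)) powRAC.
  have -> : M * (D ^+ n * P%:R `^ alpha) * (L `^ alpha ^+ n / P%:R `^ alpha) =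
      M * (D * L `^ alpha) ^+ n by rewrite exprMn; field; rewrite gt_eqF.
  have -> : 4 * M / (2 ^ (l i).+1)%:R / (2 ^ (l j).+1)%:R = M * (2^-1) ^+ n :> R.
    by rewrite exprVn /n exprD !natrX !exprS; field; rewrite !expf_neq0.
  rewrite ler_wpM2l// lerXn2r// nnegrE ?mulr_ge0 ?powR_ge0// ltW//.
rewrite -esum_mkcond (reindex_esum _ _ _ _ enc_bij).
under eq_esum do rewrite enc_i enc_j.
have -> : [set: nat * nat] = [set: nat] `*`` (fun=> [set: nat]).
  by apply/seteqP; split.
rewrite -(@esum_esum _ _ _ _ _ t)//.
under eq_esum do rewrite esum_half ?divr_ge0 ?mulr_ge0//.
by rewrite esum_half// mulr_ge0.
Qed.

End Lift.

(** * Picard iteration for bounded Lipschitz planar fields *)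

Section Picard.
Context {R : realType}.

Definition integral0 (h : R -> R) (t : R) : R := primitive h t - primitive h 0.

Lemma integral0_derive h (t : R) : continuous h -> is_derive t 1 (integral0 h) (h t).
Proof.
move=> /primitiveP dh; rewrite -[h t]subr0.
by apply: is_deriveB.
Qed.

Lemma integral0_0 h : integral0 h 0 = 0. Proof. exact: subrr. Qed.

(** In the norm weighted by exp(K |t|) integration gains a factor 1 / K. With K four times the
    Lipschitz constant and two components, the Picard map contracts by 1/2 on the whole line at
    once, so solutions need no continuation in time. *)
Lemma exp_growth_bound (G h : R -> R) (m K : R) : 0 < K -> 0 <= m ->
  G 0 = 0 -> (forall t : R, is_derive t 1 G (h t)) ->
  (forall t, `|h t| <= m * expR (K * `|t|)) ->
  forall t, `|G t| <= m / K * expR (K * `|t|).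
Proof.
move=> K0 m0.
suff H (G' h' : R -> R) : G' 0 = 0 -> (forall t : R, is_derive t 1 G' (h' t)) ->
    (forall t, `|h' t| <= m * expR (K * `|t|)) ->
    forall t : R, G' t <= m / K * expR (K * `|t|).
  move=> G0 dG hm t; rewrite ler_norml (H G h)// andbT lerNl.
  apply: (H (fun t => - G t) (fun t => - h t)) => [|t'].
    by rewrite G0 oppr0.
  by rewrite normrN.
move=> G0 dG hm t.
have mK0 : 0 <= m / K by rewrite divr_ge0// ltW.
have dE (c z : R) : is_derive z 1 (fun z => m / K * expR (c * z))
    (m / K * (expR (c * z) * c)).
  apply: (@is_deriveZ _ _ _ (fun z => expR (c * z)) (m / K)).
  have d1 : is_derive z 1 (c \*: (@id R)) c.
    by rewrite -[X in is_derive _ _ _ X]mulr1; apply: is_deriveZ.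
  have d2 : is_derive (c * z) 1 (@expR R) (expR (c * z)) by exact: is_derive_expR.
  exact: (@is_derive1_comp R expR (c \*: (@id R)) z _ _ d2 d1).
have [t0|t0] := leP 0 t.
- have dphi (z : R) : is_derive z 1 (fun z => m / K * expR (K * z) - G' z)
      (m / K * (expR (K * z) * K) - h' z) by exact: is_deriveB.
  have [s /andP[s0 s1]] := mean_value dphi 0 t.
  rewrite !add0r mulr0 expR0 mulr1 G0 subr0 => E.
  have st0 : 0 <= s * t by rewrite mulr_ge0.
  have : 0 <= (m / K * (expR (K * (s * t)) * K) - h' (s * t)) * t.
    rewrite mulr_ge0// subr_ge0 (le_trans (ler_norm _))// (le_trans (hm _))//.
    rewrite (ger0_norm st0) le_eqVlt; apply/orP; left; apply/eqP.
    by field; rewrite gt_eqF.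
  by rewrite -E (ger0_norm t0) => ?; lra.
- have dphi (z : R) : is_derive z 1 (fun z => m / K * expR (- K * z) - G' z)
      (m / K * (expR (- K * z) * - K) - h' z) by exact: is_deriveB.
  have [s /andP[s0 s1]] := mean_value dphi 0 t.
  rewrite !add0r mulr0 expR0 mulr1 G0 subr0 => E.
  have st0 : s * t <= 0 by rewrite mulr_ge0_le0// ltW.
  have : 0 <= (m / K * (expR (- K * (s * t)) * - K) - h' (s * t)) * t.
    rewrite mulr_le0 ?(ltW t0)//.
    have -> : m / K * (expR (- K * (s * t)) * - K) = - (m * expR (K * `|s * t|)).
      rewrite (ler0_norm st0) (_ : - K * (s * t) = K * - (s * t)); last by ring.
      by field; rewrite gt_eqF.
    by have := hm (s * t); rewrite ler_norml => /andP[]; lra.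
  rewrite -E (ltr0_norm t0) mulrN -mulNr; lra.
Qed.

Lemma le_geometric_eq0 (C z : R) : (forall n : nat, `|z| <= C / 2 ^+ n) -> z = 0.
Proof.
move=> H; apply/eqP; rewrite -normr_le0.
have cv : C / 2 ^+ n @[n --> \oo] --> (0 : R).
  rewrite -[0](mulr0 C); apply: cvgMr.
  have := @cvg_geometric R 1 2^-1.
  rewrite gtr0_norm ?invr_gt0// invf_lt1// ltr1n => /(_ isT).
  rewrite (_ : geometric 1 2^-1 = fun n => 2 ^- n)//.
  by apply/funext => n /=; rewrite mul1r exprVn.
by apply: (closed_cvg (fun y => `|z| <= y)) cv; [exact: closed_ge|exact: nearW].
Qed.

Section Planar.
Variables (f g : R -> R -> R) (Lam B : R).
Hypotheses (Lam_gt0 : 0 < Lam) (B_ge0 : 0 <= B).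
Hypothesis f_lip : forall x y x' y',
  `|f x y - f x' y'| <= Lam * (`|x - x'| + `|y - y'|).
Hypothesis g_lip : forall x y x' y',
  `|g x y - g x' y'| <= Lam * (`|x - x'| + `|y - y'|).
Hypothesis f_le : forall x y, `|f x y| <= B.
Hypothesis g_le : forall x y, `|g x y| <= B.
Variables (x0 y0 : R).

Let f0 := f x0 y0.
Let g0 := g x0 y0.

(** The iteration starts from the tangent line instead of a constant: where the field is constant
    along that line, every iterate reproduces it. *)
Fixpoint picard n : (R -> R) * (R -> R) :=
  if n is n'.+1 then
    let: (X, Y) := picard n' in
    (fun t => x0 + integral0 (fun s => f (X s) (Y s)) t,
     fun t => y0 + integral0 (fun s => g (X s) (Y s)) t)
  else (fun t => x0 + t * f0, fun t => y0 + t * g0).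

Let PX n := (picard n).1.
Let PY n := (picard n).2.

Let PXS n : PX n.+1 = fun t => x0 + integral0 (fun s => f (PX n s) (PY n s)) t.
Proof. by rewrite /PX /PY /=; case: (picard n). Qed.

Let PYS n : PY n.+1 = fun t => y0 + integral0 (fun s => g (PX n s) (PY n s)) t.
Proof. by rewrite /PX /PY /=; case: (picard n). Qed.

Let comp_continuous (k : R -> R -> R) X Y :
  (forall x y x' y', `|k x y - k x' y'| <= Lam * (`|x - x'| + `|y - y'|)) ->
  lipschitz_on_line B X -> lipschitz_on_line B Y ->
  continuous (fun s => k (X s) (Y s)).
Proof.
move=> kl Xl Yl; apply: (@lipschitz_on_line_continuous _ (Lam * (B + B))) => s t.
by rewrite (le_trans (kl _ _ _ _))// -mulrA ler_pM2l// mulrDl lerD.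
Qed.

Let integral_lip (c : R) (h : R -> R) : continuous h -> (forall t, `|h t| <= B) ->
  lipschitz_on_line B (fun t => c + integral0 h t).
Proof.
move=> ch hB; apply: (@derive_bound_lipschitz _ _ h) => // t.
rewrite -[h t]add0r; apply: is_deriveD; exact: integral0_derive.
Qed.

Let P_lip n : lipschitz_on_line B (PX n) /\ lipschitz_on_line B (PY n).
Proof.
elim: n => [|n [IHX IHY]].
  have H (c d : R) : `|d| <= B -> lipschitz_on_line B (fun t => c + t * d).
    move=> dB s t; rewrite opprD addrACA subrr add0r -mulrBl normrM mulrC.
    by rewrite ler_wpM2r.
  by split; apply: H; [exact: f_le|exact: g_le].
by rewrite PXS PYS; split; apply: integral_lip => //; apply: comp_continuous.
Qed.

Let P_cont (k : R -> R -> R) n :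
  (forall x y x' y', `|k x y - k x' y'| <= Lam * (`|x - x'| + `|y - y'|)) ->
  continuous (fun s => k (PX n s) (PY n s)).
Proof. by move=> kl; have [? ?] := P_lip n; exact: comp_continuous. Qed.

Let K := 4 * Lam.
Let K_gt0 : 0 < K. Proof. by rewrite mulr_gt0. Qed.
Let c := 4 * B / K.
Let c_ge0 : 0 <= c. Proof. by rewrite divr_ge0 ?mulr_ge0// ltW. Qed.
Let E (t : R) := expR (K * `|t|).

Let integral0B (h k : R -> R) (m : R) : 0 <= m -> continuous h -> continuous k ->
  (forall t, `|h t - k t| <= m * E t) ->
  forall t, `|integral0 h t - integral0 k t| <= m / K * E t.
Proof.
move=> m0 ch ck hk t.
apply: (@exp_growth_bound (fun t => integral0 h t - integral0 k t)
  (fun t => h t - k t)) => //; first by rewrite !integral0_0 subrr.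
by move=> s; apply: is_deriveB; exact: integral0_derive.
Qed.

Let P_step n t : `|PX n.+1 t - PX n t| + `|PY n.+1 t - PY n t| <= c / 2 ^+ n * E t.
Proof.
elim: n t => [|n IH] t.
  have H (k : R -> R -> R) (z0 d : R) : `|d| <= B -> (forall x y, `|k x y| <= B) ->
      continuous (fun s => k (PX 0 s) (PY 0 s)) ->
      `|z0 + integral0 (fun s => k (PX 0 s) (PY 0 s)) t - (z0 + t * d)| <=
      B * `|t| + B * `|t|.
    move=> dB kB kc; rewrite opprD addrACA subrr add0r (le_trans (ler_normB _ _))//.
    rewrite normrM (mulrC `|t|) lerD ?ler_wpM2r//.
    have := @derive_bound_lipschitz _ _ _ B
      (fun s => integral0_derive s kc) (fun s => kB _ _) t 0.
    by rewrite integral0_0 !subr0.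
  rewrite PXS PYS expr0 divr1.
  apply: le_trans (lerD (H f x0 f0 _ f_le _) (H g y0 g0 _ g_le _)) _;
    rewrite ?f_le ?g_le//; try exact: P_cont.
  have -> : B * `|t| + B * `|t| + (B * `|t| + B * `|t|) = c * (K * `|t|).
    by rewrite /c; field; rewrite gt_eqF.
  rewrite ler_wpM2l// (le_trans _ (expR_ge1Dx _))//; lra.
pose m := c / 2 ^+ n.
have m0 : 0 <= m by rewrite divr_ge0// exprn_ge0.
have H (k : R -> R -> R) :
    (forall x y x' y', `|k x y - k x' y'| <= Lam * (`|x - x'| + `|y - y'|)) ->
    `|integral0 (fun s => k (PX n.+1 s) (PY n.+1 s)) t -
      integral0 (fun s => k (PX n s) (PY n s)) t| <= (Lam * m) / K * E t.
  move=> kl; apply: integral0B; try exact: P_cont.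
    by apply: mulr_ge0 => //; exact: ltW.
  by move=> s; rewrite (le_trans (kl _ _ _ _))// -mulrA ler_pM2l.
have -> : PX n.+2 t - PX n.+1 t = integral0 (fun s => f (PX n.+1 s) (PY n.+1 s)) t -
      integral0 (fun s => f (PX n s) (PY n s)) t.
  by rewrite (PXS n.+1) [in X in _ - X](PXS n) opprD addrACA subrr add0r.
have -> : PY n.+2 t - PY n.+1 t = integral0 (fun s => g (PX n.+1 s) (PY n.+1 s)) t -
      integral0 (fun s => g (PX n s) (PY n s)) t.
  by rewrite (PYS n.+1) [in X in _ - X](PYS n) opprD addrACA subrr add0r.
apply: le_trans (lerD (H f f_lip) (H g g_lip)) _.
rewrite le_eqVlt; apply/orP; left; apply/eqP.
by rewrite /m /K exprS; field; rewrite expf_neq0// gt_eqF.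
Qed.

Let X (t : R) : R := limn (fun n => PX n t).
Let Y (t : R) : R := limn (fun n => PY n t).

Let bnd t n : 2 * c * E t / 2 ^+ n - 2 * c * E t / 2 ^+ n.+1 = c / 2 ^+ n * E t.
Proof. by rewrite exprS; field; rewrite expf_neq0. Qed.

Let E_gt0 t : 0 < E t. Proof. exact: expR_gt0. Qed.

Let bnd_ge0 t n : 0 <= 2 * c * E t / 2 ^+ n.
Proof.
apply: divr_ge0; last by rewrite exprn_ge0.
by apply: mulr_ge0; [exact: mulr_ge0|exact: ltW].
Qed.

Let X_cvg t : cvgn (fun n => PX n t) /\
  forall n, `|X t - PX n t| <= 2 * c * E t / 2 ^+ n.
Proof.
apply: (@telescoping_cvg _ _ (fun n => 2 * c * E t / 2 ^+ n)) => // n.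
by rewrite bnd (le_trans _ (P_step n t))// lerDl.
Qed.

Let Y_cvg t : cvgn (fun n => PY n t) /\
  forall n, `|Y t - PY n t| <= 2 * c * E t / 2 ^+ n.
Proof.
apply: (@telescoping_cvg _ _ (fun n => 2 * c * E t / 2 ^+ n)) => // n.
by rewrite bnd (le_trans _ (P_step n t))// lerDr.
Qed.

Let lim_lip (Z : nat -> R -> R) : (forall t, cvgn (fun n => Z n t)) ->
  (forall n, lipschitz_on_line B (Z n)) ->
  lipschitz_on_line B (fun t => limn (fun n => Z n t)).
Proof.
move=> cZ lZ s t.
have cd : `|Z n s - Z n t| @[n --> \oo] -->
    `|limn (fun n => Z n s) - limn (fun n => Z n t)|.
  by apply: cvg_norm; apply: cvgB; exact: cZ.
apply: (closed_cvg (fun z => z <= B * `|s - t|)) cd; first exact: closed_le.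
by apply: nearW => n; exact: lZ.
Qed.

Let X_lip : lipschitz_on_line B X.
Proof. by apply: lim_lip => [t|n]; [exact: (X_cvg t).1|exact: (P_lip n).1]. Qed.

Let Y_lip : lipschitz_on_line B Y.
Proof. by apply: lim_lip => [t|n]; [exact: (Y_cvg t).1|exact: (P_lip n).2]. Qed.

Let fixpoint (k : R -> R -> R) (z0 : R) (Z : R -> R) (PZ : nat -> R -> R) :
  (forall x y x' y', `|k x y - k x' y'| <= Lam * (`|x - x'| + `|y - y'|)) ->
  (forall t n, `|Z t - PZ n t| <= 2 * c * E t / 2 ^+ n) ->
  (forall n, PZ n.+1 = fun t => z0 + integral0 (fun s => k (PX n s) (PY n s)) t) ->
  forall t, Z t = z0 + integral0 (fun s => k (X s) (Y s)) t.
Proof.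
move=> kl ZP PZS t; apply/eqP; rewrite -subr_eq0; apply/eqP.
apply: (@le_geometric_eq0 (2 * c * E t)) => n.
have h1 := ZP t n.+1.
have h2 : `|integral0 (fun s => k (PX n s) (PY n s)) t -
    integral0 (fun s => k (X s) (Y s)) t| <= (Lam * (4 * c / 2 ^+ n)) / K * E t.
  apply: integral0B.
  - apply: mulr_ge0; first exact: ltW.
    by apply: divr_ge0; [exact: mulr_ge0|rewrite exprn_ge0].
  - exact: P_cont.
  - exact: comp_continuous.
  move=> s; rewrite (le_trans (kl _ _ _ _))// -mulrA ler_pM2l//.
  rewrite distrC (distrC (PY n s)) (le_trans (lerD ((X_cvg s).2 n) ((Y_cvg s).2 n)))//.
  by rewrite le_eqVlt; apply/orP; left; apply/eqP; field; rewrite expf_neq0.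
rewrite -(subrKA (PZ n.+1 t)) (le_trans (ler_normD _ _))//.
have -> : PZ n.+1 t - (z0 + integral0 (fun s => k (X s) (Y s)) t) =
   integral0 (fun s => k (PX n s) (PY n s)) t - integral0 (fun s => k (X s) (Y s)) t.
  by rewrite PZS opprD addrACA subrr add0r.
apply: le_trans (lerD h1 h2) _.
rewrite le_eqVlt; apply/orP; left; apply/eqP.
by rewrite /K exprS; field; rewrite expf_neq0// gt_eqF.
Qed.

Let P_local (t : R) : 0 <= t <= 1 ->
  (forall s, 0 <= s <= 1 -> f (x0 + s * f0) (y0 + s * g0) = f0 /\
                            g (x0 + s * f0) (y0 + s * g0) = g0) ->
  forall n, PX n t = x0 + t * f0 /\ PY n t = y0 + t * g0.
Proof.
move=> t01 H n; elim: n t t01 => [//|n IH] t /andP[t0 t1].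
have I (k : R -> R -> R) (d : R) : continuous (fun s => k (PX n s) (PY n s)) ->
   (forall s, 0 <= s <= 1 -> k (PX n s) (PY n s) = d) ->
   integral0 (fun s => k (PX n s) (PY n s)) t = t * d.
  move=> kc kd.
  have [s /andP[s0 s1]] := mean_value (fun s => integral0_derive s kc) 0 t.
  rewrite !add0r integral0_0 subr0 kd ?(mulrC d)//.
  by rewrite mulr_ge0//= mulr_ile1.
by rewrite PXS PYS (I f f0) ?(I g g0) //; try (exact: P_cont);
  move=> s s01; have [-> ->] := IH s s01; have [] := H s s01.
Qed.

(* The second part locates the solution as long as the field is constant along
   the segment it starts on, which makes a uniqueness statement unnecessary. *)
Lemma planar_solution : exists X Y : R -> R,
  [/\ X 0 = x0, Y 0 = y0,
      (forall t : R, is_derive t 1 X (f (X t) (Y t))),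
      (forall t : R, is_derive t 1 Y (g (X t) (Y t))) &
      (forall s, 0 <= s <= 1 -> f (x0 + s * f0) (y0 + s * g0) = f0 /\
                                g (x0 + s * f0) (y0 + s * g0) = g0) ->
      X 1 = x0 + f0 /\ Y 1 = y0 + g0].
Proof.
have XE := fixpoint f_lip (fun t => (X_cvg t).2) PXS.
have YE := fixpoint g_lip (fun t => (Y_cvg t).2) PYS.
have D (k : R -> R -> R) (z0 : R) (t : R) :
  (forall x y x' y', `|k x y - k x' y'| <= Lam * (`|x - x'| + `|y - y'|)) ->
  is_derive t 1 (fun t => z0 + integral0 (fun s => k (X s) (Y s)) t) (k (X t) (Y t)).
  move=> kl; rewrite -[k _ _]add0r; apply: is_deriveD.
  by apply: (@integral0_derive (fun s => k (X s) (Y s))); exact: comp_continuous.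
exists X, Y; split.
- by rewrite XE integral0_0 addr0.
- by rewrite YE integral0_0 addr0.
- by move=> t; rewrite {1}(funext XE); exact: D.
- by move=> t; rewrite {1}(funext YE); exact: D.
move=> H; have P1 := P_local (_ : 0 <= 1 <= 1) H.
rewrite /X /Y; split.
  rewrite (_ : (fun n => PX n 1) = cst (x0 + f0)) ?lim_cst//.
  by apply/funext => n; rewrite (P1 _ n).1 ?mul1r ?lexx ?ler01.
rewrite (_ : (fun n => PY n 1) = cst (y0 + g0)) ?lim_cst//.
by apply/funext => n; rewrite (P1 _ n).2 ?mul1r ?lexx ?ler01.
Qed.

End Planar.
End Picard.

(** * Hamiltonian flows of functions of one angle and one action *)

Section Flows.
Context {R : realType} {n : nat}.
Implicit Types s : nat -> nat -> R -> R -> R.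

Lemma is_derive_scale_vec N (X : R -> R) (v : 'rV[R]_N) (t d : R) :
  is_derive t 1 X d -> is_derive t 1 (fun y : R => X y *: v) (d *: v).
Proof.
move=> [dX <-].
have cv : (fun h : R => h^-1 *: (((fun y : R => X y *: v) \o shift t) (h *: 1) - X t *: v))
    @ 0^' --> 'D_1 X t *: v.
  have -> : (fun h : R => h^-1 *: (((fun y : R => X y *: v) \o shift t) (h *: 1) - X t *: v))
    = (fun h : R => (h^-1 *: ((X \o shift t) (h *: 1) - X t)) *: v).
    by apply/funext => h /=; rewrite -scalerBl scalerA.
  by apply: cvgZr_tmp; exact: dX.
by apply: DeriveDef; [apply/cvg_ex; eexists; exact: cv|exact: cvg_lim].
Qed.

Section Field.
Variables (a b : 'I_n) (s : nat -> nat -> R -> R -> R).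
Hypothesis js : bijet s.

Let i := lshift n a.
Let j := rshift n b.

Let ij : i != j. Proof. by rewrite eq_lrshift. Qed.

Let H : 'rV[R]_(n + n) -> R := lift2 i j (s 0%N 0%N).

Lemma hamiltonian_field_lift2 z : hamiltonian_field H z =
  lift2 i j (s 0%N 1%N) z *: basis_vec (lshift n b) -
  lift2 i j (s 1%N 0%N) z *: basis_vec (rshift n a).
Proof.
apply/rowP => k; rewrite /hamiltonian_field; case: (split_ordP k) => c ->.
  rewrite row_mxEl !mxE !eqxx /= eq_lrshift mulr0 subr0 eq_lshift.
  have [->|cb] := eqVneq c b.
    by rewrite /H partial_lift2_r// mulr1.
  by rewrite /H partial_lift2_0 ?mulr0// ?eq_rlshift// eq_rshift.
rewrite row_mxEr !mxE !eqxx /= eq_rlshift mulr0 sub0r eq_rshift.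
have [->|cb] := eqVneq c a.
  by rewrite /H partial_lift2_l// mulr1.
by rewrite /H partial_lift2_0 ?mulr0// ?eq_lrshift// eq_lshift.
Qed.

End Field.

(** The field moves only theta_b and r_a while the Hamiltonian depends on theta_a and r_b; as a and
    b differ, the field is constant along its own orbits. *)
Lemma shear_flow (a b : 'I_n) s : bijet s -> a != b ->
  let H : 'rV[R]_(n + n) -> R := lift2 (lshift n a) (rshift n b) (s 0%N 0%N) in
  time_one_map H (fun z => z + hamiltonian_field H z).
Proof.
move=> js ab H; exists (fun t z => z + t *: hamiltonian_field H z); last first.
  by apply/funext => z; rewrite scale1r.
split=> [z|z t]; first by rewrite scale0r addr0.
have -> : hamiltonian_field H (z + t *: hamiltonian_field H z) = hamiltonian_field H z.
  set w := hamiltonian_field H z.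
  have wa : w 0 (lshift n a) = 0.
    rewrite /w hamiltonian_field_lift2// !mxE eq_lshift (negbTE ab) eq_lrshift.
    by rewrite /= !mulr0 subr0.
  have wb : w 0 (rshift n b) = 0.
    rewrite /w hamiltonian_field_lift2// !mxE eq_rshift (eq_sym b) (negbTE ab) eq_rlshift.
    by rewrite /= !mulr0 subr0.
  have E f : lift2 (lshift n a) (rshift n b) f (z + t *: w) =
             lift2 (lshift n a) (rshift n b) f z.
    rewrite /lift2; congr (f _ _).
      by rewrite mxE [X in _ + X]mxE wa mulr0 addr0.
    by rewrite mxE [X in _ + X]mxE wb mulr0 addr0.
  by rewrite hamiltonian_field_lift2// !E /w hamiltonian_field_lift2.
rewrite -[X in is_derive _ _ _ X]add0r; apply: is_deriveD.
rewrite -[X in is_derive _ _ _ X]scale1r.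
exact: is_derive_scale_vec (is_derive_id t 1).
Qed.

(** The closed form serves in two places: on the tori over [X], where the field vanishes, and near
    the center of a gap, where the Hamiltonian depends on the angle alone. *)
Lemma planar_flow (a : 'I_n) s : bounded_bijet s ->
  let H : 'rV[R]_(n + n) -> R := lift2 (lshift n a) (rshift n a) (s 0%N 0%N) in
  exists2 Phi, time_one_map H Phi &
  forall (z : 'rV[R]_(n + n)) (x0 := z 0 (lshift n a)) (y0 := z 0 (rshift n a)),
    (forall t, 0 <= t <= 1 ->
      s 0%N 1%N (x0 + t * s 0%N 1%N x0 y0) (y0 - t * s 1%N 0%N x0 y0) =
        s 0%N 1%N x0 y0 /\
      s 1%N 0%N (x0 + t * s 0%N 1%N x0 y0) (y0 - t * s 1%N 0%N x0 y0) =
        s 1%N 0%N x0 y0) ->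
    Phi z = z + hamiltonian_field H z.
Proof.
move=> bs H; set i := lshift n a; set j := rshift n a.
have [K1 K10 HK1] := bounded_bijet_lipschitz bs 0 1.
have [K2 K20 HK2] := bounded_bijet_lipschitz bs 1 0.
have [B1 HB1] := bs.2 0%N 1%N; have [B2 HB2] := bs.2 1%N 0%N.
have B10 : 0 <= B1 by rewrite (le_trans _ (HB1 0 0)).
have B20 : 0 <= B2 by rewrite (le_trans _ (HB2 0 0)).
pose f := s 0%N 1%N; pose g x y := - s 1%N 0%N x y.
have f_lip x y x' y' : `|f x y - f x' y'| <= (K1 + K2) * (`|x - x'| + `|y - y'|).
  rewrite (le_trans (HK1 _ _ _ _))// ler_wpM2r ?addr_ge0//; lra.
have g_lip x y x' y' : `|g x y - g x' y'| <= (K1 + K2) * (`|x - x'| + `|y - y'|).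
  rewrite /g -opprD normrN (le_trans (HK2 _ _ _ _))// ler_wpM2r ?addr_ge0//; lra.
have f_le x y : `|f x y| <= B1 + B2 by rewrite (le_trans (HB1 _ _))// lerDl.
have g_le x y : `|g x y| <= B1 + B2 by rewrite normrN (le_trans (HB2 _ _))// lerDr.
have K0 : 0 < K1 + K2 by rewrite addr_gt0.
have B0 : 0 <= B1 + B2 by rewrite addr_ge0.
have sol (z : 'rV[R]_(n + n)) : exists phi : R -> 'rV[R]_(n + n), [/\ phi 0 = z,
    (forall t : R, is_derive t 1 phi (hamiltonian_field H (phi t))) &
    (forall t, 0 <= t <= 1 ->
      s 0%N 1%N (z 0 i + t * s 0%N 1%N (z 0 i) (z 0 j)) (z 0 j - t * s 1%N 0%N (z 0 i) (z 0 j)) =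
        s 0%N 1%N (z 0 i) (z 0 j) /\
      s 1%N 0%N (z 0 i + t * s 0%N 1%N (z 0 i) (z 0 j)) (z 0 j - t * s 1%N 0%N (z 0 i) (z 0 j)) =
        s 1%N 0%N (z 0 i) (z 0 j)) ->
    phi 1 = z + hamiltonian_field H z].
  have [X [Y [X0 Y0 dX dY XY1]]] :=
    planar_solution K0 B0 f_lip g_lip f_le g_le (z 0 i) (z 0 j).
  pose phi t := z + ((X t - z 0 i) *: basis_vec i + (Y t - z 0 j) *: basis_vec j).
  have phii t : phi t 0 i = X t.
    rewrite /phi !mxE !eqxx /= eq_lrshift mulr0 addr0 mulr1; ring.
  have phij t : phi t 0 j = Y t.
    rewrite /phi !mxE !eqxx /= eq_rlshift mulr0 add0r mulr1; ring.
  have field w : hamiltonian_field H w =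
      f (w 0 i) (w 0 j) *: basis_vec i + g (w 0 i) (w 0 j) *: basis_vec j.
    by rewrite /H hamiltonian_field_lift2 ?scaleNr//; exact: bs.1.
  exists phi; split.
  - by rewrite /phi X0 Y0 !subrr !scale0r !addr0.
  - move=> t; rewrite field phii phij -[X in is_derive _ _ _ X]add0r.
    apply: is_deriveD; apply: is_deriveD; apply: is_derive_scale_vec.
      by rewrite -[f _ _]subr0; apply: is_deriveB.
    by rewrite -[g _ _]subr0; apply: is_deriveB.
  move=> loc; have [|X1 Y1] := XY1; last first.
    by rewrite field /phi X1 Y1; congr (_ + (_ *: _ + _ *: _)); rewrite /f /g; ring.
  move=> t /loc[e1 e2]; rewrite /g mulrN; split; first exact: e1.
  by congr (- _); exact: e2.
(* Solutions are chosen independently for each initial point; [is_flow] asks for no group law. *)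
pose phi z := sval (cid (sol z)).
have phiP z := svalP (cid (sol z)).
exists (phi ^~ 1).
  exists (fun t z => phi z t) => //; split=> [z|z t]; first by have [] := phiP z.
  by have [_ d _] := phiP z; exact: d.
by move=> z x0 y0 loc; have [_ _ h] := phiP z; exact: h.
Qed.

End Flows.

(** * Symmetric periodic orbits of the standard map *)

Section StandardMap.
Context {R : realType}.
Implicit Types (x y s : R).

Lemma sin_cos_turn x (k : int) :
  sin (2 * pi * (x + k%:~R)) = sin (2 * pi * x) /\
  cos (2 * pi * (x + k%:~R)) = cos (2 * pi * x).
Proof.
suff H (n : nat) (z : R) : sin (2 * pi * (z + n%:R)) = sin (2 * pi * z) /\
    cos (2 * pi * (z + n%:R)) = cos (2 * pi * z).
  case: k => n; first exact: H.
  rewrite NegzE mulrNz; have := H n.+1 (x - n.+1%:~R).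
  by rewrite subrK => -[-> ->].
have -> : 2 * pi * (z + n%:R) = 2 * pi * z + (pi *+ 2) *+ n.
  by rewrite -mulr_natr -(mulr_natr pi); ring.
by rewrite (periodicn (@sinD2pi R)) (periodicn (@cosD2pi R)).
Qed.

Lemma sin_ge_half x : 0 <= x <= 1 -> x / 2 <= sin x.
Proof.
move=> /andP[x0 x1].
have sin_le (z : R) : 0 <= z -> `|sin z| <= z.
  move=> z0; have := @derive_bound_lipschitz R sin cos 1 (@is_derive_sin R) (@cos_max R) z 0.
  by rewrite sin0 !subr0 mul1r (ger0_norm z0).
have [t /andP[t0 t1]] := mean_value (@is_derive_sin R) 0 x.
rewrite !add0r sin0 subr0 => ->; rewrite mulrC ler_wpM2r//.
have tx0 : 0 <= t * x by rewrite mulr_ge0.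
have tx1 : t * x <= 1 by rewrite mulr_ile1.
have -> : t * x = (t * x / 2) *+ 2 by rewrite -mulr_natr divfK.
rewrite cos_mulr2n cos2sin2.
have h0 : 0 <= t * x / 2 by rewrite divr_ge0.
have := sin_le _ h0 => sle.
have : sin (t * x / 2) ^+ 2 <= 4^-1.
  rewrite (_ : 4^-1 = 2^-1 ^+ 2); last by field.
  rewrite -real_normK ?num_real// lerXn2r ?nnegrE//.
  by rewrite (le_trans sle)// ler_pdivrMr// mulVf.
by move: (sin _ ^+ 2) => q hq; rewrite -mulr_natr; lra.
Qed.

Section Orbit.
Variables (sig : R) (m : nat).
Hypotheses (sig_gt0 : 0 < sig) (sig_le : sig <= 64^-1) (m_ge : (8 <= m)%N).

(** Clamping makes the force nonnegative everywhere, so positions grow at least like j s for every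
    initial action s >= 0, as the intermediate value argument requires. The orbit that is found
    stays in [0, 1/2] up to index [m], where clamped and true force agree. *)
Let clamp x := Num.min (Num.max x 0) 2^-1.
Let h x := sig * sin (2 * pi * clamp x).

Let clamp_bd x : 0 <= clamp x <= 2^-1.
Proof. by rewrite /clamp /Num.min /Num.max; do ! case: ifP => //; lra. Qed.

Let sin_turn_ge0 x : 0 <= x <= 2^-1 -> 0 <= sin (2 * pi * x).
Proof.
move=> /andP[x0 x1]; apply: sin_ge0_pi.
have p0 : 0 <= pi :> R by exact: pi_ge0.
rewrite mulr_ge0 ?mulr_ge0//= mulrAC -[leRHS]mul1r ler_wpM2r//; lra.
Qed.

Let h_ge0 x : 0 <= h x.
Proof. by rewrite mulr_ge0 ?(ltW sig_gt0)// sin_turn_ge0. Qed.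

Let h_cont : continuous h.
Proof.
have cc : continuous clamp.
  apply: (@lipschitz_on_line_continuous _ 1) => u v; rewrite mul1r.
  have H a b : clamp a - clamp b <= `|a - b|.
    have := normr_ge0 (a - b); have := ler_norm (a - b).
    by rewrite /clamp /Num.min /Num.max; do ! case: ifP => //; lra.
  by rewrite ler_norml H andbT lerNl opprB (le_trans (H _ _))// distrC.
move=> x; apply: cvgMr; apply: continuous_comp; last exact: continuous_sin.
by apply: cvgMr; exact: cc.
Qed.

Fixpoint orbit (k : R -> R) j s : R * R :=
  if j is j'.+1 then
    let: (x, y) := orbit k j' s in (x + y, y + k (x + y))
  else (0, s).

Let X k j s := (orbit k j s).1.
Let Y k j s := (orbit k j s).2.

Let XS k j s : X k j.+1 s = X k j s + Y k j s.
Proof. by rewrite /X /Y /=; case: orbit. Qed.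

Let YS k j s : Y k j.+1 s = Y k j s + k (X k j.+1 s).
Proof. by rewrite XS /X /Y /=; case: orbit. Qed.

Let XY_cont j : continuous (X h j) /\ continuous (Y h j).
Proof.
elim: j => [|j [cX cY]].
  by split => s; [exact: cvg_cst|exact: cvg_id].
have -> : X h j.+1 = fun s => X h j s + Y h j s by apply/funext => s; exact: XS.
have cX1 : continuous (fun s => X h j s + Y h j s).
  by move=> s; apply: cvgD; [exact: cX|exact: cY].
split=> //.
have -> : Y h j.+1 = fun s => Y h j s + h (X h j s + Y h j s).
  by apply/funext => s; rewrite YS XS.
have ch : continuous (h \o (fun s => X h j s + Y h j s)).
  by move=> s; apply: continuous_comp; [exact: (cX1 s)|exact: h_cont].
by move=> s; apply: cvgD; [exact: cY|exact: (ch s)].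
Qed.

Let Y_ge j s : s <= Y h j s.
Proof. by elim: j => [|j IH] //; rewrite YS (le_trans IH)// lerDl. Qed.

Let X_ge j s : j%:R * s <= X h j s.
Proof.
elim: j => [|j IH]; first by rewrite mul0r.
by rewrite XS -natr1 mulrDl mul1r lerD.
Qed.

(** An orbit from x = 0 satisfying this equation is mapped to itself, with time reversed, by x -> 1
    - x; hence it advances by exactly 1 in 2 m + 1 steps and its action returns to s. *)
Let start : exists2 s, 0 <= s & X h m s + X h m.+1 s = 1.
Proof.
have G_cont : {within `[0, 1], continuous (fun s => X h m s + X h m.+1 s)}.
  apply: continuous_subspaceT => s; apply: cvgD; exact: (XY_cont _).1.
have h00 : h 0 = 0 by rewrite /h /clamp maxxx min_l// ?invr_ge0// mulr0 sin0 mulr0.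
have XY0 j : X h j 0 = 0 /\ Y h j 0 = 0.
  by elim: j => [|j [X0 Y0]] //; rewrite YS XS X0 Y0 !add0r h00.
have [|s] := IVT ler01 G_cont (v := 1).
  rewrite (XY0 m).1 (XY0 m.+1).1 addr0 minEle maxEle.
  have G1 : 1 <= X h m 1 + X h m.+1 1.
    have := X_ge m.+1 1; have := X_ge m 1; rewrite !mulr1 -natr1.
    have : 0 <= m%:R :> R by []; lra.
  by rewrite (le_trans ler01 G1) ler01 G1.
by rewrite in_itv/= => /andP[s0 _] E; exists s.
Qed.

(** Actions increase up to index [m] and then run through the same values backwards, so [m] is the
    only maximum in a period. *)
Lemma standard_map_orbit : exists x y : nat -> R,
  [/\ (forall j, x j.+1 = x j + y j),
      (forall j, y j.+1 = y j + sig * sin (2 * pi * x j.+1)),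
      (forall j, x (j + m.*2.+1)%N = x j + 1),
      (forall j, y (j + m.*2.+1)%N = y j) &
  [/\ (forall j, 0 <= y j <= y m), y m ^+ 2 <= (m%:R * 2)^-1 ^+ 2 + sig,
      (forall j, (j %% m.*2.+1)%N != m -> y j <= y m - sig ^+ 2 / 8)
      & sig / 8 <= y m]].
Proof.
have [s s0 sE] := start.
pose k x := sig * sin (2 * pi * x).
pose x j := X k j s; pose y j := Y k j s.
have xS j : x j.+1 = x j + y j by exact: XS.
have yS j : y j.+1 = y j + k (x j.+1) by exact: YS.
have X_mono i j : (i <= j)%N -> X h i s <= X h j s.
  move=> /subnKC <-; elim: (j - i)%N => [|n IH]; first by rewrite addn0.
  by rewrite addnS XS (le_trans IH)// lerDl (le_trans s0).
have Xm : X h m s <= 2^-1.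
  by have := X_mono m m.+1 (leqnSn m); lra.
have Xbd j : (j <= m)%N -> 0 <= X h j s <= 2^-1.
  by move=> jm; rewrite (le_trans (X_mono _ _ jm) Xm) (X_mono 0%N j).
have hk z : 0 <= z <= 2^-1 -> h z = k z.
  move=> /andP[z0 z1]; rewrite /h /k; congr (sig * sin (2 * pi * _)).
  by rewrite /clamp (max_l z0) (min_l z1).
have xyE j : (j <= m)%N -> x j = X h j s /\ y j = Y h j s.
  elim: j => [//|j IH] jm; have [xj yj] := IH (ltnW jm).
  have xj1 : x j.+1 = X h j.+1 s by rewrite xS XS xj yj.
  by split=> //; rewrite yS YS xj1 yj hk//; exact: Xbd.
have xbd j : (j <= m)%N -> 0 <= x j <= 2^-1.
  by move=> jm; rewrite (xyE j jm).1; exact: Xbd.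
have xm1 : x m + x m.+1 = 1.
  by rewrite xS (xyE m _).1// (xyE m _).2// -XS.
have k_ge0 z : 0 <= z <= 2^-1 -> 0 <= k z.
  by move=> z01; rewrite mulr_ge0 ?(ltW sig_gt0)// sin_turn_ge0.
have y_mono i j : (i <= j)%N -> (j <= m)%N -> y i <= y j.
  move=> /subnKC <-; elim: (j - i)%N => [|n IH]; first by rewrite addn0.
  rewrite addnS => im; rewrite yS (le_trans (IH (ltnW im)))// lerDl k_ge0//.
  exact: xbd.
have k_turn z : k (1 - z) = - k z.
  rewrite /k addrC (sin_cos_turn (- z) 1).1 mulrN sinN mulrN //.
have sym i : (i <= m)%N -> x (m.+1 + i)%N = 1 - x (m - i)%N /\ y (m + i)%N = y (m - i)%N.
  elim: i => [|i IH] im; first by rewrite !addn0 subn0; split=> //; lra.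
  have [xi yi] := IH (ltnW im).
  have e : (m - i = (m - i.+1).+1)%N by rewrite subnSK.
  have yE : y (m + i.+1)%N = y (m - i.+1)%N.
    by rewrite addnS yS yi -addSn xi k_turn e yS; ring.
  by split=> //; rewrite addnS xS xi addSn -addnS yE e xS; ring.
have xq : x m.*2.+1 = 1.
  by rewrite -addnn -addSn (sym m _).1// subnn subr0.
have y2m : y m.*2 = s by rewrite -addnn (sym m _).2// subnn.
have yq : y m.*2.+1 = s.
  rewrite yS xq y2m -[X in k X]subr0 k_turn /k mulr0 sin0 mulr0 oppr0 addr0//.
have per j : x (j + m.*2.+1)%N = x j + 1 /\ y (j + m.*2.+1)%N = y j.
  elim: j => [|j [xj yj]]; first by rewrite add0n xq yq add0r.
  have xj1 : x (j.+1 + m.*2.+1)%N = x j.+1 + 1 by rewrite addSn xS xj yj xS; ring.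
  split=> //; rewrite addSn yS yj -addSn xj1 yS; congr (_ + sig * _).
  exact: (sin_cos_turn _ 1).1.
have y_mod j : y j = y (j %% m.*2.+1)%N.
  rewrite {1}(divn_eq j m.*2.+1) addnC; elim: (j %/ _)%N => [|n IH].
    by rewrite mul0n addn0.
  by rewrite mulSn addnCA addnC (per _).2.
have y_sym j : (j <= m.*2)%N -> exists2 i, (i <= m)%N & (j != m -> (i < m)%N) /\ y j = y i.
  move=> j2; have [jm|mj] := leqP j m.
    by exists j => //; split=> // jm'; rewrite ltn_neqAle jm'.
  exists (m - (j - m))%N; first exact: leq_subr.
  split; first by move=> _; rewrite ltn_subrL subn_gt0 mj (leq_trans _ m_ge).
  rewrite -(sym (j - m)%N _).2 ?subnKC ?(ltnW mj)//.
  by rewrite leq_subLR addnn.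
have y0 j : (j <= m)%N -> s <= y j by move=> jm; exact: (y_mono 0%N).
(* Discrete energy estimate: one step raises the squared action by the kick times [y j.+1 + y j],
   and this sum equals x_(j+2) - x_j, so the bound telescopes. At [m] the symmetry gives
   [x m + x m.+1 = 1]. *)
have energy j : (j <= m)%N -> y j ^+ 2 <= s ^+ 2 + sig * (x j.+1 + x j - s).
  elim: j => [_|j IH jm].
    by rewrite xS /x /X /= !add0r addr0 subrr mulr0 addr0.
  have := IH (ltnW jm); have := xbd _ jm => xj1.
  have kj0 := k_ge0 _ xj1.
  have ks : k (x j.+1) <= sig by rewrite -[leRHS]mulr1 ler_pM2l// sin_le1.
  have : k (x j.+1) * (y j.+1 + y j) <= sig * (y j.+1 + y j).
    by rewrite ler_wpM2r// addr_ge0 ?(le_trans s0) ?y0// ltnW.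
  have -> : y j.+1 ^+ 2 = y j ^+ 2 + k (x j.+1) * (y j.+1 + y j).
    by rewrite yS; ring.
  rewrite (xS j.+1) (xS j); lra.
have m0 : 0 < m%:R :> R by rewrite ltr0n (leq_trans _ m_ge).
have s_le : s <= (m%:R * 2)^-1.
  rewrite -div1r ler_pdivlMr ?mulr_gt0//.
  have := X_ge m s; have : 0 <= s by []; lra.
have ym2 : y m ^+ 2 <= (m%:R * 2)^-1 ^+ 2 + sig.
  have := energy m (leqnn m).
  have : s ^+ 2 <= (m%:R * 2)^-1 ^+ 2 by rewrite lerXn2r// nnegrE// invr_ge0 mulr_ge0// ltW.
  have : 0 <= sig * s by rewrite mulr_ge0// ltW.
  have -> : x m.+1 + x m = 1 by rewrite addrC.
  lra.
have ym0 : 0 <= y m by rewrite (le_trans s0)// y0.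
have ym4 : y m <= 4^-1.
  rewrite -(ler_pXn2r (n := 2))// ?nnegrE// (le_trans ym2)//.
  have : (m%:R * 2)^-1 ^+ 2 <= (16^-1) ^+ 2 :> R.
    rewrite lerXn2r ?nnegrE ?invr_ge0 ?mulr_ge0 ?(ltW m0)//.
    rewrite lef_pV2 ?posrE ?mulr_gt0//.
    have : 8 <= m%:R :> R by rewrite ler_nat.
    lra.
  have := sig_le; lra.
have pi2 := @pi_ge2 R.
have pi4 : pi <= 4 :> R by have := @pihalf_lt2 R; lra.
have xmE : x m = (1 - y m) / 2 by have := xS m; lra.
(* When the steps are short, the first position beyond 1/16 is still at most 1/8, and the kick
   received there alone is at least [sig / 8]. *)
have ylow : sig / 8 <= y m.
  have [big|small] := leP (16^-1) (y m).
    by have := sig_le; lra.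
  have ex : exists j, 16^-1 <= x j by exists m; rewrite xmE; lra.
  case: (ex_minnP ex) => -[|j] xj jmin.
    by move: xj; rewrite /x /X /=; lra.
  have jm : (j.+1 <= m)%N by apply: jmin; rewrite xmE; lra.
  have xj' : x j < 16^-1.
    by rewrite ltNge; apply/negP => /jmin; rewrite ltnn.
  have xle : x j.+1 <= 8^-1.
    have := y_mono j m (ltnW jm) (leqnn m); rewrite xS; lra.
  have := y_mono j.+1 m jm (leqnn m); rewrite yS.
  have yj0 := le_trans s0 (y0 j (ltnW jm)).
  have : (2 * pi * x j.+1) / 2 <= sin (2 * pi * x j.+1).
    apply: sin_ge_half; rewrite !mulr_ge0 ?pi_ge0//=; last by lra.
    have : pi * x j.+1 <= 4 * 8^-1 by rewrite ler_pM ?pi_ge0//; lra.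
    lra.
  have : 2 * 16^-1 <= pi * x j.+1 by rewrite ler_pM//; lra.
  move=> h1 h2; have : sig * 8^-1 <= k (x j.+1) by rewrite ler_pM2l//; lra.
  lra.
(* The last rise before the maximum is [sig * sin (pi * y m)], since [x m = (1 - y m) / 2]; this is
   at least [sig * y m], and [y m] is at least [sig / 8]. *)
have gap j : (j %% m.*2.+1)%N != m -> y j <= y m - sig ^+ 2 / 8.
  move=> jm; rewrite y_mod.
  have [] := y_sym (j %% m.*2.+1)%N; first by rewrite -ltnS ltn_pmod.
  move=> i im [/(_ jm) im' ->].
  have m1 : (m = m.-1.+1)%N by rewrite prednK// (leq_trans _ m_ge).
  have : y i <= y m.-1 by apply: y_mono; rewrite ?leq_pred// -ltnS -m1.
  have : y m = y m.-1 + k (x m) by rewrite {1}m1 yS -m1.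
  have : k (x m) = sig * sin (pi * y m).
    have -> : pi * y m = pi - 2 * pi * x m by rewrite xmE; field.
    by rewrite sinB sinpi cospi; rewrite /k; ring.
  have : pi * y m / 2 <= sin (pi * y m).
    apply: sin_ge_half; rewrite mulr_ge0 ?pi_ge0//=.
    have : pi * y m <= 4 * 4^-1 by rewrite ler_pM ?pi_ge0//.
    lra.
  have : 2 * y m <= pi * y m by rewrite ler_wpM2r.
  move=> h1 h2 h3 h4 h5.
  have : sig * (sig / 8) <= sig * sin (pi * y m) by rewrite ler_pM2l//; lra.
  lra.
exists x, y; split=> //.
- by move=> j; exact: (per j).1.
- by move=> j; exact: (per j).2.
split=> // j; rewrite y_mod.
have [|i im [_ ->]] := y_sym (j %% m.*2.+1)%N; first by rewrite -ltnS ltn_pmod.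
by rewrite (le_trans s0) ?y0//= y_mono.
Qed.

End Orbit.
End StandardMap.

(** * Gevrey weights of trigonometric functions *)

Section TrigJet.
Context {R : realType}.
Implicit Types alpha D w : R.

(** An upper bound for w^a / (D^a a!^alpha) over all a: with y = (w / D)^(1 / alpha) the quotient is
    (y^a / a!)^alpha, at most exp(alpha y). *)
Definition trig_weight alpha D w : R := expR (alpha * (w / D) `^ alpha^-1).

Definition cos_jet w (a : nat) (x : R) : R := w ^+ a * cos (w * x + a%:R * (pi / 2)).

Lemma cos_jetP w : jet (cos_jet w).
Proof.
move=> a x; rewrite /cos_jet.
have d1 : is_derive x 1 (fun x => w * x + a%:R * (pi / 2)) w.
  rewrite -[X in is_derive _ _ _ X]addr0 -[X in is_derive _ _ _ (X + _)]mulr1.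
  by apply: is_deriveD; apply: is_deriveZ.
have d2 : is_derive (w * x + a%:R * (pi / 2)) 1 (@cos R) (- sin (w * x + a%:R * (pi / 2))).
  exact: is_derive_cos.
have d3 := @is_derive1_comp R cos _ x _ _ d2 d1.
apply: is_derive_eq (is_deriveZ (w ^+ a) d3) _.
have -> : w * x + a.+1%:R * (pi / 2) = w * x + a%:R * (pi / 2) + pi / 2.
  by rewrite -[a.+1%:R]natr1; ring.
rewrite /GRing.scale/= exprSr cosDpihalf; ring.
Qed.

Lemma gevrey_cos_jet alpha D w : 0 < alpha -> 0 < D -> 0 <= w ->
  gevrey_jet alpha D (trig_weight alpha D w) (cos_jet w).
Proof.
move=> al0 D0 w0; split=> [|a x]; first exact: cos_jetP.
rewrite /cos_jet normrM ger0_norm ?exprn_ge0//.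
rewrite (le_trans (ler_piMr _ (cos_max _))) ?exprn_ge0//.
set y := (w / D) `^ alpha^-1.
have y0 : 0 <= y by exact: powR_ge0.
have wy : w = y `^ alpha * D.
  rewrite /y -powRrM mulVf ?gt_eqF// powRr1 ?divfK ?gt_eqF//.
  by rewrite divr_ge0// ltW.
have ya : y ^+ a <= expR y * a`!%:R.
  rewrite -ler_pdivrMr ?ltr0n ?fact_gt0//.
  case: a => [|a]; first by rewrite expr0 fact0 divr1 -expR0 ler_expR.
  by rewrite (le_trans _ (expR_ge1Dxn a y0))// lerDr.
rewrite {1}wy exprMn mulrCA mulrC ler_wpM2l ?exprn_ge0 ?(ltW D0)//.
have -> : (y `^ alpha) ^+ a = (y ^+ a) `^ alpha.
  by rewrite -(powR_mulrn _ (powR_ge0 _ _)) -(powR_mulrn _ y0) powRAC.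
have -> : trig_weight alpha D w * a`!%:R `^ alpha = (expR y * a`!%:R) `^ alpha.
  by rewrite /trig_weight -/y powRM ?expR_ge0 ?ler0n// (mulrC alpha) expRM.
by apply: ge0_ler_powR; rewrite ?nnegrE ?exprn_ge0 ?mulr_ge0 ?expR_ge0 ?ler0n// (ltW al0).
Qed.

Lemma gevrey_jet_scale alpha D M c (F : nat -> R -> R) : 0 <= c ->
  gevrey_jet alpha D M F -> gevrey_jet alpha D (c * M) (fun a x => c * F a x).
Proof.
move=> c0 [jF FM]; split=> a x; first by apply: is_deriveZ; exact: jF.
by rewrite normrM ger0_norm// -mulrA ler_wpM2l.
Qed.

Lemma trig_weight_ge1 alpha D w : 0 < alpha -> 1 <= trig_weight alpha D w.
Proof.
by move=> al0; rewrite -expR0 ler_expR mulr_ge0 ?powR_ge0// ltW.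
Qed.

End TrigJet.

(** * The growth class exp(O(n^gamma)) *)

Section Growth.
Context {R : realType}.
Variable (gam : R).
Hypothesis gam_gt0 : 0 < gam.

(** Closure under sums, products and powers lets the constants of the construction be estimated
    without being made explicit. *)
Definition subexp (f : nat -> R) : Prop :=
  exists2 B, 0 <= B & forall n, (0 < n)%N -> f n <= expR (B * n%:R `^ gam).

Let g_ge1 n : (0 < n)%N -> 1 <= n%:R `^ gam :> R.
Proof.
by move=> n0; rewrite -[leLHS](powRr0 n%:R) ler_powR ?ler1n// ltW.
Qed.

Lemma subexp_exp (c : R) f : 0 <= c -> (forall n, (0 < n)%N -> f n <= c * n%:R `^ gam) ->
  subexp (fun n => expR (f n)).
Proof. by move=> c0 H; exists c => // n n0; rewrite ler_expR H. Qed.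

Lemma subexp_le f f' : (forall n, (0 < n)%N -> f n <= f' n) -> subexp f' -> subexp f.
Proof. by move=> ff' [B B0 H]; exists B => // n n0; rewrite (le_trans (ff' n n0)) ?H. Qed.

Lemma subexp_cst (c : R) : subexp (fun=> c).
Proof.
exists `|c| => // n n0; rewrite (le_trans (ler_norm _))//.
rewrite (le_trans _ (expR_ge1Dx _))//.
by rewrite (le_trans (ler_peMr (normr_ge0 c) (g_ge1 n0)))// lerDr.
Qed.

Lemma subexp_mul f f' : (forall n, 0 <= f n) -> (forall n, 0 <= f' n) ->
  subexp f -> subexp f' -> subexp (fun n => f n * f' n).
Proof.
move=> f0 f0' [B B0 H] [B' B0' H']; exists (B + B') => [|n n0]; first exact: addr_ge0.
by rewrite mulrDl expRD ler_pM// ?H ?H'.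
Qed.

Lemma subexp_add f f' : (forall n, 0 <= f n) -> (forall n, 0 <= f' n) ->
  subexp f -> subexp f' -> subexp (fun n => f n + f' n).
Proof.
move=> f0 f0' [B B0 H] [B' B0' H'].
apply: (@subexp_le _ (fun n => 2 * expR ((B + B') * n%:R `^ gam))) => [n n0|].
  rewrite mulr_natl mulr2n; apply: lerD.
    by rewrite (le_trans (H n n0))// ler_expR ler_wpM2r ?powR_ge0// lerDl.
  by rewrite (le_trans (H' n n0))// ler_expR ler_wpM2r ?powR_ge0// lerDr.
apply: subexp_mul => [//|n||]; rewrite ?expR_ge0//; first exact: subexp_cst.
by apply: (@subexp_exp (B + B')) => //; exact: addr_ge0.
Qed.

Lemma subexp_powR f (p : R) : 0 <= p -> (forall n, 0 <= f n) ->
  subexp f -> subexp (fun n => f n `^ p).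
Proof.
move=> p0 f0 [B B0 H]; exists (p * B) => [|n n0]; first exact: mulr_ge0.
rewrite -mulrA mulrC expRM; apply: ge0_ler_powR; rewrite ?nnegrE ?expR_ge0//.
exact: H.
Qed.

Lemma subexp_nat : subexp (fun n => n%:R).
Proof.
exists gam^-1 => [|n n0]; first by rewrite invr_ge0 ltW.
rewrite -{1}(@lnK _ n%:R) ?posrE ?ltr0n//.
rewrite ler_expR ler_pdivlMl// -ln_powR ltW// ln_sublinear//.
by rewrite powR_gt0// ltr0n.
Qed.

End Growth.

(** * The constants of one generation *)

Section Constants.
Context {R : realType}.
Variables (alpha D : R).
Hypotheses (alpha_gt1 : 1 < alpha) (D_gt0 : 0 < D).

Let gam : R := 1 / (alpha - 1).
Let gam_gt0 : 0 < gam. Proof. by rewrite divr_gt0// subr_gt0. Qed.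
Let alpha_gt0 : 0 < alpha. Proof. exact: lt_trans ltr01 alpha_gt1. Qed.
Let c0 : R := cutoff_const alpha D.
Let c0_gt0 : 0 < c0. Proof. exact: cutoff_const_gt0. Qed.

(** Inverts c0 J^(1 - alpha) <= w; this is where the exponent gamma = 1 / (alpha - 1) comes from. *)
Definition cutoff_order (w : R) : nat := (Num.truncn ((c0 / w) `^ gam)).+1.

Lemma cutoff_orderP w : 0 < w -> c0 * (cutoff_order w)%:R `^ (1 - alpha) <= w.
Proof.
move=> w0; set J := cutoff_order w.
have J0 : 0 < J%:R :> R by rewrite ltr0n.
have al1 : 0 < alpha - 1 by rewrite subr_gt0.
have -> : 1 - alpha = - (alpha - 1) by ring.
rewrite powRN ler_pdivrMr ?powR_gt0// mulrC -ler_pdivrMr//.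
have -> : c0 / w = ((c0 / w) `^ gam) `^ (alpha - 1).
  by rewrite -powRrM /gam div1r mulVf ?gt_eqF// powRr1// ltW// divr_gt0.
apply: ge0_ler_powR; rewrite ?nnegrE ?powR_ge0 ?(ltW J0) ?(ltW al1)//.
by rewrite ltW// /J /cutoff_order truncnS_gt.
Qed.

Lemma cutoff_order_le w : (cutoff_order w)%:R <= (c0 / w) `^ gam + 1.
Proof. by rewrite -natr1 lerD2r truncn_le// powR_ge0. Qed.

(* e controls the measure of the gaps of a generation, and n is the inverse of
   the spacing of their centers. *)
Variable e : R.
Hypothesis e_gt0 : 0 < e.

Definition gap_width (n : nat) : R := e / (80 * n%:R).
(** A cutoff vanishes only from five times its width on, hence the division by 5. *)
Definition gap_order n : nat := cutoff_order (gap_width n / 5).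
(** Quadratic in [e] because the highest action is of the order of the square root of the coupling.
    The power of 10 brings that action below e / 500, whereas a fifth of a gap, rescaled by n, is e
    / 400. *)
Definition amplitude : R := e ^+ 2 / 10 ^+ 7.
Definition kick_loss n : R :=
  trig_weight alpha D (2 * pi * n%:R) * (2 `^ alpha) ^+ gap_order n.
(** The coefficient mu of the cosine in [u]. Dividing by [kick_loss] pays for the Gevrey norm; the
    factor n^2 cancels in the coupling 2 pi n^2 mu obtained after rescaling angle and action by
    n. *)
Definition kick_size n : R := amplitude / (kick_loss n * n%:R ^+ 2).
Definition kick_param n : R := 2 * pi * amplitude / kick_loss n.
(** Five widths give [kick_param] squared over 16 n, half of the guaranteed distance in r_1 between
    the highest action and the others. *)
Definition spot_width n : R := kick_param n ^+ 2 / (80 * n%:R).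
Definition spot_order n : nat := cutoff_order (spot_width n).
Definition spot_loss n : R := trig_weight alpha D (2 * pi) * (2 `^ alpha) ^+ spot_order n.
(** The truncation term lets the coefficient 1 / (2 pi q) of [v] absorb [spot_loss]; the term n^2
    ensures q >= n^2, which makes the starting values of theta_2 dense enough for shadowing. *)
Definition half_period n : nat := (n ^ 2 + (Num.truncn (spot_loss n / amplitude)).+1)%N.
Definition period n : nat := (half_period n).*2.+1.

Lemma amplitude_gt0 : 0 < amplitude.
Proof. by rewrite divr_gt0 ?exprn_gt0. Qed.

Lemma two_powR_alpha_ge1 J : 1 <= (2 `^ alpha) ^+ J :> R.
Proof. by rewrite exprn_ege1// -[leLHS](powRr0 2) ler_powR ?ler1n// ltW. Qed.

Lemma kick_loss_ge1 n : 1 <= kick_loss n.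
Proof.
by rewrite -[1]mulr1 ler_pM ?two_powR_alpha_ge1 ?trig_weight_ge1.
Qed.

Let kick_loss_gt0 n : 0 < kick_loss n.
Proof. exact: lt_le_trans ltr01 (kick_loss_ge1 n). Qed.

Lemma spot_loss_ge1 n : 1 <= spot_loss n.
Proof.
by rewrite -[1]mulr1 ler_pM ?two_powR_alpha_ge1 ?trig_weight_ge1.
Qed.

Lemma kick_param_gt0 n : 0 < kick_param n.
Proof. by rewrite divr_gt0// !mulr_gt0 ?pi_gt0 ?amplitude_gt0. Qed.

Lemma kick_paramE n : (0 < n)%N -> kick_param n = 2 * pi * n%:R ^+ 2 * kick_size n.
Proof.
move=> n0; rewrite /kick_param /kick_size; field.
by rewrite pnatr_eq0 -lt0n n0 gt_eqF.
Qed.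

Lemma kick_param_le n : kick_param n <= 8 * amplitude.
Proof.
rewrite ler_pdivrMr// (le_trans _ (ler_peMr _ (kick_loss_ge1 n)))//;
  last by rewrite mulr_ge0 ?(ltW amplitude_gt0).
rewrite ler_pM2r ?amplitude_gt0//.
have := @pihalf_lt2 R; lra.
Qed.

Lemma spot_width_gt0 n : (0 < n)%N -> 0 < spot_width n.
Proof.
by move=> n0; rewrite divr_gt0 ?exprn_gt0 ?kick_param_gt0// mulr_gt0// ltr0n.
Qed.

Lemma gap_width_gt0 n : (0 < n)%N -> 0 < gap_width n.
Proof. by move=> n0; rewrite divr_gt0// mulr_gt0// ltr0n. Qed.

Lemma half_period_ge n : spot_loss n / amplitude <= (half_period n)%:R.
Proof.
by rewrite /half_period natrD (le_trans (ltW (truncnS_gt _)))// lerDr ler0n.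
Qed.

Lemma period_ge_sq n : (n ^ 2 <= period n)%N.
Proof.
by rewrite /period /half_period ltnW// ltnS -addnn -addnA leq_addr.
Qed.

Let subexp_kick_loss : subexp gam kick_loss.
Proof.
apply: subexp_mul => [n|n||].
- exact: expR_ge0.
- by rewrite exprn_ge0// powR_ge0.
- pose c := alpha * (2 * pi / D) `^ alpha^-1.
  have cc : 0 <= c by rewrite mulr_ge0 ?powR_ge0// ltW.
  apply: (@subexp_exp _ _ c) => // n n0.
  have p0 : 0 <= 2 * pi / D by rewrite divr_ge0 ?mulr_ge0 ?pi_ge0 ?ltW.
  rewrite /c -[leRHS]mulrA ler_pM2l// (_ : 2 * pi * n%:R / D = 2 * pi / D * n%:R); last by ring.
  rewrite powRM// ?ler0n// ler_wpM2l ?powR_ge0// ler_powR ?ler1n//.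
  by rewrite /gam div1r lef_pV2 ?posrE ?subr_gt0// gerBl.
- pose c := (c0 * (5 * 80) / e) `^ gam.
  have cc : 0 <= c by exact: powR_ge0.
  apply: (@subexp_le _ _ _ (fun n => expR (alpha * (c * n%:R `^ gam + 1) * ln 2))).
    move=> n n0.
    have -> : (2 `^ alpha) ^+ gap_order n = expR (alpha * (gap_order n)%:R * ln 2).
      rewrite -(powR_mulrn _ (powR_ge0 _ _)) -powRrM /powR ifF//.
      by apply/negbTE; rewrite pnatr_eq0.
    rewrite ler_expR ler_pM2r; last by rewrite ln_gt0// ltr1n.
    rewrite ler_pM2l// (le_trans (cutoff_order_le _))// lerD2r.
    have ce : 0 <= c0 * (5 * 80) / e.
      apply: divr_ge0 (ltW e_gt0); apply: mulr_ge0 (ltW c0_gt0) _.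
      exact: mulr_ge0 (ler0n R 5) (ler0n R 80).
    rewrite /c -(powRM _ ce (ler0n R n)).
    apply: ge0_ler_powR; rewrite ?nnegrE; first exact: ltW.
    + by rewrite divr_ge0 ?(ltW c0_gt0)// divr_ge0// ltW// gap_width_gt0.
    + exact: mulr_ge0 ce (ler0n R n).
    rewrite /gap_width le_eqVlt; apply/orP; left; apply/eqP; field.
    by rewrite pnatr_eq0 -lt0n n0 gt_eqF.
  have l2 : 0 <= ln 2 :> R by rewrite ln_ge0// ler1n.
  apply: (@subexp_exp _ _ (alpha * (c + 1) * ln 2)) => [|n n0].
    by rewrite mulr_ge0// mulr_ge0 ?(ltW alpha_gt0)// addr_ge0.
  rewrite [leRHS]mulrAC ler_wpM2r// -[leRHS]mulrA ler_pM2l// mulrDl mul1r lerD2l.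
  by rewrite -[leLHS](powRr0 n%:R) ler_powR ?ler1n// ltW.
Qed.

(** The period is affine in [spot_loss], which is exponential in [spot_order], and the latter is a
    power of an inverse width of size exp(O(n^gamma)). The quantity 3 q^2 is the one that
    [escape_time] consumes. *)
Lemma period_growth : exists2 B : R, 0 <= B & forall n, (0 < n)%N ->
  3 * (period n)%:R ^+ 2 <= expR (expR (B * n%:R `^ gam)).
Proof.
have am0 := amplitude_gt0.
have c_le f : subexp gam f -> exists2 B : R, 0 <= B &
   forall n, (0 < n)%N -> f n <= expR (B * n%:R `^ gam) by [].
pose C := 3 * (5 + 2 * (trig_weight alpha D (2 * pi) / amplitude)) ^+ 2.
have tw0 : 0 <= trig_weight alpha D (2 * pi) / amplitude.
  by rewrite divr_ge0 ?expR_ge0// ltW.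
have C0 : 1 <= C.
  rewrite /C; set y := 5 + _; have y5 : 5 <= y by rewrite lerDl mulr_ge0.
  have : 5 * 5 <= y ^+ 2 by rewrite expr2 ler_pM.
  lra.
(* An upper bound for the logarithm of 3 q^2: [C] gathers the constants, and n^4 is replaced by
   exp(4 n). *)
suff H : subexp gam (fun n => ln C + 4 * n%:R + 2 * alpha * ln 2 * (spot_order n)%:R).
  have [B B0 HB] := H; exists B => // n n0.
  have n0R : 0 < n%:R :> R by rewrite ltr0n.
  have n1R : 1 <= n%:R :> R by rewrite ler1n.
  apply: le_trans (_ : expR (ln C + 4 * n%:R + 2 * alpha * ln 2 * (spot_order n)%:R) <= _);
    last by rewrite ler_expR HB.
  pose P : R := (2 `^ alpha) ^+ spot_order n.
  have P1 : 1 <= P by exact: two_powR_alpha_ge1.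
  have qle : (period n)%:R <= (5 + 2 * (trig_weight alpha D (2 * pi) / amplitude)) *
      (n%:R ^+ 2 * P).
    rewrite /period -addn1 natrD -muln2 natrM /half_period natrD -natr1 natrX.
    have : (Num.truncn (spot_loss n / amplitude))%:R <= spot_loss n / amplitude.
      by rewrite truncn_le// divr_ge0 ?(ltW am0)// (le_trans ler01 (spot_loss_ge1 _)).
    have n2 : 1 <= n%:R ^+ 2 :> R by rewrite exprn_ege1.
    have -> : spot_loss n / amplitude = trig_weight alpha D (2 * pi) / amplitude * P.
      by rewrite /spot_loss -/P; ring.
    have h1 : n%:R ^+ 2 <= n%:R ^+ 2 * P by rewrite ler_peMr// exprn_ge0.
    have h2 : trig_weight alpha D (2 * pi) / amplitude * P <=
       trig_weight alpha D (2 * pi) / amplitude * (n%:R ^+ 2 * P).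
      by rewrite ler_wpM2l// ler_peMl// (le_trans ler01).
    lra.
  have -> : expR (ln C + 4 * n%:R + 2 * alpha * ln 2 * (spot_order n)%:R) =
      C * expR (n%:R) ^+ 4 * P ^+ 2.
    rewrite !expRD lnK; last by rewrite posrE (lt_le_trans ltr01).
    congr (_ * _ * _); first by rewrite expRM_natl.
    rewrite /P -(powR_mulrn _ (powR_ge0 _ _)) -powRrM -powR_mulrn ?powR_ge0//.
    rewrite -powRrM /powR ifF; last by apply/negbTE; rewrite pnatr_eq0.
    by congr expR; ring.
  have q0 : 0 <= (period n)%:R :> R by [].
  have : (period n)%:R ^+ 2 <= ((5 + 2 * (trig_weight alpha D (2 * pi) / amplitude)) *
      (n%:R ^+ 2 * P)) ^+ 2 by rewrite lerXn2r// nnegrE// (le_trans q0).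
  rewrite -(ler_pM2l (ltr0n _ 3)) => /le_trans; apply.
  have -> : 3 * ((5 + 2 * (trig_weight alpha D (2 * pi) / amplitude)) *
      (n%:R ^+ 2 * P)) ^+ 2 = C * n%:R ^+ 4 * P ^+ 2 by rewrite /C; ring.
  have P0 : 0 <= P ^+ 2 by rewrite exprn_ge0// (le_trans ler01 P1).
  rewrite ler_wpM2r// ler_wpM2l//; first exact: le_trans ler01 C0.
  rewrite lerXn2r ?nnegrE ?expR_ge0//.
  by rewrite (le_trans _ (expR_ge1Dx _))// lerDr.
have l2 : 0 <= ln 2 :> R by rewrite ln_ge0// ler1n.
have lC : 0 <= ln C by rewrite ln_ge0.
have a2 : 0 <= 2 * alpha * ln 2 by rewrite !mulr_ge0// ltW.
apply: (subexp_add gam_gt0) => [n|n||].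
- by apply: addr_ge0 => //; apply: mulr_ge0 (ler0n R n).
- exact: mulr_ge0 a2 (ler0n R _).
- apply: (subexp_add gam_gt0) => [//|n||]; rewrite ?mulr_ge0//; first exact: (subexp_cst gam_gt0).
  by apply: subexp_mul => //; [exact: (subexp_cst gam_gt0)|exact: (subexp_nat gam_gt0)].
apply: subexp_mul => //; first exact: (subexp_cst gam_gt0).
apply: (@subexp_le _ _ _
  (fun n => (c0 * (80 / (2 * pi * amplitude) ^+ 2) * (n%:R * kick_loss n `^ 2)) `^ gam + 1)).
  move=> n n0; rewrite (le_trans (cutoff_order_le _))// lerD2r le_eqVlt; apply/orP; left.
  apply/eqP; congr (_ `^ _); rewrite /spot_width /kick_param powR_mulrn ?(ltW (kick_loss_gt0 n))//.
  have k0 := lt0r_neq0 (kick_loss_gt0 n); have p0 := lt0r_neq0 (@pi_gt0 R).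
  have a0 := lt0r_neq0 am0.
  have n0R : n%:R != 0 :> R by rewrite pnatr_eq0 -lt0n.
  move: pi p0 => p p0.
  by field; rewrite k0 p0 a0 n0R.
have cc : 0 <= c0 * (80 / (2 * pi * amplitude) ^+ 2).
  by rewrite mulr_ge0 ?(ltW c0_gt0)// divr_ge0// exprn_ge0// !mulr_ge0 ?pi_ge0// ltW.
have k0 n : 0 <= kick_loss n by exact: ltW.
apply: (subexp_add gam_gt0) => [n|//||]; rewrite ?powR_ge0//; last exact: (subexp_cst gam_gt0).
have nk0 n : 0 <= n%:R * kick_loss n `^ 2 by exact: mulr_ge0 (ler0n R n) (powR_ge0 _ _).
apply: subexp_powR => [|n|]; [exact: ltW|exact: mulr_ge0 cc (nk0 n)|].
apply: subexp_mul => [n|//||]; [exact: cc|exact: (subexp_cst gam_gt0)|].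
apply: subexp_mul => [n|n||]; [exact: ler0n|exact: powR_ge0|exact: (subexp_nat gam_gt0)|].
by apply: subexp_powR => //; exact: subexp_kick_loss.
Qed.

End Constants.

(** * Comparison of the values of the escape function at nu and 2 nu *)

Section Escape.
Context {R : realType}.

(** For nu = 4 / n put A = (ln(n / 4) n / 4)^gam. The two values are exp(exp A) at nu and at most
    exp(exp(2^-gam A)) at 2 nu. Since A / n^gam tends to infinity, exp(B n^gam) and exp(2^-gam A)
    are eventually each at most half of exp A. *)
Lemma dbl_exp_star_growth (gam B : R) : 0 < gam -> 0 <= B ->
  exists N0, forall n, (N0 <= n)%N -> [/\ (16 <= n)%N,
    1 <= dbl_exp_star 1 gam (2 * (4 / n%:R)) &
    expR (expR (B * n%:R `^ gam)) * dbl_exp_star 1 gam (2 * (4 / n%:R)) <=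
    dbl_exp_star 1 gam (4 / n%:R)].
Proof.
move=> gam0 B0.
pose th : R := 2 `^ (- gam).
have th0 : 0 < th by rewrite powR_gt0.
have th1 : th < 1.
  rewrite /th powRN invf_lt1 ?powR_gt0// [X in X < _](_ : 1 = 1 `^ gam); last by rewrite powR1.
  by apply: gt0_ltr_powR; rewrite ?nnegrE ?ler01 ?ler0n ?ltr1n.
(* Once A >= T n^gam, both [B * g + 1 <= A] and [th * A + 1 <= A] hold; the margin 1 in the exponent
   yields the factor 2. *)
pose T := B + 1 + (1 - th)^-1.
have T0 : 0 <= T by rewrite !addr_ge0 ?invr_ge0 ?subr_ge0 ?(ltW th1).
pose l0 := 4 * T `^ gam^-1.
pose N0 := maxn 16 (Num.truncn (4 * expR l0)).+1.
exists N0 => n; rewrite geq_max => /andP[n16 nl].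
split=> //; first by rewrite -expR0 ler_expR expR_ge0.
have n0 : 0 < n%:R :> R by rewrite ltr0n (leq_trans _ n16).
have n16R : 16 <= n%:R :> R by rewrite ler_nat.
pose l : R := ln (n%:R / 4).
have n4 : 0 < n%:R / 4 :> R by rewrite divr_gt0.
have ll0 : l0 <= l.
  rewrite -ler_expR lnK ?posrE// ler_pdivlMr// mulrC ltW//.
  by rewrite (lt_le_trans (truncnS_gt _))// ler_nat.
have l_2 : ln 2 < l by rewrite ltr_ln ?posrE//; lra.
have ln2 : 0 < ln 2 :> R by rewrite ln_gt0// ltr1n.
have l_gt0 : 0 < l by exact: lt_trans l_2.
have E1 (nu lam : R) : 0 < nu -> 0 < lam -> ln nu = - lam ->
    dbl_exp_star 1 gam nu = expR (expR ((lam / nu) `^ gam)).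
  move=> nu0 lam0 lnu; rewrite /dbl_exp_star /dbl_exp lnu normrN.
  rewrite (gtr0_norm lam0) mul1r.
  have -> : nu / lam = (lam / nu) `^ (-1).
    by rewrite powR_inv1 ?invf_div// divr_ge0// ltW.
  by rewrite -powRrM mulN1r opprK.
have nu0 : 0 < 4 / n%:R :> R by rewrite divr_gt0.
have nu20 : 0 < 2 * (4 / n%:R) :> R by rewrite mulr_gt0.
have lnu : ln (4 / n%:R) = - l by rewrite /l -lnV ?posrE// invf_div.
have lnu2 : ln (2 * (4 / n%:R)) = - (l - ln 2).
  by rewrite lnM ?posrE// lnu opprB addrC.
have l20 : 0 < l - ln 2 by rewrite subr_gt0.
rewrite (E1 _ _ nu0 l_gt0 lnu) (E1 _ _ nu20 l20 lnu2).
pose A : R := (l / (4 / n%:R)) `^ gam.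
have A2 : ((l - ln 2) / (2 * (4 / n%:R))) `^ gam <= th * A.
  rewrite /th /A.
  have -> : 2 `^ (- gam) = (2^-1) `^ gam :> R.
    by rewrite -powR_inv1// -powRrM mulN1r.
  rewrite -powRM ?invr_ge0//; last by rewrite divr_ge0 ?(ltW l_gt0) ?(ltW nu0).
  apply: ge0_ler_powR; rewrite ?(ltW gam0) ?nnegrE//.
  - by rewrite divr_ge0 ?(ltW l20) ?(ltW nu20).
  - by rewrite mulr_ge0 ?invr_ge0// divr_ge0 ?(ltW l_gt0) ?(ltW nu0).
  rewrite invfM mulrCA ler_wpM2l ?invr_ge0// ler_pM2r ?invr_gt0// gerBl ltW//.
pose g : R := n%:R `^ gam.
have g1 : 1 <= g.
  by rewrite -[leLHS](powRr0 n%:R) ler_powR ?(ltW gam0)// (le_trans _ n16R)// ler1n.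
have Ag : T * g <= A.
  have -> : A = (l / 4) `^ gam * g.
    rewrite /A /g -powRM ?ler0n ?divr_ge0 ?(ltW l_gt0)//; congr (_ `^ _).
    by field; rewrite gt_eqF.
  rewrite ler_wpM2r ?powR_ge0//.
  have -> : T = (T `^ gam^-1) `^ gam by rewrite -powRrM mulVf ?gt_eqF// powRr1.
  apply: ge0_ler_powR; rewrite ?(ltW gam0) ?nnegrE ?powR_ge0 ?divr_ge0 ?(ltW l_gt0)//.
  by rewrite ler_pdivlMr// mulrC.
have exp2 (x y : R) : x + 1 <= y -> 2 * expR x <= expR y.
  move=> xy; have -> : y = x + (y - x) by ring.
  rewrite expRD mulrC ler_pM2l ?expR_gt0//.
  by have := expR_ge1Dx (y - x); lra.
have BA : B * g + 1 <= A.
  have T1 : B + 1 <= T by rewrite /T lerDl invr_ge0 subr_ge0 ltW.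
  have : (B + 1) * g <= T * g by rewrite ler_wpM2r ?powR_ge0.
  by rewrite mulrDl mul1r; lra.
have thA : th * A + 1 <= A.
  have : (1 - th)^-1 <= A.
    apply: le_trans Ag; rewrite (le_trans _ (ler_peMr T0 g1))//.
    by rewrite /T lerDr addr_ge0.
  rewrite -[_^-1]div1r ler_pdivrMr ?subr_gt0//; lra.
rewrite -expRD ler_expR.
have h1 := exp2 _ _ BA; have h2 := exp2 _ _ thA.
have : expR (((l - ln 2) / (2 * (4 / n%:R))) `^ gam) <= expR (th * A) by rewrite ler_expR.
rewrite -/A -/g; lra.
Qed.

End Escape.

(** * Measure of the set of good actions *)

Section GoodFrequencies.
Context {R : realType}.
Variables (om e : R) (n : nat -> nat) (h : nat -> R).
Hypotheses (e_gt0 : 0 < e) (e_le1 : e <= 1) (n_gt0 : forall k, (0 < n k)%N).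
Hypothesis (h_gt0 : forall k, 0 < h k).
Hypothesis (h_le : forall k, h k <= e / 2 ^+ k / (80 * (n k)%:R)).

(** One [h k] keeps [x] off the supports of generation [k]; the second one protects the circles of
    later generations close to [x] from being dropped. *)
Definition good_freq : set R := [set x | x \in `[0, 1] /\
  forall k (p : int), 2 * h k <= `|x + om - p%:~R / (n k)%:R|].

Lemma good_freq_closed : closed good_freq.
Proof.
have -> : good_freq = `[0, 1]%classic `&` \bigcap_k \bigcap_(p in [set: int])
    (fun x : R => `|x + om - p%:~R / (n k)%:R|) @^-1` [set y | 2 * h k <= y].
  apply/seteqP; split=> [x [x01 H]|x [x01 H]].
    by split=> // k _ p _ /=; exact: H.
  by split=> // k p; exact: (H k I p I).
apply: closedI; first exact: itv_closed.
apply: closed_bigI => k _; apply: closed_bigI => p _.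
apply: closed_comp => [x _|]; last exact: closed_ge.
apply: cvg_norm; apply: cvgB; last exact: cvg_cst.
by apply: cvgD; [exact: cvg_id|exact: cvg_cst].
Qed.

Let I k (i : nat) : set R :=
  `](Num.floor ((n k)%:R * om) + i)%:~R / (n k)%:R - om - 2 * h k,
    (Num.floor ((n k)%:R * om) + i)%:~R / (n k)%:R - om + 2 * h k[%classic.

(** For [x] in [0, 1] the relevant numerators are the [(n k).+2] consecutive integers starting at
    the floor of [(n k)%:R * om]. *)
Let U k : set R := \big[setU/set0]_(i < (n k).+2) I k i.

Let U_meas k : measurable (U k).
Proof. by apply: bigsetU_measurable => i _; exact: measurable_itv. Qed.

Let U_cover : `[0, 1]%classic `<=` good_freq `|` \bigcup_k U k.
Proof.
move=> x x01; have [G|] := pselect (good_freq x); first by left.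
move=> nG; right.
have [k [p kp]] : exists k (p : int), `|x + om - p%:~R / (n k)%:R| < 2 * h k.
  apply: contrapT => H; apply: nG; split=> // k p.
  by rewrite leNgt; apply/negP => kp; apply: H; exists k, p.
exists k => //; rewrite /U.
have nk0 : 0 < (n k)%:R :> R by rewrite ltr0n.
pose f := Num.floor ((n k)%:R * om).
have /andP[f1 f2] := floor_itv ((n k)%:R * om); rewrite -/f in f1 f2.
have hn : 2 * h k * (n k)%:R <= 40^-1.
  have -> : 40^-1 = 2 * (1 / (80 * (n k)%:R)) * (n k)%:R :> R by field; rewrite gt_eqF.
  rewrite ler_pM2r// ler_pM2l// (le_trans (h_le k))// ler_pM2r ?invr_gt0 ?mulr_gt0//.
  by rewrite ler_pdivrMr ?exprn_gt0// mul1r (le_trans e_le1)// exprn_ege1// ler1n.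
move: x01; rewrite /= in_itv/= => /andP[x0 x1].
have [p1 p2] : f%:~R - 1 < p%:~R :> R /\ p%:~R < f%:~R + (n k)%:R + 2 :> R.
  have := kp; rewrite -(ltr_pM2r nk0) -{2}(gtr0_norm nk0) -normrM mulrBl divfK ?gt_eqF//.
  have xn0 : 0 <= x * (n k)%:R by rewrite mulr_ge0// ltW.
  have xn1 : x * (n k)%:R <= (n k)%:R by rewrite ler_piMl// ltW.
  rewrite mulrDl (mulrC om) ltr_norml => /andP[a1 a2].
  by move: f1 f2; rewrite intrD; split; lra.
have fp : f <= p by rewrite -ltzD1 -(ltr_int R) intrD; lra.
have [i pi] : exists i : nat, p = f + i%:Z.
  by exists `|p - f|%N; rewrite gez0_abs ?subr_ge0// subrKC.
have i_lt : (i < (n k).+2)%N.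
  rewrite -(ltr_nat R); move: p2; rewrite pi intrD -!natr1; lra.
rewrite -bigcup_mkord; exists i => //; rewrite /I/= in_itv/= -/f -pi.
by move: kp; rewrite ltr_norml => /andP[]; lra.
Qed.

Let U_le k : (lebesgue_measure (U k) <= (e / (2 ^ k.+1)%:R)%:E)%E.
Proof.
apply: (@le_trans _ _ (\sum_(i < (n k).+2) (4 * h k)%:E)%E).
  have Bo : (lebesgue_measure (U k) <= \sum_(i < (n k).+2) lebesgue_measure (I k i))%E.
    by apply: Boole_inequality => i _; exact: measurable_itv.
  apply: (le_trans Bo).
  apply: lee_sum => i _.
  rewrite lebesgue_measure_itv/= lte_fin ifT; last by have := h_gt0 k; lra.
  by rewrite -EFinD lee_fin; lra.
rewrite sumEFin lee_fin big_const_ord iter_addr_0 -[leLHS]mulr_natr.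
have nk1 : 1 <= (n k)%:R :> R by rewrite ler1n.
have nk0 : 0 < (n k)%:R :> R by rewrite ltr0n.
have h12 : 4 * h k * (n k).+2%:R <= 12 * (h k * (n k)%:R).
  have -> : (n k).+2%:R = (n k)%:R + 2 :> R by rewrite -natrD addn2.
  have : h k * 1 <= h k * (n k)%:R by rewrite ler_pM2l.
  lra.
rewrite (le_trans h12)// natrX exprS.
have : h k * (n k)%:R <= e / 2 ^+ k / 80.
  have -> : e / 2 ^+ k / 80 = e / 2 ^+ k / (80 * (n k)%:R) * (n k)%:R.
    by field; rewrite ?gt_eqF ?expf_neq0// exprn_gt0.
  by rewrite ler_pM2r.
have -> : e / (2 * 2 ^+ k) = e / 2 ^+ k / 2 by field; rewrite expf_neq0.
have : 0 <= e / 2 ^+ k by rewrite divr_ge0 ?exprn_ge0// ltW.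
lra.
Qed.

Lemma good_freq_measure : ((1 - e)%:E <= lebesgue_measure good_freq)%E.
Proof.
have mG : measurable good_freq by apply: closed_measurable; exact: good_freq_closed.
have mU : measurable (\bigcup_k U k) by apply: bigcupT_measurable => k; exact: U_meas.
have l1 : lebesgue_measure (`[0, 1]%classic : set R) = 1%E.
  by rewrite lebesgue_measure_itv/= lte_fin ltr01 -EFinD subr0.
have sU : (lebesgue_measure (\bigcup_k U k) <= e%:E)%E.
  apply: (@le_trans _ _ (\sum_(0 <= k <oo) lebesgue_measure (U k))%E).
    by apply: measure_sigma_subadditive => //; exact: U_meas.
  have cv := @cvg_geometric_eseries_half R e 0.
  rewrite expr0 divr1 in cv; rewrite -(cvg_lim _ cv)//.
  apply: lee_nneseries => [k _ _|k _]; first exact: measure_ge0.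
  by rewrite addn1; exact: U_le.
have : (1 <= lebesgue_measure good_freq + e%:E)%E.
  rewrite -l1; apply: (@le_trans _ _ (lebesgue_measure (good_freq `|` \bigcup_k U k))).
    apply: le_measure; rewrite ?inE; [exact: measurable_itv|exact: measurableU|].
    exact: U_cover.
  by apply: (le_trans (measureU2 _ _ _)) => //; exact: leeD2l.
by rewrite EFinB leeBlDr.
Qed.

End GoodFrequencies.

(** * Distances and fields in coordinates *)

Section FlatDist.
Context {R : realType}.

Lemma circle_norm_le (s : R) (k : int) : circle_norm s <= `|s - k%:~R|.
Proof.
apply: ge_inf; last by exists k.
by exists 0 => _ [i _ <-].
Qed.

Lemma circle_norm_ge0 (s : R) : 0 <= circle_norm s.
Proof.
apply: lb_le_inf; first by exists `|s - 0%:~R|; exists 0.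
by move=> _ [i _ <-].
Qed.

Lemma flat_dist_le (z w : 'rV[R]_(2 + 2)) (d : R) :
  (forall i, exists k : int, `|z 0 (lshift 2 i) - w 0 (lshift 2 i) - k%:~R| <= d) ->
  (forall i, `|z 0 (rshift 2 i) - w 0 (rshift 2 i)| <= d) ->
  flat_dist z w <= 2 * d.
Proof.
move=> Hl Hr; have d0 : 0 <= d := le_trans (normr_ge0 _) (Hr ord0).
have sq (a : R) : 0 <= a -> a <= d -> a ^+ 2 <= d ^+ 2.
  by move=> a0 ad; rewrite lerXn2r// nnegrE.
rewrite /flat_dist -(ger0_norm (mulr_ge0 (ler0n R 2) d0)) -sqrtr_sqr.
apply: ler_wsqrtr; rewrite exprMn.
apply: (@le_trans _ _ (\sum_(i < 2) d ^+ 2 + \sum_(i < 2) d ^+ 2)).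
  apply: lerD; apply: ler_sum => i _.
    apply: sq; first exact: circle_norm_ge0.
    have [k kd] := Hl i; rewrite (le_trans (circle_norm_le _ k))//.
    by rewrite !mxE.
  by rewrite -real_normK ?num_real// sq// !mxE.
rewrite !big_ord_recl !big_ord0 !addr0; move: (d ^+ 2) => D.
by rewrite le_eqVlt; apply/orP; left; apply/eqP; ring.
Qed.

Lemma flat_dist_ge (z w : 'rV[R]_(2 + 2)) i :
  `|z 0 (rshift 2 i) - w 0 (rshift 2 i)| <= flat_dist z w.
Proof.
rewrite /flat_dist -sqrtr_sqr; apply: ler_wsqrtr.
rewrite (bigD1 i (P := xpredT) (F := fun j => (rsubmx z - rsubmx w) 0 j ^+ 2))//=.
rewrite !mxE addrCA lerDl addr_ge0// sumr_ge0// => j _; exact: sqr_ge0.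
Qed.

Lemma T0_lshift (om : 'rV[R]_2) z i :
  T0 om z 0 (lshift 2 i) = z 0 (lshift 2 i) + om 0 i + z 0 (rshift 2 i).
Proof. by rewrite /T0 row_mxEl !mxE. Qed.

Lemma T0_rshift (om : 'rV[R]_2) z i : T0 om z 0 (rshift 2 i) = z 0 (rshift 2 i).
Proof. by rewrite /T0 row_mxEr !mxE. Qed.

Lemma field_lshift (a b : 'I_2) s (js : bijet s) z i :
  hamiltonian_field (lift2 (lshift 2 a) (rshift 2 b) (s 0%N 0%N)) z 0 (lshift 2 i) =
  (i == b)%:R * s 0%N 1%N (z 0 (lshift 2 a)) (z 0 (rshift 2 b)) :> R.
Proof.
by rewrite hamiltonian_field_lift2// !mxE eqxx eq_lrshift eq_lshift /= mulr0 subr0 mulrC.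
Qed.

Lemma field_rshift (a b : 'I_2) s (js : bijet s) z i :
  hamiltonian_field (lift2 (lshift 2 a) (rshift 2 b) (s 0%N 0%N)) z 0 (rshift 2 i) =
  - ((i == a)%:R * s 1%N 0%N (z 0 (lshift 2 a)) (z 0 (rshift 2 b))) :> R.
Proof.
by rewrite hamiltonian_field_lift2// !mxE eqxx eq_rlshift eq_rshift /= mulr0 sub0r mulrC.
Qed.

End FlatDist.

(** * The drifting orbit *)

Section Drift.
Context {R : realType}.
Variables (om : 'rV[R]_2) (su sv : nat -> nat -> R -> R -> R).
Hypotheses (bsu : bounded_bijet su) (bsv : bijet sv).

Notation i0 := (ord0 : 'I_2).
Notation i1 := (ord_max : 'I_2).

Variable Phiu : 'rV[R]_(2 + 2) -> 'rV[R]_(2 + 2).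

Let Hu : 'rV[R]_(2 + 2) -> R := lift2 (lshift 2 i0) (rshift 2 i0) (su 0%N 0%N).
Let Hv : 'rV[R]_(2 + 2) -> R := lift2 (lshift 2 i1) (rshift 2 i0) (sv 0%N 0%N).

Hypothesis PhiuE : forall (z : 'rV[R]_(2 + 2))
    (x0 := z 0 (lshift 2 i0)) (y0 := z 0 (rshift 2 i0)),
    (forall t, 0 <= t <= 1 ->
      su 0%N 1%N (x0 + t * su 0%N 1%N x0 y0) (y0 - t * su 1%N 0%N x0 y0) =
        su 0%N 1%N x0 y0 /\
      su 1%N 0%N (x0 + t * su 0%N 1%N x0 y0) (y0 - t * su 1%N 0%N x0 y0) =
        su 1%N 0%N x0 y0) ->
    Phiu z = z + hamiltonian_field Hu z.

Let T z := z + hamiltonian_field Hv z.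
Definition drift_map : 'rV[R]_(2 + 2) -> 'rV[R]_(2 + 2) :=
  (fun z => z + hamiltonian_field Hv z) \o Phiu \o T0 om.

Variables (n m : nat) (mu sig h kappa c : R) (p : int) (x y : nat -> R).
Let q := m.*2.+1.
Hypotheses (n_ge2 : (1 < n)%N) (nm : (n <= m)%N) (nq : (n ^ 2 <= q)%N).
Hypotheses (sigE : sig = 2 * pi * n%:R ^+ 2 * mu) (cE : c + om 0 i0 = p%:~R / n%:R).
Hypotheses (xS : forall j, x j.+1 = x j + y j)
  (yS : forall j, y j.+1 = y j + sig * sin (2 * pi * x j.+1))
  (y_per : forall j, y (j + q)%N = y j)
  (y_bd : forall j, 0 <= y j <= y m) (ym_le1 : y m <= 1)
  (ym_lt : y m / n%:R < h).
Hypothesis su_gap : forall th r, `|r - c| < h ->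
  su 0%N 1%N th r = 0 /\ su 1%N 0%N th r = - (2 * pi * n%:R * mu * sin (2 * pi * n%:R * th)).
Hypothesis sv_off : forall j th, (j %% q)%N != m ->
  sv 0%N 1%N th (c + y j / n%:R) = 0 /\ sv 1%N 0%N th (c + y j / n%:R) = 0.
Hypothesis sv_spot : forall th,
  sv 0%N 1%N th (c + y m / n%:R) = kappa * cos (2 * pi * th) /\
  sv 1%N 0%N th (c + y m / n%:R) = - (q%:R^-1 * sin (2 * pi * th)).

Let n_gt0 : (0 < n)%N. Proof. exact: ltnW. Qed.
Let n0 : 0 < n%:R :> R. Proof. by rewrite ltr0n. Qed.
Let q0 : 0 < q%:R :> R. Proof. by rewrite ltr0n. Qed.

(* j is the index along the periodic orbit of the standard map, and l counts
   the kicks received in the r2 direction. *)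
Let state (j : nat) (l : int) (z : 'rV[R]_(2 + 2)) : Prop :=
  [/\ exists A : int, z 0 (lshift 2 i0) = (x j + A%:~R) / n%:R,
      z 0 (rshift 2 i0) = c + y j / n%:R,
      exists B : int, z 0 (lshift 2 i1) = 4^-1 + (j%:R - m%:R) * l%:~R / q%:R + B%:~R
    & z 0 (rshift 2 i1) = l%:~R / q%:R - om 0 i1].

(** The actions [y j] and [y j.+1] both lie in [0, [y m]] and [y m / n < h], so the whole segment
    between them stays where the field depends on the angle alone; there the closed form of [Phiu]
    is exact. *)
Let Phiu_step j (z : 'rV[R]_(2 + 2)) (A : int) : z 0 (lshift 2 i0) = (x j.+1 + A%:~R) / n%:R ->
  z 0 (rshift 2 i0) = c + y j / n%:R ->
  [/\ Phiu z 0 (lshift 2 i0) = z 0 (lshift 2 i0),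
      Phiu z 0 (rshift 2 i0) = c + y j.+1 / n%:R,
      Phiu z 0 (lshift 2 i1) = z 0 (lshift 2 i1)
    & Phiu z 0 (rshift 2 i1) = z 0 (rshift 2 i1)].
Proof.
move=> z1 z2.
have y_gap s : 0 <= s <= y m -> `|c + s / n%:R - c| < h.
  move=> /andP[s0 s1]; rewrite addrAC subrr add0r ger0_norm ?divr_ge0 ?(ltW n0)//.
  by rewrite (le_lt_trans _ ym_lt)// ler_pM2r ?invr_gt0.
have [f0 f1] := su_gap (z 0 (lshift 2 i0)) (y_gap _ (y_bd j)).
have sinE : sin (2 * pi * n%:R * z 0 (lshift 2 i0)) = sin (2 * pi * x j.+1).
  rewrite z1 -(sin_cos_turn (x j.+1) A).1; congr sin.
  by rewrite -mulrA (mulrC n%:R) divfK ?gt_eqF.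
have kickE : 2 * pi * n%:R * mu * sin (2 * pi * n%:R * z 0 (lshift 2 i0)) =
    (y j.+1 - y j) / n%:R.
  rewrite sinE yS sigE addrAC subrr add0r; field.
  by rewrite gt_eqF.
have -> : Phiu z = z + hamiltonian_field Hu z.
  apply: PhiuE => t /andP[t0 t1]; rewrite z2 f0 f1 mulr0 addr0.
  have -> : c + y j / n%:R -
      t * - (2 * pi * n%:R * mu * sin (2 * pi * n%:R * z 0 (lshift 2 i0))) =
      c + (y j + t * (y j.+1 - y j)) / n%:R by rewrite kickE; ring.
  have [|g0 g1] := su_gap (z 0 (lshift 2 i0)) (r := c + (y j + t * (y j.+1 - y j)) / n%:R).
    apply: y_gap; have /andP[a0 a1] := y_bd j; have /andP[b0 b1] := y_bd j.+1.
    have -> : y j + t * (y j.+1 - y j) = (1 - t) * y j + t * y j.+1 by ring.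
    have u0 : 0 <= 1 - t by rewrite subr_ge0.
    rewrite addr_ge0 ?mulr_ge0//=.
    have : (1 - t) * y j <= (1 - t) * y m by rewrite ler_wpM2l.
    have : t * y j.+1 <= t * y m by rewrite ler_wpM2l.
    lra.
  by rewrite g0 g1.
have jsu := bsu.1.
split; rewrite mxE.
- by rewrite field_lshift// z2 f0 mulr0 addr0.
- by rewrite field_rshift// z2 f1 kickE eqxx mul1r opprK; ring.
- by rewrite field_lshift// mul0r addr0.
- by rewrite field_rshift// mul0r subr0.
Qed.

(** Since c + omega_1 = p / n, the rotation by omega_1 + r_1 becomes [x j.+1 = x j + y j] up to an
    integer, once theta_1 is multiplied by n. *)
Let step_pre j l z : state j l z ->
  let z' := Phiu (T0 om z) in
  [/\ exists A : int, z' 0 (lshift 2 i0) = (x j.+1 + A%:~R) / n%:R,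
      z' 0 (rshift 2 i0) = c + y j.+1 / n%:R,
      exists B : int, z' 0 (lshift 2 i1) = 4^-1 + (j.+1%:R - m%:R) * l%:~R / q%:R + B%:~R
    & z' 0 (rshift 2 i1) = l%:~R / q%:R - om 0 i1].
Proof.
move=> [[A z1] z2 [B z3] z4] z'.
have w1 : T0 om z 0 (lshift 2 i0) = (x j.+1 + (A + p)%:~R) / n%:R.
  rewrite T0_lshift z1 z2 xS intrD.
  have -> : (x j + A%:~R) / n%:R + om 0 i0 + (c + y j / n%:R) =
    (x j + A%:~R) / n%:R + (c + om 0 i0) + y j / n%:R by ring.
  by rewrite cE; field; rewrite gt_eqF.
have w2 : T0 om z 0 (rshift 2 i0) = c + y j / n%:R by rewrite T0_rshift.
have [e1 e2 e3 e4] := Phiu_step w1 w2.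
split.
- by exists (A + p); rewrite e1.
- exact: e2.
- exists B; rewrite e3 T0_lshift z3 z4 -natr1.
  by field; rewrite gt_eqF.
- by rewrite e4 T0_rshift.
Qed.

Let step_off j l z : state j l z -> (j.+1 %% q)%N != m -> state j.+1 l (drift_map z).
Proof.
move=> /step_pre[[A z1] z2 [B z3] z4] jm.
have [g0 g1] := sv_off (Phiu (T0 om z) 0 (lshift 2 i1)) jm.
rewrite /drift_map /=; split; rewrite mxE.
- by exists A; rewrite field_lshift// z2 g0 mulr0 addr0.
- by rewrite field_rshift// mul0r subr0.
- by exists B; rewrite field_lshift// mul0r addr0.
- by rewrite field_rshift// z2 g1 mulr0 subr0.
Qed.

Let y_spot i : y (m + i * q)%N = y m.
Proof.
by elim: i => [|i IH]; rewrite ?addn0// mulSn addnCA addnC y_per.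
Qed.

(** The sine is 1 at the kick, giving exactly 1 / q to r_2, and the cosine is 0, so that theta_1 is
    not displaced and the orbit of the standard map continues undisturbed. *)
Let step_spot j l z i : state j l z -> j.+1 = (m + i * q)%N ->
  state j.+1 (l + 1) (drift_map z).
Proof.
move=> /step_pre[[A z1] z2 [B z3] z4] ji.
have z2' : Phiu (T0 om z) 0 (rshift 2 i0) = c + y m / n%:R by rewrite z2 ji y_spot.
have z3' : Phiu (T0 om z) 0 (lshift 2 i1) = 4^-1 + (i%:Z * l + B)%:~R.
  rewrite z3 ji intrD intrM natrD natrM -pmulrn.
  by field; rewrite gt_eqF.
have [g0 g1] := sv_spot (Phiu (T0 om z) 0 (lshift 2 i1)).
have [s0 c0] := sin_cos_turn (4^-1 : R) (i%:Z * l + B).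
have quarter : 2 * pi * 4^-1 = pi / 2 :> R by move: pi => P; field.
rewrite z3' s0 quarter sin_pihalf mulr1 in g1.
rewrite z3' c0 quarter cos_pihalf mulr0 in g0.
rewrite /drift_map /=; split; rewrite mxE.
- by exists A; rewrite field_lshift// z2' z3' g0 mulr0 addr0.
- by rewrite field_rshift// mul0r subr0.
(* Replacing [l] by [l + 1] changes the rotation term by the integer [i], which is subtracted from
   [B]. *)
- exists (B - i%:Z); rewrite field_lshift// mul0r addr0 z3 ji.
  rewrite natrD natrM intrD intrB -!pmulrn.
  by field; rewrite gt_eqF.
- by rewrite field_rshift// z2' z3' g1 z4 eqxx mul1r opprK intrD; ring.
Qed.

Let steps_off s j l z : state j l z ->
  (forall i, (0 < i <= s)%N -> ((j + i) %% q)%N != m) ->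
  state (j + s) l (iter s drift_map z).
Proof.
move=> st; elim: s => [|s IH] H; first by rewrite addn0.
rewrite addnS iterS; apply: step_off.
  by apply: IH => i /andP[i_gt0 i_le]; apply: H; rewrite i_gt0 leqW.
by have := H s.+1; rewrite addnS; apply; rewrite /= leqnn.
Qed.

Let turn i l z : state (m + i * q) l z ->
  state (m + i.+1 * q) (l + 1) (iter q drift_map z).
Proof.
move=> st.
have e : (m + i.+1 * q = (m + i * q + m.*2).+1)%N.
  by rewrite mulSn addnCA addnC -addnS.
rewrite e (_ : q = m.*2.+1)// iterS; apply: (@step_spot _ _ _ i.+1); last by rewrite -e.
apply: steps_off => // s /andP[s0 s1].
rewrite addnAC addnC modnMDl.
have [lt|ge] := ltnP (m + s) q; first by rewrite modn_small// -[X in _ != X]addn0 eqn_add2l -lt0n.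
have mq : (m + s - q < m)%N.
  rewrite ltn_subLR//.
  by rewrite (leq_ltn_trans (leq_add (leqnn m) s1))// /q addSn ltnS addnC.
rewrite -(subnK ge) modnDr modn_small; last by rewrite (ltn_trans mq)// /q ltnS -addnn leq_addr.
by rewrite neq_ltn mq.
Qed.

Lemma drift_escape (z : 'rV[R]_(2 + 2)) : `|z 0 (rshift 2 i0) - c| <= n%:R^-1 ->
  exists2 zhat, flat_dist zhat z <= 4 / n%:R &
    forall i : nat, i.+1%:R / q%:R - 1 <=
      flat_dist (iter (n + i * q) drift_map zhat) z.
Proof.
move=> zc.
(* With n steps left before the first kick, changing [l] by one moves theta_2 by n / q, at most 1 /
   n, and r_2 by only 1 / q. *)
pose j0 := (m - n)%N.
pose A := Num.floor (n%:R * z 0 (lshift 2 i0) - x j0).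
have /andP[A1 A2] := floor_itv (n%:R * z 0 (lshift 2 i0) - x j0).
rewrite -/A intrD in A1 A2.
(* [i] is the number of turns for which [b] is within 1 of n (r_2 + omega_2). The choice of [l]
   makes n l / q close to [b]: then 1/4 - n l / q is close to theta_2 modulo 1, and l / q is close
   to r_2 + omega_2. *)
pose i := Num.floor (n%:R * (z 0 (rshift 2 i1) + om 0 i1) + z 0 (lshift 2 i1) - 4^-1).
have /andP[I1 I2] := floor_itv (n%:R * (z 0 (rshift 2 i1) + om 0 i1) + z 0 (lshift 2 i1) - 4^-1).
rewrite -/i intrD in I1 I2.
pose b := 4^-1 - z 0 (lshift 2 i1) + i%:~R.
pose l := Num.floor (q%:R * b / n%:R).
have /andP[L1 L2] := floor_itv (q%:R * b / n%:R).
rewrite -/l intrD in L1 L2.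
pose zhat : 'rV[R]_(2 + 2) := row_mx
  (\row_k if k == i0 then (x j0 + A%:~R) / n%:R else 4^-1 + (j0%:R - m%:R) * l%:~R / q%:R)
  (\row_k if k == i0 then c + y j0 / n%:R else l%:~R / q%:R - om 0 i1).
have st0 : state j0 l zhat.
  split; rewrite /zhat ?row_mxEl ?row_mxEr !mxE//.
  - by exists A.
  - by exists 0; rewrite addr0.
have q1 : 1 <= q%:R :> R by rewrite ler1n.
have n1 : 1 <= n%:R :> R by rewrite ler1n.
have nqR : n%:R <= q%:R / n%:R :> R.
  by rewrite ler_pdivlMr// -natrM ler_nat mulnn.
have qn : q%:R^-1 <= n%:R^-1 :> R.
  rewrite lef_pV2 ?posrE// (le_trans nqR)// ler_pdivrMr// ler_peMr// ltW//.
have qn2 : n%:R / q%:R <= n%:R^-1 :> R.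
  by rewrite ler_pdivrMr// mulrC.
have r2_near : `|l%:~R / q%:R - om 0 i1 - z 0 (rshift 2 i1)| <= 2 / n%:R.
  have h1 : `|l%:~R / q%:R - b / n%:R| <= q%:R^-1.
    have -> : l%:~R / q%:R - b / n%:R = (l%:~R - q%:R * b / n%:R) / q%:R.
      by field; rewrite !gt_eqF.
    rewrite normrM normfV (gtr0_norm q0) ler_pdivrMr// mulVf ?gt_eqF//.
    by rewrite ler_norml; lra.
  have h2 : `|b / n%:R - (z 0 (rshift 2 i1) + om 0 i1)| <= n%:R^-1.
    have -> : b / n%:R - (z 0 (rshift 2 i1) + om 0 i1) =
       (b - n%:R * (z 0 (rshift 2 i1) + om 0 i1)) / n%:R by field; rewrite gt_eqF.
    rewrite normrM normfV (gtr0_norm n0) ler_pdivrMr// mulVf ?gt_eqF//.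
    by rewrite /b ler_norml; lra.
  have -> : l%:~R / q%:R - om 0 i1 - z 0 (rshift 2 i1) =
    (l%:~R / q%:R - b / n%:R) + (b / n%:R - (z 0 (rshift 2 i1) + om 0 i1)) by ring.
  rewrite (le_trans (ler_normD _ _))// (le_trans (lerD h1 h2))//.
  by rewrite mulr_natl mulr2n lerD2r.
have th2_near : `|4^-1 + (j0%:R - m%:R) * l%:~R / q%:R - z 0 (lshift 2 i1) - (- i)%:~R| <= n%:R^-1.
  have -> : 4^-1 + (j0%:R - m%:R) * l%:~R / q%:R - z 0 (lshift 2 i1) - (- i)%:~R =
     - ((n%:R / q%:R) * (l%:~R - q%:R * b / n%:R)).
    rewrite /j0 natrB// /b intrN; field.
    by rewrite !gt_eqF.
  rewrite normrN normrM (ger0_norm (divr_ge0 _ _)) ?(ltW n0) ?(ltW q0)//.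
  rewrite (le_trans _ qn2)// ler_piMr ?divr_ge0 ?(ltW n0) ?(ltW q0)//.
  by rewrite ler_norml; lra.
have th1_near : `|(x j0 + A%:~R) / n%:R - z 0 (lshift 2 i0) - 0%:~R| <= n%:R^-1.
  rewrite subr0.
  have -> : (x j0 + A%:~R) / n%:R - z 0 (lshift 2 i0) =
     (x j0 + A%:~R - n%:R * z 0 (lshift 2 i0)) / n%:R by field; rewrite gt_eqF.
  rewrite normrM normfV (gtr0_norm n0) ler_pdivrMr// mulVf ?gt_eqF//.
  by rewrite ler_norml; lra.
have ninv : n%:R^-1 <= 2 / n%:R :> R by rewrite ler_peMl ?invr_ge0 ?(ltW n0)// ler1n.
have two (k : 'I_2) : k = i0 \/ k = i1.
  by case: k => -[|[|//]] kP; [left|right]; exact/val_inj.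
exists zhat.
  have -> : 4 / n%:R = 2 * (2 / n%:R) :> R by ring.
  apply: flat_dist_le => k.
    have [->|->] := two k; rewrite /zhat row_mxEl mxE /=.
      by exists 0; exact: le_trans th1_near ninv.
    by exists (- i); exact: le_trans th2_near ninv.
  have [->|->] := two k; rewrite /zhat row_mxEr mxE //=.
  rewrite addrAC (le_trans (ler_normD _ _))// mulr_natl mulr2n lerD//.
    by rewrite distrC.
  have /andP[yj0 yj1] := y_bd j0.
  rewrite ger0_norm ?divr_ge0 ?(ltW n0)// ler_pdivrMr// mulVf ?gt_eqF//.
  exact: le_trans yj1 ym_le1.
move=> t.
have st1 : state m (l + 1) (iter n drift_map zhat).
  have -> : n = n.-1.+1 by rewrite prednK.
  have jm : (j0 + n.-1).+1 = m by rewrite -addnS prednK// subnK.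
  rewrite iterS -{1}jm; apply: (@step_spot _ _ _ 0%N); last by rewrite mul0n addn0.
  apply: steps_off => // s /andP[s0 s1].
  have sm : (j0 + s < m)%N by rewrite -jm ltnS leq_add2l.
  by rewrite modn_small ?neq_ltn ?sm// (ltn_trans sm)// /q ltnS -addnn leq_addr.
have st : state (m + t * q) (l + 1 + t%:Z) (iter (n + t * q) drift_map zhat).
  elim: t => [|t IH]; first by rewrite !mul0n !addn0 addr0.
  have -> : (n + t.+1 * q = q + (n + t * q))%N by rewrite mulSn addnCA.
  rewrite iterD -addn1 PoszD addrA addn1.
  exact: turn.
have [_ _ _ r2E] := st.
apply: le_trans (flat_dist_ge _ _ i1); rewrite r2E.
have -> : (l + 1 + t%:Z)%:~R / q%:R - om 0 i1 - z 0 (rshift 2 i1) =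
   t.+1%:R / q%:R + (l%:~R / q%:R - om 0 i1 - z 0 (rshift 2 i1)).
  by rewrite !intrD -pmulrn -natr1; field; rewrite gt_eqF.
have n2 : 2 / n%:R <= 1 :> R by rewrite ler_pdivrMr// mul1r ler_nat.
have := lerB_normD (t.+1%:R / q%:R) (l%:~R / q%:R - om 0 i1 - z 0 (rshift 2 i1)).
have := ler_norm (t.+1%:R / q%:R : R).
lra.
Qed.

End Drift.

(** * Successive frequencies and the construction of the two Hamiltonians *)

Section Frequencies.
Context {R : realType}.

(** The next frequency is chosen once the gap of the current generation is known, so that twice the
    new spacing fits into that gap. *)
Fixpoint frequency (N0 : nat -> nat) (w : nat -> nat -> R) (k : nat) : nat :=
  if k is k'.+1
  then maxn (N0 k) (Num.truncn (2 / w k' (frequency N0 w k'))).+1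
  else (N0 0%N).+1.

Lemma frequencyP N0 (w : nat -> nat -> R) :
  (forall k n, (0 < n)%N -> 0 < w k n) -> let n := frequency N0 w in
  forall k, [/\ (N0 k <= n k)%N, (0 < n k)%N & 2 / (n k.+1)%:R <= w k (n k)].
Proof.
move=> w0 n k.
have n_gt0 i : (0 < n i)%N by case: i => // i; rewrite /n /= leq_max orbT.
split=> //; first by case: k => [|k] //; rewrite /n /= leq_maxl.
rewrite ler_pdivrMr ?ltr0n// mulrC -ler_pdivrMr ?w0//.
rewrite (le_trans (ltW (truncnS_gt _)))// ler_nat leq_max leqnn orbT//.
Qed.

End Frequencies.

Section Construction.
Context {R : realType}.
Variables (om1 alpha D e : R) (n : nat -> nat).
Hypotheses (alpha_gt1 : 1 < alpha) (D_gt0 : 0 < D) (e_gt0 : 0 < e) (e_le1 : e <= 1).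
Hypothesis n_ge16 : forall k, (16 <= n k)%N.

Definition share (k : nat) : R := e / 2 ^+ k.
Definition gap k : R := gap_width (share k) (n k).

Hypothesis gap_large : forall k, 2 / (n k.+1)%:R <= gap k.

Let share_gt0 k : 0 < share k. Proof. by rewrite divr_gt0// exprn_gt0. Qed.

Let share_le1 k : share k <= 1.
Proof.
by rewrite ler_pdivrMr ?exprn_gt0// mul1r (le_trans e_le1)// exprn_ege1// ler1n.
Qed.

Let n_gt0 k : (0 < n k)%N. Proof. exact: leq_trans (n_ge16 k). Qed.
Let nR_gt0 k : 0 < (n k)%:R :> R. Proof. by rewrite ltr0n. Qed.

Let gap_gt0 k : 0 < gap k. Proof. exact: gap_width_gt0. Qed.

Let gap_small k : gap k <= (n k)%:R^-1.
Proof.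
rewrite /gap /gap_width ler_pdivrMr ?mulr_gt0// mulrCA mulVf ?gt_eqF// mulr1.
by have := share_le1 k; lra.
Qed.

Let gap_sep j k : (j < k)%N -> (n k)%:R^-1 + gap k <= gap j.
Proof.
have step i : (n i.+1)%:R^-1 + gap i.+1 <= gap i.
  by rewrite (le_trans _ (gap_large i))// mulr_natl mulr2n lerD2l.
have mono i : gap i.+1 <= gap i.
  by rewrite (le_trans _ (step i))// lerDr invr_ge0 ler0n.
case: k => // k; rewrite ltnS => jk; rewrite (le_trans (step k))//.
move: jk => /subnKC <-; elim: (k - j)%N => [|i IH]; first by rewrite addn0.
by rewrite addnS (le_trans (mono _)).
Qed.

(* A rational circle is discarded when it is close to an earlier generation, so
   that the supports of distinct generations are disjoint. *)
Definition kept (k : nat) (p : int) : Prop := forall j (p' : int), (j < k)%N ->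
  gap j + gap k <= `|p%:~R / (n k)%:R - p'%:~R / (n j)%:R|.

Definition centers (k : nat) : set R :=
  [set c | exists2 p, kept k p & c + om1 = p%:~R / (n k)%:R].

Let kept_shift k p (i : int) : kept k p -> kept k (p + i * (n k)%:Z).
Proof.
move=> Kp j p' jk.
have := Kp j (p' - i * (n j)%:Z) jk.
have -> : p%:~R / (n k)%:R - (p' - i * (n j)%:Z)%:~R / (n j)%:R =
  (p + i * (n k)%:Z)%:~R / (n k)%:R - p'%:~R / (n j)%:R :> R => //.
rewrite !(intrD, intrN, intrM) -!pmulrn.
by field; rewrite !gt_eqF.
Qed.

Let centers_periodic k c : centers k (c + 1) <-> centers k c.
Proof.
split=> -[p Kp E].
  exists (p + (- 1) * (n k)%:Z); first exact: kept_shift.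
  rewrite intrD intrM intrN -pmulrn mulrDl -E.
  by rewrite -mulrA divff ?gt_eqF//; ring.
exists (p + 1 * (n k)%:Z); first exact: kept_shift.
rewrite intrD intrM -pmulrn mulrDl -E.
by rewrite -mulrA divff ?gt_eqF//; ring.
Qed.

Let centers_far k c r j c' : centers k c -> `|r - c| < gap k -> centers j c' ->
  j != k -> gap j <= `|r - c'|.
Proof.
move=> [p Kp cE] rc [p' Kp' cE'] jk.
have far : gap j + gap k <= `|c - c'|.
  have -> : c - c' = p%:~R / (n k)%:R - p'%:~R / (n j)%:R by rewrite -cE -cE'; ring.
  move: jk; rewrite neq_ltn => /orP[jk|kj]; first exact: Kp.
  by rewrite addrC distrC; exact: Kp'.
have := ler_distD r c c'; rewrite (distrC c r); lra.
Qed.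

Let good := plus_int (good_freq om1 n gap).

Lemma good_far r j c : good r -> centers j c -> gap j <= `|r - c|.
Proof.
move=> [x [_ Gx] [i ->]] [p _ cE].
have := Gx j (p - i * (n j)%:Z).
have -> : x + om1 - (p - i * (n j)%:Z)%:~R / (n j)%:R = x + i%:~R - c.
  have -> : c = p%:~R / (n j)%:R - om1 by rewrite -cE; ring.
  rewrite intrB !intrM -!pmulrn; field.
  by rewrite gt_eqF.
by have := gap_gt0 j; lra.
Qed.

(** Rounding down gives a circle within 1 / n_k. It is kept: [r] is at least [2 * gap j] away from
    each earlier circle, and [2 * gap j - 1 / n_k] is at least [gap j + gap k] by [gap_sep]. *)
Lemma good_near r k : good r -> exists2 c, centers k c & `|r - c| <= (n k)%:R^-1.
Proof.
move=> [x [_ Gx] [i rE]].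
pose p := Num.floor ((n k)%:R * (r + om1)).
have /andP[p1 p2] := floor_itv ((n k)%:R * (r + om1)); rewrite -/p intrD in p1 p2.
have rp : `|r + om1 - p%:~R / (n k)%:R| <= (n k)%:R^-1.
  have -> : r + om1 - p%:~R / (n k)%:R = ((n k)%:R * (r + om1) - p%:~R) / (n k)%:R.
    by field; rewrite gt_eqF.
  rewrite normrM normfV (gtr0_norm (nR_gt0 k)) ler_pdivrMr// mulVf ?gt_eqF//.
  by rewrite ler_norml; lra.
exists (p%:~R / (n k)%:R - om1); last first.
  by have -> : r - (p%:~R / (n k)%:R - om1) = r + om1 - p%:~R / (n k)%:R by ring.
exists p; last by rewrite subrK.
move=> j p' jk; have := Gx j (p' - i * (n j)%:Z).
have -> : x + om1 - (p' - i * (n j)%:Z)%:~R / (n j)%:R = r + om1 - p'%:~R / (n j)%:R.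
  rewrite rE intrB !intrM -!pmulrn; field.
  by rewrite gt_eqF.
have := ler_distD (p%:~R / (n k)%:R) (r + om1) (p'%:~R / (n j)%:R).
by have := gap_sep jk; lra.
Qed.

Let al0 : 0 < alpha. Proof. exact: lt_trans ltr01 alpha_gt1. Qed.

Let J k := gap_order alpha D (share k) (n k).
Let mu k := kick_size alpha D (share k) (n k).
Let sig k := kick_param alpha D (share k) (n k).
Let dlt k := spot_width alpha D (share k) (n k).
Let m k := half_period alpha D (share k) (n k).
Let q k := period alpha D (share k) (n k).
Let am k := amplitude (share k).

Let am_gt0 k : 0 < am k. Proof. exact: amplitude_gt0. Qed.

Let small : R := (10 ^+ 3)^-1.

Let small_bd : small * (10 * 10 * 10) = 1.
Proof. by rewrite /small; field. Qed.

Let amE k : am k = (share k * small) ^+ 2 / 10.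
Proof. by rewrite /am /amplitude /small; field. Qed.

Let am_small k : am k <= small /\ am k <= share k * small.
Proof.
have b := small_bd; have s1 := share_le1 k; have s0 := share_gt0 k.
have t0 : 0 < share k * small by rewrite mulr_gt0// invr_gt0 exprn_gt0.
have t1 : share k * small <= small by rewrite ler_piMl// invr_ge0 exprn_ge0.
have h : (share k * small) ^+ 2 <= share k * small by rewrite expr2 ler_piMl ?(ltW t0)//; lra.
by rewrite amE; split; lra.
Qed.

Let sig_gt0 k : 0 < sig k. Proof. exact: kick_param_gt0. Qed.

Let sig_le k : sig k <= 8 * am k. Proof. exact: kick_param_le. Qed.

(** The bound [2 * (share k * small)] is the square root of [40 * am k], whereas the orbit satisfies
    y_m^2 <= am^2 + 8 am, because [m k] is at least 1 / [am k]. *)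
Let orbitP k : exists xy : (nat -> R) * (nat -> R),
  [/\ (forall j, xy.1 j.+1 = xy.1 j + xy.2 j),
      (forall j, xy.2 j.+1 = xy.2 j + sig k * sin (2 * pi * xy.1 j.+1)),
      (forall j, xy.2 (j + q k)%N = xy.2 j) &
  [/\ (forall j, 0 <= xy.2 j <= xy.2 (m k)), xy.2 (m k) <= 2 * (share k * small) &
      (forall j, (j %% q k)%N != m k -> xy.2 j <= xy.2 (m k) - sig k ^+ 2 / 8)]].
Proof.
have [a1 a2] := am_small k.
have sig64 : sig k <= 64^-1.
  by have := sig_le k; have := small_bd; lra.
have m8 : (8 <= m k)%N.
  rewrite /m /half_period ltn_addr// -[X in (X <= _)%N](muln1 8) -mulnn.
  by rewrite leq_mul// (leq_trans _ (n_ge16 k)).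
have [x [y [xS yS _ y_per [y_bd ym2 y_gap _]]]] := standard_map_orbit (sig_gt0 k) sig64 m8.
exists (x, y); split=> //; split=> //=.
have m_ge : (am k)^-1 <= (m k)%:R.
  rewrite (le_trans _ (half_period_ge _ _ _ _))// -[leLHS]mul1r ler_pM2r ?invr_gt0//.
  exact: spot_loss_ge1.
have m_inv : ((m k)%:R * 2)^-1 <= am k.
  rewrite -[leRHS]invrK lef_pV2 ?posrE ?invr_gt0 ?mulr_gt0 ?ltr0n ?(leq_trans _ m8)//.
  by rewrite (le_trans m_ge)// ler_peMr ?ler0n// ler1n.
have ym0 : 0 <= y (m k) by have /andP[] := y_bd (m k).
have t0 : 0 <= share k * small.
  by apply: mulr_ge0 (ltW (share_gt0 k)) _; rewrite invr_ge0 exprn_ge0.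
rewrite -(ler_pXn2r (n := 2)) ?nnegrE//; last exact: mulr_ge0 (ler0n _ 2) t0.
rewrite (le_trans ym2)//.
have i0 : 0 <= ((m k)%:R * 2)^-1 :> R by rewrite invr_ge0 mulr_ge0// ler0n.
have h1 : ((m k)%:R * 2)^-1 ^+ 2 <= am k ^+ 2 by rewrite lerXn2r// nnegrE// ltW.
have h2 : am k ^+ 2 <= am k.
  by rewrite expr2 ler_piMr ?(ltW (am_gt0 k))//; have := small_bd; lra.
have h3 : (2 * (share k * small)) ^+ 2 = 10 * (4 * am k) by rewrite amE; field.
by have := sig_le k; have := am_gt0 k; lra.
Qed.

Let x k := (sval (cid (orbitP k))).1.
Let y k := (sval (cid (orbitP k))).2.
Let xyP k := svalP (cid (orbitP k)).

Let top k : R := y k (m k) / (n k)%:R.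

Definition spots (k : nat) : set R := [set c + top k | c in centers k].

Let spots_periodic k c : spots k (c + 1) <-> spots k c.
Proof.
split=> -[d dk dE].
  by exists (d - 1); [apply/centers_periodic; rewrite subrK|rewrite -[c](addrK 1) -dE; ring].
by exists (d + 1); [apply/centers_periodic|rewrite -dE; ring].
Qed.

Let dlt_gt0 k : 0 < dlt k. Proof. exact: spot_width_gt0. Qed.

Let gap5_gt0 k : 0 < gap k / 5. Proof. by rewrite divr_gt0. Qed.

Let YP k := cid (gevrey_cutoff alpha_gt1 D_gt0 (ltn0Sn _) (gap5_gt0 k)
  (cutoff_orderP alpha_gt1 D_gt0 (gap5_gt0 k)) (centers_periodic k)).
Let Y k := sval (YP k).

Let KP k := cid (gevrey_cutoff alpha_gt1 D_gt0 (ltn0Sn _) (dlt_gt0 k)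
  (cutoff_orderP alpha_gt1 D_gt0 (dlt_gt0 k)) (spots_periodic k)).
Let K k := sval (KP k).

Let Y_spec k : [/\ gevrey_jet alpha D ((2 `^ alpha) ^+ J k) (Y k),
  (forall a x, Y k a (x + 1) = Y k a x),
  (forall x, (exists2 c, centers k c & `|x - c| <= gap k / 5) -> Y k 0 x = 1),
  (forall x, (exists2 c, centers k c & `|x - c| < gap k / 5) -> forall a, Y k a.+1 x = 0)
  & (forall x, (forall c, centers k c -> 5 * (gap k / 5) <= `|x - c|) -> forall a, Y k a x = 0)].
Proof. exact: svalP (YP k). Qed.

Let K_spec k : [/\ gevrey_jet alpha D ((2 `^ alpha) ^+ spot_order alpha D (share k) (n k)) (K k),
  (forall a x, K k a (x + 1) = K k a x),
  (forall x, (exists2 c, spots k c & `|x - c| <= dlt k) -> K k 0 x = 1),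
  (forall x, (exists2 c, spots k c & `|x - c| < dlt k) -> forall a, K k a.+1 x = 0)
  & (forall x, (forall c, spots k c -> 5 * dlt k <= `|x - c|) -> forall a, K k a x = 0)].
Proof. exact: svalP (KP k). Qed.

Definition su (a b : nat) (th r : R) : R :=
  dsum (fun k => (mu k * cos_jet (2 * pi * (n k)%:R) a th) * Y k b r).

Definition sv (a b : nat) (th r : R) : R :=
  dsum (fun k => ((2 * pi * (q k)%:R)^-1 * cos_jet (2 * pi) a th) * K k b r).

Let pi_pos : 0 < 2 * pi :> R. Proof. by rewrite mulr_gt0// pi_gt0. Qed.

Let kl_gt0 k : 0 < kick_loss alpha D (share k) (n k).
Proof. by rewrite (lt_le_trans ltr01)// kick_loss_ge1. Qed.

Let mu_ge0 k : 0 <= mu k.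
Proof.
rewrite /mu /kick_size; apply: divr_ge0; first exact: ltW (am_gt0 k).
exact: mulr_ge0 (ltW (kl_gt0 k)) (exprn_ge0 _ (ler0n _ _)).
Qed.

Let am_share k : am k <= (e / 100) / 2 ^+ k.+1.
Proof.
have [_ h] := am_small k.
have -> : e / 100 / 2 ^+ k.+1 = share k / (10 * 20).
  by rewrite /share exprS; field; rewrite expf_neq0.
rewrite (le_trans h)// ler_pM2l//.
by have := small_bd; lra.
Qed.

(** [mu] cancels [kick_loss] and leaves [am k] over n^2; moreover [am k] is at most a thousandth of
    [share k], and the term allowed by the series is a two-hundredth of it. *)
Lemma su_bijet : gevrey_bijet alpha D (e / 100) su.
Proof.
apply: (@tensor_series _ _ _ _ (fun k a th => mu k * cos_jet (2 * pi * (n k)%:R) a th) Y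
  (fun k => mu k * trig_weight alpha D (2 * pi * (n k)%:R)) (fun k => (2 `^ alpha) ^+ J k)) => //.
- move=> k; apply: gevrey_jet_scale (mu_ge0 k) _; apply: gevrey_cos_jet => //.
  by rewrite mulr_ge0 ?(ltW pi_pos).
- by move=> k; have [] := Y_spec k.
move=> k; apply: le_trans (am_share k).
have -> : mu k * trig_weight alpha D (2 * pi * (n k)%:R) * (2 `^ alpha) ^+ J k =
    mu k * kick_loss alpha D (share k) (n k) by rewrite -mulrA.
have cancel (a b c : R) : b != 0 -> a / (b * c) * b = a / c.
  by move=> b0; rewrite invfM mulrA mulrAC divfK.
rewrite /mu /kick_size cancel ?gt_eqF// -/(am k).
rewrite ler_pdivrMr ?exprn_gt0// ler_peMr ?(ltW (am_gt0 k))// exprn_ege1// ler1n//.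
Qed.

(** The length of the period pays for the cutoff: [spot_loss] is at most the amplitude times q. *)
Lemma sv_bijet : gevrey_bijet alpha D (e / 100) sv.
Proof.
have q0 k : 0 < (q k)%:R :> R by rewrite ltr0n.
apply: (@tensor_series _ _ _ _
  (fun k a th => (2 * pi * (q k)%:R)^-1 * cos_jet (2 * pi) a th) K
  (fun k => (2 * pi * (q k)%:R)^-1 * trig_weight alpha D (2 * pi))
  (fun k => (2 `^ alpha) ^+ spot_order alpha D (share k) (n k))) => //.
- move=> k; apply: gevrey_jet_scale; first by rewrite invr_ge0 mulr_ge0// ltW.
  by apply: gevrey_cos_jet => //; exact: ltW.
- by move=> k; have [] := K_spec k.
move=> k; apply: le_trans (am_share k).
have -> : (2 * pi * (q k)%:R)^-1 * trig_weight alpha D (2 * pi) *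
    (2 `^ alpha) ^+ spot_order alpha D (share k) (n k) =
    (2 * pi * (q k)%:R)^-1 * spot_loss alpha D (share k) (n k) by rewrite -mulrA.
rewrite ler_pdivrMl ?mulr_gt0// ?pi_gt0//.
have hp := half_period_ge alpha D (share k) (n k).
rewrite ler_pdivrMr ?amplitude_gt0// in hp.
apply: (le_trans hp); rewrite ler_pM2r ?am_gt0//.
apply: (@le_trans _ _ (q k)%:R).
  by rewrite ler_nat /q /period leqW// -addnn leq_addr.
rewrite ler_peMl ?ler0n//; have := @pi_ge2 R; lra.
Qed.

Let far_Y j r : (forall c, centers j c -> gap j <= `|r - c|) -> forall a, Y j a r = 0.
Proof.
have [_ _ _ _ H] := Y_spec j; move=> far; apply: H => c /far.
by rewrite mulrC divfK.
Qed.

Let top_lt j : 0 <= top j /\ top j < gap j / 5.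
Proof.
have [_ _ _ [y_bd ym _]] := xyP j; split.
  by apply: divr_ge0; [have /andP[] := y_bd (m j)|exact: ler0n].
rewrite /top /gap /gap_width.
have -> : share j / (80 * (n j)%:R) / 5 = (share j / 80 / 5) / (n j)%:R.
  by field; rewrite gt_eqF.
rewrite ltr_pM2r ?invr_gt0// (le_lt_trans ym)//.
have -> : 2 * (share j * small) = share j * (2 * small) by ring.
rewrite -mulrA ltr_pM2l//.
by have := small_bd; lra.
Qed.

Let sig_sq j : 0 < sig j ^+ 2 /\ sig j ^+ 2 <= 8 * am j.
Proof.
split; first by rewrite exprn_gt0.
rewrite (le_trans _ (sig_le j))// expr2 ler_piMr ?(ltW (sig_gt0 j))//.
by have := sig_le j; have := (am_small j).1; have := small_bd; lra.
Qed.

Let dlt5 j : 5 * dlt j = sig j ^+ 2 / 16 / (n j)%:R.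
Proof. by rewrite /dlt /spot_width -/(sig j); field; rewrite gt_eqF. Qed.

(** A spot sits less than [gap j / 5] above its center and its cutoff vanishes from
    [5 * dlt j <= gap j / 5] on, so it lies inside the gap. *)
Let far_K j r : (forall c, centers j c -> gap j <= `|r - c|) -> forall a, K j a r = 0.
Proof.
have [_ _ _ _ H] := K_spec j; move=> far; apply: H => _ [c cj <-].
have [t0 t1] := top_lt j.
have d5 : 5 * dlt j <= gap j / 5.
  rewrite dlt5 /gap /gap_width.
  have -> : share j / (80 * (n j)%:R) / 5 = (share j / 80 / 5) / (n j)%:R.
    by field; rewrite gt_eqF.
  rewrite ler_pM2r ?invr_gt0//.
  have [_ h1] := sig_sq j; have [_ h2] := am_small j.
  have h3 : share j * (small * (10 * 10 * 10)) = share j by rewrite small_bd mulr1.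
  by have := share_gt0 j; lra.
have := far c cj; have := ler_distD (r - top j) r c.
have -> : r - (r - top j) = top j by ring.
have -> : r - top j - c = r - (c + top j) by ring.
by rewrite (ger0_norm t0); lra.
Qed.

Let su_single k c a b th r : centers k c -> `|r - c| < gap k ->
  su a b th r = (mu k * cos_jet (2 * pi * (n k)%:R) a th) * Y k b r.
Proof.
move=> ck rc; rewrite /su (@dsum_single _ _ k)// => j jk.
rewrite (@far_Y j r) ?mulr0// => c' c'j; exact: centers_far ck rc c'j jk.
Qed.

Let sv_single k c a b th r : centers k c -> `|r - c| < gap k ->
  sv a b th r = ((2 * pi * (q k)%:R)^-1 * cos_jet (2 * pi) a th) * K k b r.
Proof.
move=> ck rc; rewrite /sv (@dsum_single _ _ k)// => j jk.
rewrite (@far_K j r) ?mulr0// => c' c'j; exact: centers_far ck rc c'j jk.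
Qed.

Lemma su_good a b th r : good r -> su a b th r = 0.
Proof.
move=> Gr; apply: dsum0 => k; rewrite (@far_Y k r) ?mulr0// => c; exact: good_far.
Qed.

Lemma sv_good a b th r : good r -> sv a b th r = 0.
Proof.
move=> Gr; apply: dsum0 => k; rewrite (@far_K k r) ?mulr0// => c; exact: good_far.
Qed.

Let cos_jet0_periodic (N : nat) th :
  cos_jet (2 * pi * N%:R) 0 (th + 1) = cos_jet (2 * pi * N%:R) 0 th :> R.
Proof.
rewrite /cos_jet !mul0r !addr0 !expr0 !mul1r.
have -> : 2 * pi * N%:R * (th + 1) = 2 * pi * (N%:R * th + (N%:Z)%:~R) :> R.
  by rewrite -pmulrn; ring.
by rewrite (sin_cos_turn _ _).2; congr cos; ring.
Qed.

Lemma su_periodic th r :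
  su 0 0 (th + 1) r = su 0 0 th r /\ su 0 0 th (r + 1) = su 0 0 th r.
Proof.
split; congr dsum; apply/funext => k.
  by rewrite cos_jet0_periodic.
by have [_ -> _ _ _] := Y_spec k.
Qed.

Lemma sv_periodic th r :
  sv 0 0 (th + 1) r = sv 0 0 th r /\ sv 0 0 th (r + 1) = sv 0 0 th r.
Proof.
split; congr dsum; apply/funext => k.
  by have := cos_jet0_periodic 1 th; rewrite !mulr1 => ->.
by have [_ -> _ _ _] := K_spec k.
Qed.

Let su_gap k c th r : centers k c -> `|r - c| < gap k / 5 ->
  su 0 1 th r = 0 /\
  su 1 0 th r = - (2 * pi * (n k)%:R * mu k * sin (2 * pi * (n k)%:R * th)).
Proof.
move=> ck rc.
have rc' : `|r - c| < gap k by rewrite (lt_le_trans rc)//; have := gap_gt0 k; lra.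
have [_ _ Y1 Y0 _] := Y_spec k.
rewrite !(su_single _ _ _ ck rc') (Y0 _ _ 0%N); last by exists c.
rewrite (Y1 r); last by exists c; rewrite // ltW.
rewrite mulr0 mulr1; split=> //.
by rewrite /cos_jet mul1r cosDpihalf expr1; ring.
Qed.

(** The spot of the same circle is avoided thanks to the action gap, which is twice [5 * dlt k] in
    r_1; other circles of the generation are at least 1 / n away, and other generations have
    disjoint supports. *)
Let sv_off k c j th : centers k c -> (j %% q k)%N != m k ->
  sv 0 1 th (c + y k j / (n k)%:R) = 0 /\ sv 1 0 th (c + y k j / (n k)%:R) = 0.
Proof.
move=> ck jm; have [_ _ _ [y_bd ym y_gap]] := xyP k.
have [t0 t1] := top_lt k.
have /andP[yj0 yj1] := y_bd j.
have yjt : y k j / (n k)%:R <= top k by rewrite ler_pM2r ?invr_gt0.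
have yj0' : 0 <= y k j / (n k)%:R by rewrite divr_ge0.
have rc : `|c + y k j / (n k)%:R - c| < gap k.
  by rewrite addrAC subrr add0r ger0_norm//; have := gap_gt0 k; lra.
have [_ _ _ _ K0] := K_spec k.
have dlt_le : 5 * dlt k <= 2^-1 / (n k)%:R.
  rewrite dlt5 ler_pM2r ?invr_gt0//.
  by have := (sig_sq k).2; have := (am_small k).1; have := small_bd; lra.
suff far c' : centers k c' -> 5 * dlt k <= `|c + y k j / (n k)%:R - (c' + top k)|.
  by rewrite !(sv_single _ _ _ ck rc) !K0 ?mulr0// => _ [c' c'k <-]; exact: far.
have [-> _|cc' [p' _ pE']] := eqVneq c' c.
  have -> : c + y k j / (n k)%:R - (c + top k) = - ((y k (m k) - y k j) / (n k)%:R).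
    by rewrite /top; ring.
  rewrite dlt5 normrN (le_trans _ (ler_norm _))// ler_pM2r ?invr_gt0//.
  by have := y_gap j jm; have := (sig_sq k).1; rewrite -/(y k); lra.
have [p _ pE] := ck.
have pp' : p != p'.
  by apply: contra cc' => /eqP pp; apply/eqP; apply: (addIr om1); rewrite pE pE' pp.
have cc1 : (n k)%:R^-1 <= `|c - c'|.
  have -> : c - c' = (p - p')%:~R / (n k)%:R by rewrite intrB mulrBl -pE -pE'; ring.
  rewrite normrM normfV (gtr0_norm (nR_gt0 k)) ler_peMl ?invr_ge0 ?ler0n//.
  by rewrite -intr_norm ler1z -gtz0_ge1 normr_gt0 subr_eq0.
have h1 := ler_distD (c + y k j / (n k)%:R - top k) c c'.
have h2 : `|c - (c + y k j / (n k)%:R - top k)| <= gap k / 5.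
  rewrite (_ : c - _ = top k - y k j / (n k)%:R); last by ring.
  by rewrite ger0_norm ?subr_ge0//; lra.
have -> : c + y k j / (n k)%:R - (c' + top k) = c + y k j / (n k)%:R - top k - c' by ring.
by have := gap_small k; lra.
Qed.

Let sv_spot k c th : centers k c ->
  sv 0 1 th (c + top k) =
    ((2 * pi * (q k)%:R)^-1 * K k 1 (c + top k)) * cos (2 * pi * th) /\
  sv 1 0 th (c + top k) = - ((q k)%:R^-1 * sin (2 * pi * th)).
Proof.
move=> ck; have [t0 t1] := top_lt k.
have rc : `|c + top k - c| < gap k.
  by rewrite addrAC subrr add0r ger0_norm//; have := gap_gt0 k; lra.
have [_ _ K1 _ _] := K_spec k.
rewrite !(sv_single _ _ _ ck rc) (K1 (c + top k)); last first.
  by exists (c + top k); [exists c|rewrite subrr normr0 ltW].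
split; first by rewrite /cos_jet expr0 mul0r addr0 mul1r; ring.
rewrite /cos_jet mul1r cosDpihalf expr1 mulr1.
have q0 : (q k)%:R != 0 :> R by rewrite pnatr_eq0.
have := lt0r_neq0 (@pi_gt0 R); move: (sin _) => S; move: pi => P P0.
by field; rewrite P0 q0.
Qed.

Lemma construction_escape (om : 'rV[R]_2) (Phiu : 'rV[R]_(2 + 2) -> 'rV[R]_(2 + 2)) :
  om 0 ord0 = om1 ->
  (forall (z : 'rV[R]_(2 + 2))
    (x0 := z 0 (lshift 2 ord0)) (y0 := z 0 (rshift 2 ord0)),
    (forall t, 0 <= t <= 1 ->
      su 0%N 1%N (x0 + t * su 0%N 1%N x0 y0) (y0 - t * su 1%N 0%N x0 y0) =
        su 0%N 1%N x0 y0 /\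
      su 1%N 0%N (x0 + t * su 0%N 1%N x0 y0) (y0 - t * su 1%N 0%N x0 y0) =
        su 1%N 0%N x0 y0) ->
    Phiu z = z + hamiltonian_field
      (lift2 (lshift 2 (ord0 : 'I_2)) (rshift 2 (ord0 : 'I_2)) (su 0%N 0%N)) z) ->
  forall k (z : 'rV[R]_(2 + 2)), good (z 0 (rshift 2 ord0)) ->
  exists2 zhat, flat_dist zhat z <= 4 / (n k)%:R &
    forall i : nat, i.+1%:R / (period alpha D (share k) (n k))%:R - 1 <=
      flat_dist (iter (n k + i * period alpha D (share k) (n k))
        (drift_map om sv Phiu) zhat) z.
Proof.
move=> omE PhiuE k z Gz.
have [c ck zc] := good_near k Gz.
have [xS yS y_per [y_bd ym y_gap]] := xyP k.
have [p _ pE] := ck; rewrite -omE in pE.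
have [t0 t1] := top_lt k.
have ym1 : y k (m k) <= 1.
  rewrite (le_trans ym)//.
  have : share k * small <= small by rewrite ler_piMl// invr_ge0 exprn_ge0.
  by have := small_bd; lra.
have nm : (n k <= m k)%N.
  by rewrite /m /half_period (leq_trans _ (leq_addr _ _))// -mulnn leq_pmulr.
have nq := period_ge_sq alpha D (share k) (n k).
have n2 : (1 < n k)%N by rewrite (leq_trans _ (n_ge16 k)).
have sigE : sig k = 2 * pi * (n k)%:R ^+ 2 * mu k by exact: kick_paramE.
exact: (drift_escape (gevrey_bijet_bounded su_bijet) sv_bijet.1 PhiuE n2 nm nq sigE pE
  xS yS y_per y_bd ym1 t1 (fun th r rc => su_gap th ck rc)
  (fun j th jm => sv_off th ck jm) (fun th => sv_spot th ck) zc).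
Qed.

End Construction.

(** * Assembly of the theorem *)

Section Assembly.
Context {R : realType}.

(** About q (E2 + 1) periods suffice, which takes time at most q + q^2 (E2 + 1) <= 3 q^2 E2. *)
Lemma escape_time (E1 E2 : R) (n q : nat) : (0 < n)%N -> (n <= q)%N -> 1 <= E2 ->
  3 * q%:R ^+ 2 * E2 <= E1 ->
  exists i : nat, (n + i * q)%:R <= E1 /\ E2 <= i.+1%:R / q%:R - 1.
Proof.
move=> n0 nq E2_ge1 qE.
have q1 : 1 <= q%:R :> R by rewrite ler1n (leq_trans n0).
have q0 : 0 < q%:R :> R by exact: lt_le_trans ltr01 q1.
have b0 : 0 <= q%:R * (E2 + 1) by apply: mulr_ge0; [exact: ltW|lra].
have i1 : (Num.truncn (q%:R * (E2 + 1)))%:R <= q%:R * (E2 + 1) by rewrite truncn_le.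
have i2 := truncnS_gt (q%:R * (E2 + 1)).
exists (Num.truncn (q%:R * (E2 + 1))); move: (Num.truncn _) i1 i2 => i i1 i2.
split; last by rewrite lerBrDr ler_pdivlMr// mulrC ltW.
apply: le_trans qE; rewrite natrD natrM.
have h1 : i%:R * q%:R <= q%:R * (E2 + 1) * q%:R by rewrite ler_pM2r.
have h2 : n%:R <= q%:R :> R by rewrite ler_nat.
have h3 : q%:R <= q%:R ^+ 2 :> R by rewrite expr2 ler_peMr// ltW.
have h4 : q%:R ^+ 2 <= q%:R ^+ 2 * E2 by rewrite ler_peMr// exprn_ge0// ltW.
have -> : 3 * q%:R ^+ 2 * E2 = q%:R * (E2 + 1) * q%:R + (2 * (q%:R ^+ 2 * E2) - q%:R ^+ 2).
  by ring.
lra.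
Qed.

Lemma lift2_shift N (i j k : 'I_N) (f : R -> R -> R) x :
  lift2 i j f (x + basis_vec k) = f (x 0 i + (i == k)%:R) (x 0 j + (j == k)%:R).
Proof. by rewrite /lift2 !mxE !eqxx. Qed.

Lemma gevrey_lift2 n m (a : 'I_n) (b : 'I_m) (alpha D L M : R) s :
  0 < alpha -> 0 < L -> 0 < D -> D * L `^ alpha <= 2^-1 -> 0 <= M ->
  gevrey_bijet alpha D M s ->
  (forall th r, s 0%N 0%N (th + 1) r = s 0%N 0%N th r) ->
  gevrey alpha L (lift2 (lshift m a) (rshift n b) (s 0%N 0%N)).
Proof.
move=> al0 L0 D0 DL M0 gs per.
have ab : lshift m a != rshift n b by rewrite eq_lrshift.
have sm := lift2_smooth ab (gevrey_bijet_bounded gs).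
split; first exact: sm.
  move=> i x; rewrite lift2_shift eq_lshift eq_rlshift addr0 /lift2.
  by case: (a == i); rewrite ?addr0.
apply: le_lt_trans (ltry _); exact: gevrey_norm_lift2 al0 L0 D0 DL M0 gs.
Qed.

Lemma periodic_along_lift2 n m (a : 'I_n) (b : 'I_m) (f : R -> R -> R) :
  (forall th r, f th (r + 1) = f th r) ->
  periodic_along (rshift n b) (lift2 (lshift m a) (rshift n b) f).
Proof. by move=> per x; rewrite lift2_shift eq_lrshift eqxx addr0 per. Qed.

Lemma T0_torus (om r : 'rV[R]_2) : T0 om @` torus r = torus r.
Proof.
apply/seteqP; split=> [_ [z zr <-]|z zr]; first by rewrite /torus/= /T0 row_mxKr.
exists (row_mx (lsubmx z - om - r) (rsubmx z)); first by rewrite /torus/= row_mxKr.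
by rewrite /T0 row_mxKl row_mxKr (zr : rsubmx z = r) addrAC !subrK -(zr : rsubmx z = r) hsubmxK.
Qed.

Lemma hamiltonian_field_eq0 (a b : 'I_2) s (z : 'rV[R]_(2 + 2)) : bijet s ->
  s 0%N 1%N (z 0 (lshift 2 a)) (z 0 (rshift 2 b)) = 0 ->
  s 1%N 0%N (z 0 (lshift 2 a)) (z 0 (rshift 2 b)) = 0 ->
  hamiltonian_field (lift2 (lshift 2 a) (rshift 2 b) (s 0%N 0%N)) z = 0.
Proof.
move=> js s01 s10; apply/rowP => i; rewrite [RHS]mxE.
case: (split_ordP i) => j ->; first by rewrite field_lshift// s01 mulr0.
by rewrite field_rshift// s10 mulr0 oppr0.
Qed.

Lemma harmonic_squeeze (c : R) (n : nat -> nat) : 0 <= c -> (forall k, (k < n k)%N) ->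
  c / (n k)%:R @[k --> \oo] --> (0 : R).
Proof.
move=> c0 kn; apply: (@squeeze_cvgr _ _ _ _ (fun=> 0) (fun k => c * harmonic k)).
- apply: nearW => k; rewrite divr_ge0//= ler_wpM2l// lef_pV2 ?posrE ?ltr0n//.
    by rewrite ler_nat.
  exact: leq_ltn_trans (kn k).
- exact: cvg_cst.
by rewrite -(mulr0 c); apply: cvgMr; exact: cvg_harmonic.
Qed.

End Assembly.

Theorem theorem3p4 (R : realType) (omega : 'rV[R]_2) (alpha L : R)
    (halpha : 1 < alpha) (hL : 0 < L) :
  exists2 C : R, 0 < C &
  forall eps : R, 0 < eps ->
  exists (u : 'rV[R]_(1 + 1) -> R) (v : 'rV[R]_(2 + 2) -> R) (X : set R),
    [/\ gevrey alpha L u, gevrey alpha L v,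
        periodic_along idx_r1_M1 u & periodic_along idx_r1 v] /\
    [/\ closed X, X `<=` `[0, 1]
      & ((1 - eps)%:E <= lebesgue_measure X)%E] /\
    (flat_on [set x : 'rV[R]_(1 + 1) | plus_int X (x 0 idx_r1_M1)] u /\
     flat_on [set x : 'rV[R]_(2 + 2) | plus_int X (x 0 idx_r1)] v) /\
    (gevrey_norm alpha L u + gevrey_norm alpha L v < eps%:E)%E /\
    exists Phiu Phiv : 'rV[R]_(2 + 2) -> 'rV[R]_(2 + 2),
      [/\ time_one_map (u \o proj_M1) Phiu,
          time_one_map v Phiv
        & let T := Phiv \o Phiu \o T0 omega in
          forall r : 'rV[R]_2, plus_int X (r 0 0) ->
            T @` torus r = torus r /\
            diffusive (dbl_exp_star C (1 / (alpha - 1))) (@flat_dist R 2 2)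
                      T (torus r)].
Proof.
exists 1 => // eps eps0.
have al0 : 0 < alpha := lt_trans ltr01 halpha.
set gam := 1 / (alpha - 1).
have gam0 : 0 < gam by rewrite divr_gt0// subr_gt0.
(* Gives D L^alpha = 1/2, the ratio that makes the sum in the Gevrey norm geometric. *)
pose D := L `^ (- alpha) / 2.
have D0 : 0 < D by rewrite divr_gt0// powR_gt0.
have DL : D * L `^ alpha <= 2^-1.
  by rewrite /D mulrAC powRN mulVf ?mul1r// gt_eqF// powR_gt0.
pose e := Num.min eps 1.
have e0 : 0 < e by rewrite lt_min eps0 ltr01.
have e1 : e <= 1 by rewrite ge_min lexx orbT.
have e_eps : e <= eps by rewrite ge_min lexx.
have share0 k : 0 < share e k by rewrite divr_gt0// exprn_gt0.
have NP k : exists N, forall n, (N <= n)%N -> [/\ (16 <= n)%N,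
    1 <= dbl_exp_star 1 gam (2 * (4 / n%:R)) &
    3 * (period alpha D (share e k) n)%:R ^+ 2 * dbl_exp_star 1 gam (2 * (4 / n%:R)) <=
    dbl_exp_star 1 gam (4 / n%:R)].
  have [B B0 HB] := period_growth halpha D0 (share0 k).
  have [N HN] := dbl_exp_star_growth gam0 B0; exists N => n /HN[n16 E1 E2].
  split; [exact: n16|exact: E1|apply: le_trans E2].
  have n_gt0 : (0 < n)%N by exact: leq_trans n16.
  exact: (ler_wpM2r (le_trans ler01 E1) (HB n n_gt0)).
pose N k := sval (cid (NP k)).
have w0 k n : (0 < n)%N -> 0 < gap_width (share e k) n by move=> n0; exact: gap_width_gt0.
(* [N k] is the threshold beyond which the growth estimate holds for [share e k]; [k.+1] forces
   [n k] to tend to infinity. *)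
pose n := frequency (fun k => maxn (N k) k.+1) (fun k => gap_width (share e k)).
have nP k : [/\ (N k <= n k)%N, (k < n k)%N & 2 / (n k.+1)%:R <= gap e n k].
  have [Nn _ wn] := frequencyP (fun k => maxn (N k) k.+1) w0 k.
  by move: Nn; rewrite geq_max => /andP[].
have growth k := svalP (cid (NP k)) (n k) (let: And3 h _ _ := nP k in h).
have n16 k : (16 <= n k)%N by case: (growth k).
have n_gt0 k : (0 < n k)%N by exact: leq_trans (n16 k).
have gap_lrg k : 2 / (n k.+1)%:R <= gap e n k by case: (nP k).
pose om1 := omega 0 ord0.
pose su := su om1 halpha D0 e0 n16.
pose sv := sv om1 halpha D0 e0 e1 n16.
have gsu : gevrey_bijet alpha D (e / 100) su by exact: su_bijet.
have gsv : gevrey_bijet alpha D (e / 100) sv by exact: sv_bijet.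
have su_per := su_periodic om1 halpha D0 e0 n16.
have sv_per := sv_periodic om1 halpha D0 e0 e1 n16.
pose u : 'rV[R]_(1 + 1) -> R := lift2 (lshift 1 ord0) (rshift 1 ord0) (su 0%N 0%N).
(* Depending on theta_2 and r_1, this Hamiltonian acts on r_2 and theta_1. *)
pose v : 'rV[R]_(2 + 2) -> R := lift2 (lshift 2 ord_max) (rshift 2 ord0) (sv 0%N 0%N).
pose X := good_freq om1 n (gap e n).
have M0 : 0 <= e / 100 by rewrite divr_ge0// ltW.
exists u, v, X; split; [split|split; [split|split; [split|split]]].
- by apply: (gevrey_lift2 _ _ al0 hL D0 DL M0 gsu) => th r; case: (su_per th r).
- by apply: (gevrey_lift2 _ _ al0 hL D0 DL M0 gsv) => th r; case: (sv_per th r).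
- by apply: periodic_along_lift2 => th r; case: (su_per th r).
- by apply: periodic_along_lift2 => th r; case: (sv_per th r).
- exact: good_freq_closed.
- by move=> x [].
- apply: (@le_trans _ _ (1 - e)%:E); first by rewrite lee_fin lerB.
  apply: good_freq_measure => // k; exact: gap_width_gt0.
- move=> l x Xx; apply: multi_partial_lift2_eq0; [by rewrite eq_lrshift|exact: gsu.1|].
  by move=> a b; exact: su_good.
- move=> l x Xx; apply: multi_partial_lift2_eq0; [by rewrite eq_lrshift|exact: gsv.1|].
  by move=> a b; exact: sv_good.
- apply: (@le_lt_trans _ _ ((4 * (e / 100))%:E + (4 * (e / 100))%:E)%E).
    have i_neq n1 n2 (i : 'I_n1) (j : 'I_n2) : lshift n2 i != rshift n1 j by rewrite eq_lrshift.
    apply: leeD.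
      exact: (gevrey_norm_lift2 (i_neq _ _ _ _) al0 hL D0 DL M0 gsu).
    exact: (gevrey_norm_lift2 (i_neq _ _ _ _) al0 hL D0 DL M0 gsv).
  by rewrite -EFinD lte_fin; lra.
have [Phiu PhiuP PhiuE] := planar_flow (ord0 : 'I_2) (gevrey_bijet_bounded gsu).
have neq : (ord_max : 'I_2) != ord0 by [].
have PhivP := shear_flow gsv.1 neq.
exists Phiu; eexists; split; [|exact: PhivP|].
  have -> : u \o proj_M1 = lift2 (lshift 2 ord0) (rshift 2 ord0) (su 0%N 0%N) => //.
  by apply/funext => z; rewrite /u /lift2 /= /proj_M1 row_mxEl row_mxEr !mxE.
move=> T r Xr.
have r00 : (0 : 'I_2) = ord0 by exact: val_inj.
rewrite {}r00 in Xr.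
(* For r_1 in [X] + Z all terms of both jets vanish, hence so do both fields, and [T] coincides with
   [T0 omega] on the torus. *)
have TE z : torus r z -> T z = T0 omega z.
  move=> zr.
  have goodz w : rsubmx w = r -> plus_int X (w 0 (rshift 2 ord0)).
    by move=> wr; have := Xr; rewrite -wr mxE.
  have uE : Phiu (T0 omega z) = T0 omega z.
    have T0r : rsubmx (T0 omega z) = r by rewrite /T0 row_mxKr.
    rewrite PhiuE => [|t _].
      rewrite hamiltonian_field_eq0 ?addr0//; [exact: gsu.1| |]; apply: su_good; exact: goodz.
    have g01 th : su 0%N 1%N th (T0 omega z 0 (rshift 2 ord0)) = 0.
      by apply: su_good; exact: goodz.
    have g10 th : su 1%N 0%N th (T0 omega z 0 (rshift 2 ord0)) = 0.
      by apply: su_good; exact: goodz.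
    by rewrite !(g01, g10, mulr0, subr0).
  rewrite /T /= uE hamiltonian_field_eq0 ?addr0//; [exact: gsv.1| |];
    apply: sv_good; apply: goodz; rewrite /T0 row_mxKr//.
split.
  rewrite -[RHS](T0_torus omega); apply/seteqP.
  by split=> _ [z zr <-]; exists z; rewrite // TE.
exists (fun k => 4 / (n k)%:R); split.
- move=> k; rewrite divr_gt0 ?ltr0n//= ltr_pdivrMr ?ltr0n//.
  by have : 16 <= (n k)%:R :> R; [rewrite ler_nat|lra].
- by apply: harmonic_squeeze => // k; case: (nP k).
move=> k z zr.
have Xz : plus_int X (z 0 (rshift 2 ord0)) by have := Xr; rewrite -zr mxE.
have [zhat zhat_near esc] := construction_escape e1 gap_lrg (erefl om1) PhiuE k Xz.
have [_ E1 E2] := growth k.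
have nq : (n k <= period alpha D (share e k) (n k))%N.
  by rewrite (leq_trans _ (period_ge_sq _ _ _ _))// -mulnn leq_pmulr.
have [i [ti iE]] := escape_time (n_gt0 k) nq E1 E2.
exists zhat, (n k + i * period alpha D (share e k) (n k))%N; split=> //.
- by rewrite addn_gt0 n_gt0.
- exact: le_trans iE (esc i).
Qed.
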